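(* Let $\Lambda$ be an Artin algebra. If the subcategory $\mathcal{P}^\infty(\Lambda\text{-mod})$ of $\Lambda\text{-mod}$ is contravariantly finite, then it is also covariantly finite in $\Lambda\text{-mod}$. In particular, $\mathcal{P}^\infty(\Lambda\text{-mod})$ has almost split sequences in that case.
   Context: $\Lambda\text{-mod}$ is the category of finitely generated left $\Lambda$-modules, and $\mathcal{P}^\infty(\Lambda\text{-mod})$ is its full subcategory consisting of the modules of finite projective dimension. A full subcategory $\mathcal{A}$ of $\Lambda\text{-mod}$ is contravariantly finite in $\Lambda\text{-mod}$ if for every $M\in\Lambda\text{-mod}$ there are $A\in\mathcal{A}$ and a homomorphism $f:A\to M$ such that every homomorphism $B\to M$ with $B\in\mathcal{A}$ factors through $f$. Dually, $\mathcal{A}$ is covariantly finite in $\Lambda\text{-mod}$ if for every $M\in\Lambda\text{-mod}$ there are $A\in\mathcal{A}$ and a homomorphism $f:M\to A$ such that every homomorphism $M\to B$ with $B\in\mathcal{A}$ factors through $f$. Existence of almost split sequences in a full subcategory $\mathcal{A}$ of $\Lambda\text{-mod}$ closed under extensions and direct summands is understood in the usual sense of Auslander and Smal\o: an exact sequence $0\to A\xrightarrow{u} B\xrightarrow{v} C\to 0$ with $A,B,C\in\mathcal{A}$ is almost split in $\mathcal{A}$ if it is non-split, $A$ and $C$ are indecomposable, every homomorphism $X\to C$ with $X\in\mathcal{A}$ which is not a split epimorphism factors through $v$, and every homomorphism $A\to X$ with $X\in\mathcal{A}$ which is not a split monomorphism factors through $u$. $\mathcal{A}$ has almost split sequences if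 every indecomposable $C\in\mathcal{A}$ with $\operatorname{Ext}^1_\Lambda(C,X)\neq 0$ for some $X\in\mathcal{A}$ is the right-hand term of an almost split sequence in $\mathcal{A}$, and every indecomposable $A\in\mathcal{A}$ with $\operatorname{Ext}^1_\Lambda(X,A)\neq 0$ for some $X\in\mathcal{A}$ is the left-hand term of an almost split sequence in $\mathcal{A}$. *)

(* Defs.v *)
From mathcomp Require Import all_boot all_algebra.

Set Implicit Arguments.
Unset Strict Implicit.
Unset Printing Implicit Defensive.

Import GRing.Theory.

Local Open Scope ring_scope.

Definition is_ideal (R : comPzRingType) (I : R -> Prop) : Prop :=
  [/\ I 0, forall x y, I x -> I y -> I (x + y) & forall a x, I x -> I (a * x)].

Definition artinian (R : comPzRingType) : Prop :=
  forall I : nat -> R -> Prop,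
    (forall n, is_ideal (I n)) ->
    (forall n x, I n.+1 x -> I n x) ->
    exists n, forall m, (n <= m)%N -> forall x, I m x <-> I n x.

(* The R-algebra structure is given by a morphism into the centre rather than
   by algType, since algType would exclude the zero ring. *)
Definition artin_algebra (L : pzRingType) : Prop :=
  exists (R : comPzRingType) (phi : {rmorphism R -> L}),
    [/\ artinian R,
        forall r x, phi r * x = x * phi r
      & exists (n : nat) (g : 'I_n -> L),
          forall x, exists c : 'I_n -> R, x = \sum_(i < n) phi (c i) * g i].

Section Modules.

Variable L : pzRingType.

Implicit Types A B C M N U V X : lmodType L.

Definition fin_gen M : Prop :=
  exists (n : nat) (g : 'I_n -> M),
    forall x, exists c : 'I_n -> L, x = \sum_(i < n) c i *: g i.

Definition surj M N (f : {linear M -> N}) : Prop := forall y, exists x, f x = y.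

Definition exact A B C (f : {linear A -> B}) (g : {linear B -> C}) : Prop :=
  forall y, g y = 0 <-> exists x, f x = y.

Definition short_exact A B C (u : {linear A -> B}) (v : {linear B -> C}) : Prop :=
  [/\ injective u, exact u v & surj v].

Definition split_epi M N (f : {linear M -> N}) : Prop :=
  exists s : {linear N -> M}, forall y, f (s y) = y.

Definition split_mono M N (f : {linear M -> N}) : Prop :=
  exists r : {linear N -> M}, forall x, r (f x) = x.

Definition projective (P : lmodType L) : Prop :=
  forall M N (f : {linear M -> N}) (g : {linear P -> N}),
    surj f -> exists h : {linear P -> M}, forall x, f (h x) = g x.

Definition projective_resolution M (P : nat -> lmodType L)
    (d : forall i, {linear P i.+1 -> P i}) (e : {linear P 0%N -> M}) : Prop :=
  [/\ forall i, projective (P i), surj e, exact (d 0%N) e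
    & forall i, exact (d i.+1) (d i)].

Definition finite_pdim M : Prop :=
  exists (P : nat -> lmodType L) (d : forall i, {linear P i.+1 -> P i})
         (e : {linear P 0%N -> M}),
    projective_resolution d e /\
    exists n : nat, forall i, (n < i)%N -> forall x : P i, x = 0.

Definition Pinf M : Prop := fin_gen M /\ finite_pdim M.

Definition contravariantly_finite (cA : lmodType L -> Prop) : Prop :=
  forall M, fin_gen M ->
    exists A (f : {linear A -> M}), cA A /\
      forall B (g : {linear B -> M}), cA B ->
        exists h : {linear B -> A}, forall x, f (h x) = g x.

Definition covariantly_finite (cA : lmodType L -> Prop) : Prop :=
  forall M, fin_gen M ->
    exists A (f : {linear M -> A}), cA A /\
      forall B (g : {linear M -> B}), cA B ->
        exists h : {linear A -> B}, forall x, h (f x) = g x.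

Definition indecomposable M : Prop :=
  (exists x : M, x != 0) /\
  forall U V (f : {linear (U * V)%type -> M}), bijective f ->
    (forall x : U, x = 0) \/ (forall y : V, y = 0).

(* Equivalence of the extension 0 -> A -> B -> C -> 0 with the trivial one,
   0 -> A -> A (+) C -> C -> 0; by the five lemma h is an isomorphism. *)
Definition splits A B C (u : {linear A -> B}) (v : {linear B -> C}) : Prop :=
  exists h : {linear B -> (A * C)%type},
    (forall a, h (u a) = (a, 0)) /\ (forall b, (h b).2 = v b).

(* Ext^1(C, X) is taken in the sense of Yoneda: its elements are the classes of
   extensions of C by X, and its zero is the class of the trivial extension. *)
Definition Ext1_neq0 C X : Prop :=
  exists B (u : {linear X -> B}) (v : {linear B -> C}),
    short_exact u v /\ ~ splits u v.

Definition almost_split (cA : lmodType L -> Prop) A B C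
    (u : {linear A -> B}) (v : {linear B -> C}) : Prop :=
  [/\ cA A, cA B & cA C] /\
  [/\ short_exact u v,
      ~ splits u v,
      indecomposable A /\ indecomposable C,
      forall X (f : {linear X -> C}), cA X -> ~ split_epi f ->
        exists h : {linear X -> B}, forall x, v (h x) = f x
    & forall X (f : {linear A -> X}), cA X -> ~ split_mono f ->
        exists h : {linear B -> X}, forall a, h (u a) = f a].

Definition has_almost_split_sequences (cA : lmodType L -> Prop) : Prop :=
  (forall C, cA C -> indecomposable C -> (exists X, cA X /\ Ext1_neq0 C X) ->
     exists A B (u : {linear A -> B}) (v : {linear B -> C}),
       almost_split cA u v) /\
  (forall A, cA A -> indecomposable A -> (exists X, cA X /\ Ext1_neq0 X A) ->
     exists B C (u : {linear A -> B}) (v : {linear B -> C}),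
       almost_split cA u v).

End Modules.

(* Main.v *)
From HB Require Import structures.
From mathcomp Require Import all_boot all_algebra.
From mathcomp Require Import boolp classical_sets functions.
Require Import Defs.

Set Implicit Arguments.
Unset Strict Implicit.
Unset Printing Implicit Defensive.

Import GRing.Theory.

Local Open Scope ring_scope.

(** Let E be an injective cogenerator over the commutative artinian ring R and
    D = Hom_R(L, E). The kernel Y of a minimal right approximation satisfies
    Ext^1(P^oo, Y) = 0 (Wakamatsu), and the horseshoe construction bounds the
    projective dimensions in P^oo by some d. The middle term X of such a
    sequence 0 -> Y -> X -> D -> 0 is Ext-injective in P^oo and cogenerates
    it, so that every module of P^oo has a coresolution of length d by summands
    of powers of X; a left approximation of M is then built by induction on
    that length.

    For the almost split sequence ending in C, let W be a right approximation
    of D Tr C. Every nonzero class in Ext^1(C, X) has a nonzero image in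
    Ext^1(C, W) under some X -> W, and a class of Ext^1(C, W) generating a
    minimal End(W)-submodule, projected to a minimal summand of W which sees
    it, is the class of the almost split sequence. The left end is dual, with a
    left approximation of Tr D A. *)

(** * Submodules and quotients *)

(** Approximations are given for one module at a time, so a priori nothing bounds the projective
    dimensions in P^oo. The bound d comes from the simple modules: precovers whose kernel is
    Ext-orthogonal to P^oo can be glued along composition series. It is d that makes coresolutions
    stop: for the i-th cosyzygy B of A in powers of X, Ext^1(Z, B) = Ext^{i+1}(Z, A) vanishes on all
    of P^oo once i = d.

    Only left L-modules occur. Ext^1 is handled by lifting and extending maps, Ext^2 by passing to a
    syzygy, and D Tr and Tr D are written out from a presentation matrix, so right modules and a
    duality functor never appear.

    Everything rests on finite length: Fitting's lemma, minimal approximations, minimal orbits. The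
    base R is only artinian, so its finite length is proved first. An endomorphism of an
    indecomposable module is bijective or nilpotent, and this turns the minimality of a class into
    the almost split property. *)

Definition submodule (L : pzRingType) (M : lmodType L) (P : M -> Prop) : Prop :=
  P 0 /\ forall a x y, P x -> P y -> P (a *: x + y).

Section Subquotients.

Variables (L : pzRingType) (M : lmodType L) (P : M -> Prop).
Hypothesis subP : submodule P.

Definition sub_pred : pred M := fun x => `[< P x >].

Lemma sub_pred_closed : submod_closed sub_pred.
Proof.
split; first by apply/asboolP; case: subP.
by move=> a x y /asboolP Px /asboolP Py; apply/asboolP; apply: (proj2 subP).
Qed.

HB.instance Definition _ := GRing.isSubmodClosed.Build L M sub_pred
  (GRing.submod_closed_semi sub_pred_closed).

Record submod := Submod { submod_val :> M; submod_valP : submod_val \in sub_pred }.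

HB.instance Definition _ := [isSub for submod_val].
HB.instance Definition _ := [Choice of submod by <:].
HB.instance Definition _ := [SubChoice_isSubLmodule of submod by <:].

Lemma ex_sub : exists (N : lmodType L) (i : {linear N -> M}),
  injective i /\ forall x, P x <-> exists y, i y = x.
Proof.
exists submod, (\val : {linear submod -> M}); split; first exact: val_inj.
move=> x; split => [Px|[y <-]]; last by case: y => y /= /asboolP.
have Qx : x \in sub_pred by apply/asboolP.
by exists (Submod Qx).
Qed.

Definition class_of (x : M) : M -> Prop := fun y => P (x - y).

Lemma submodB x y : P x -> P y -> P (x - y).
Proof. by move=> Px Py; rewrite addrC -scaleN1r; apply: (proj2 subP). Qed.

Lemma submodD x y : P x -> P y -> P (x + y).
Proof. by move=> Px Py; rewrite -[x]scale1r; apply: (proj2 subP). Qed.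

Lemma submodN x : P x -> P (- x).
Proof. by move=> Px; rewrite -sub0r; apply: submodB => //; case: subP. Qed.

Lemma submodZ a x : P x -> P (a *: x).
Proof. by move=> Px; rewrite -[_ *: _]addr0; apply: (proj2 subP) => //; case: subP. Qed.

(** Congruent vectors have the same class as predicates, hence the same chosen element; the quotient
    can then be the subtype of the chosen representatives. *)
Definition canon (x : M) : M := xget 0 (class_of x).

Lemma canonP x : P (x - canon x).
Proof.
apply: (@xgetPex _ 0 (class_of x)).
by exists x; rewrite /class_of subrr; case: subP.
Qed.

Lemma canonE x y : P (x - y) -> canon x = canon y.
Proof.
move=> Pxy; congr xget; apply: funext => z; apply: propext.
rewrite /class_of; split=> Pz.
  by have := submodB Pz Pxy; rewrite opprB [RHS in P RHS]addrC addrA subrK.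
by have := submodD Pxy Pz; rewrite addrA subrK.
Qed.

Lemma canonK x : canon (canon x) = canon x.
Proof. by apply/esym/canonE/canonP. Qed.

Record quomod := Quomod { quo_rep : M; quo_repP : canon quo_rep == quo_rep }.

HB.instance Definition _ := [isSub for quo_rep].
HB.instance Definition _ := [Choice of quomod by <:].

Definition quo_pi (x : M) : quomod := @Quomod (canon x) (introT eqP (canonK x)).

Lemma quo_piE x y : (quo_pi x = quo_pi y) <-> P (x - y).
Proof.
split=> [/(congr1 val) /= e|Pxy]; last by apply: val_inj; apply: canonE.
have := submodB (canonP x) (canonP y); rewrite e.
by rewrite opprB addrA subrK.
Qed.

Lemma quo_repK q : quo_pi (quo_rep q) = q.
Proof. by apply: val_inj => /=; apply/eqP; apply: quo_repP. Qed.

Definition quo_add (p q : quomod) := quo_pi (quo_rep p + quo_rep q).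
Definition quo_opp (p : quomod) := quo_pi (- quo_rep p).
Definition quo_scale (a : L) (p : quomod) := quo_pi (a *: quo_rep p).

Lemma quo_addE x y : quo_add (quo_pi x) (quo_pi y) = quo_pi (x + y).
Proof.
by apply/quo_piE; rewrite opprD addrACA; apply: submodD;
  rewrite -opprB; apply: submodN; apply: canonP.
Qed.

Lemma quo_oppE x : quo_opp (quo_pi x) = quo_pi (- x).
Proof. by apply/quo_piE; rewrite opprK addrC; apply: canonP. Qed.

Lemma quo_scaleE a x : quo_scale a (quo_pi x) = quo_pi (a *: x).
Proof.
apply/quo_piE; rewrite -scalerBr; apply: submodZ.
by rewrite -opprB; apply: submodN; apply: canonP.
Qed.

Lemma quo_piP q : exists x, q = quo_pi x.
Proof. by exists (quo_rep q); rewrite quo_repK. Qed.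

Lemma quo_addA : associative quo_add.
Proof.
move=> p q r; case: (quo_piP p) (quo_piP q) (quo_piP r) => x -> [y ->] [z ->].
by rewrite !quo_addE addrA.
Qed.

Lemma quo_addC : commutative quo_add.
Proof. by move=> p q; rewrite /quo_add addrC. Qed.

Lemma quo_add0 : left_id (quo_pi 0) quo_add.
Proof. by move=> p; case: (quo_piP p) => x ->; rewrite quo_addE add0r. Qed.

Lemma quo_addN : left_inverse (quo_pi 0) quo_opp quo_add.
Proof. by move=> p; case: (quo_piP p) => x ->; rewrite quo_oppE quo_addE addNr. Qed.

HB.instance Definition _ :=
  GRing.isZmodule.Build quomod quo_addA quo_addC quo_add0 quo_addN.

Lemma quo_scaleA a b p : quo_scale a (quo_scale b p) = quo_scale (a * b) p.
Proof. by case: (quo_piP p) => x ->; rewrite !quo_scaleE scalerA. Qed.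

Lemma quo_scale1 : left_id 1 quo_scale.
Proof. by move=> p; case: (quo_piP p) => x ->; rewrite !quo_scaleE scale1r. Qed.

Lemma quo_scaleDr : right_distributive quo_scale +%R.
Proof.
move=> a p q; case: (quo_piP p) (quo_piP q) => x -> [y ->].
by rewrite [_ + _]quo_addE !quo_scaleE scalerDr -quo_addE.
Qed.

Lemma quo_scaleDl p : {morph quo_scale^~ p : a b / a + b}.
Proof.
move=> a b; case: (quo_piP p) => x ->.
by rewrite !quo_scaleE scalerDl -quo_addE.
Qed.

HB.instance Definition _ := GRing.Zmodule_isLmodule.Build L quomod
  quo_scaleA quo_scale1 quo_scaleDr quo_scaleDl.

Lemma quo_pi_linear : linear quo_pi.
Proof. by move=> a x y; rewrite -quo_addE -quo_scaleE. Qed.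

HB.instance Definition _ := GRing.isLinear.Build L M quomod *:%R quo_pi quo_pi_linear.

Lemma ex_quo : exists (N : lmodType L) (p : {linear M -> N}),
  surj p /\ forall x, p x = 0 <-> P x.
Proof.
exists quomod, (quo_pi : {linear M -> quomod}); split.
  by move=> q; case: (quo_piP q) => x ->; exists x.
move=> x; rewrite -[0]/(quo_pi 0); split=> [/quo_piE|Px]; first by rewrite subr0.
by apply/quo_piE; rewrite subr0.
Qed.

End Subquotients.

(** * Linear maps, kernels, cokernels, pullbacks and pushouts *)

Section Toolkit.

Variable L : pzRingType.
Implicit Types A B C E G I K M N P Q Z : lmodType L.

Lemma ex_linear M N (f : M -> N) : linear f ->
  exists g : {linear M -> N}, forall x, g x = f x.
Proof.
move=> flin.
by exists (HB.pack_for {linear M -> N} f (GRing.isLinear.Build L M N *:%R f flin)).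
Qed.

Lemma linear_inj M N (f : {linear M -> N}) :
  (forall x, f x = 0 -> x = 0) -> injective f.
Proof.
by move=> f0 x y e; apply/eqP; rewrite -subr_eq0; apply/eqP/f0; rewrite linearB e subrr.
Qed.

Lemma linear_inj0 M N (f : {linear M -> N}) x : injective f -> f x = 0 -> x = 0.
Proof. by move=> finj fx; apply: finj; rewrite fx linear0. Qed.

Lemma factor_inj A N M (i : {linear N -> M}) (g : {linear A -> M}) :
  injective i -> (forall a, exists y, i y = g a) ->
  exists h : {linear A -> N}, forall a, i (h a) = g a.
Proof.
move=> iinj /choice[h hE].
have [|h' h'E] := @ex_linear A N h; first by move=> a x y; apply: iinj; rewrite linearP !hE linearP.
by exists h' => a; rewrite h'E hE.
Qed.

Lemma factor_surj M Q A (p : {linear M -> Q}) (g : {linear M -> A}) :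
  surj p -> (forall x, p x = 0 -> g x = 0) ->
  exists h : {linear Q -> A}, forall x, h (p x) = g x.
Proof.
move=> /choice[s sE] pg.
have pgE x y : p x = p y -> g x = g y.
  move=> e; apply/eqP; rewrite -subr_eq0 -linearB; apply/eqP/pg.
  by rewrite linearB e subrr.
have [|h hE] := @ex_linear Q A (g \o s).
  by move=> a x y /=; rewrite -linearP; apply: pgE; rewrite linearP !sE.
by exists h => x; rewrite hE /=; apply: pgE; rewrite sE.
Qed.

Lemma ex_inverse M N (f : {linear M -> N}) : injective f -> surj f ->
  exists g : {linear N -> M}, (forall x, g (f x) = x) /\ forall y, f (g y) = y.
Proof.
move=> finj fsurj.
have [|g gE] := @factor_inj N M N f (idfun : {linear N -> N}) finj.
  by move=> y; apply: fsurj.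
by exists g; split=> // x; apply: finj; rewrite gE.
Qed.

Lemma ex_ker M N (f : {linear M -> N}) : exists K (i : {linear K -> M}),
  injective i /\ exact i f.
Proof.
have [|K [i [iinj iE]]] := @ex_sub L M (fun x => f x = 0); last by exists K, i.
by split=> [|a x y fx fy]; rewrite ?linear0 // linearP fx fy scaler0 addr0.
Qed.

Lemma ex_coker M N (f : {linear M -> N}) : exists Q (p : {linear N -> Q}),
  surj p /\ exact f p.
Proof.
have [|Q [p [psurj pE]]] := @ex_quo L N (fun y => exists x, f x = y); last by exists Q, p.
split=> [|a _ _ [x <-] [y <-]]; first by exists 0; rewrite linear0.
by exists (a *: x + y); rewrite linearP.
Qed.

Lemma ex_image M N (f : {linear M -> N}) :
  exists I (p : {linear M -> I}) (i : {linear I -> N}),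
  [/\ surj p, injective i & forall x, i (p x) = f x].
Proof.
have [|I [i [iinj iE]]] := @ex_sub L N (fun y => exists x, f x = y).
  split=> [|a _ _ [x <-] [y <-]]; first by exists 0; rewrite linear0.
  by exists (a *: x + y); rewrite linearP.
have [|p pE] := @factor_inj M I N i f iinj; first by move=> x; apply/iE; exists x.
exists I, p, i; split=> // y; have [_ /(_ (ex_intro _ y erefl))[x xE]] := iE (i y).
by exists x; apply: iinj; rewrite pE.
Qed.

Lemma exact_comp0 A B C (f : {linear A -> B}) (g : {linear B -> C}) x :
  exact f g -> g (f x) = 0.
Proof. by move=> fg; apply/fg; exists x. Qed.

Lemma ex_pair Z A B (f : {linear Z -> A}) (g : {linear Z -> B}) :
  exists h : {linear Z -> (A * B)%type}, forall z, h z = (f z, g z).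
Proof. by apply: ex_linear => a x y; rewrite !linearP. Qed.

Lemma ex_copair Z A B (f : {linear A -> Z}) (g : {linear B -> Z}) :
  exists h : {linear (A * B)%type -> Z}, forall a b, h (a, b) = f a + g b.
Proof.
have [|h hE] := @ex_linear (A * B)%type Z (fun z => f z.1 + g z.2).
  by move=> a x y /=; rewrite !linearP scalerDr addrACA.
by exists h => a b; rewrite hE.
Qed.

Lemma ex_add M N (f g : {linear M -> N}) :
  exists h : {linear M -> N}, forall x, h x = f x + g x.
Proof. by apply: ex_linear => a x y; rewrite !linearP scalerDr addrACA. Qed.

Lemma ex_opp M N (f : {linear M -> N}) :
  exists h : {linear M -> N}, forall x, h x = - f x.
Proof. by apply: ex_linear => a x y; rewrite (linearP f) opprD scalerN. Qed.

Lemma ex_sub_map M N (f g : {linear M -> N}) :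
  exists h : {linear M -> N}, forall x, h x = f x - g x.
Proof. by have [k kE] := ex_opp g; have [h hE] := ex_add f k; exists h => x; rewrite hE kE. Qed.

Lemma ex_comp M N Q (g : {linear N -> Q}) (f : {linear M -> N}) :
  exists h : {linear M -> Q}, forall x, h x = g (f x).
Proof. by exists (g \o f). Qed.

Lemma ex_fst M N : exists h : {linear (M * N)%type -> M}, forall x, h x = x.1.
Proof. by apply: ex_linear => a x y. Qed.

Lemma ex_snd M N : exists h : {linear (M * N)%type -> N}, forall x, h x = x.2.
Proof. by apply: ex_linear => a x y. Qed.

Lemma ex_inl M N : exists h : {linear M -> (M * N)%type}, forall x, h x = (x, 0).
Proof. by apply: ex_linear => a x y; congr pair; rewrite /= scaler0 addr0. Qed.

Lemma ex_inr M N : exists h : {linear N -> (M * N)%type}, forall x, h x = (0, x).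
Proof. by apply: ex_linear => a x y; congr pair; rewrite /= scaler0 addr0. Qed.

Lemma pullback A B C (f : {linear A -> C}) (g : {linear B -> C}) :
  exists E (p : {linear E -> A}) (q : {linear E -> B}),
  [/\ forall e, f (p e) = g (q e),
      forall a b, f a = g b -> exists e, p e = a /\ q e = b,
      forall e, p e = 0 -> q e = 0 -> e = 0
    & forall Z (s : {linear Z -> A}) (t : {linear Z -> B}),
        (forall z, f (s z) = g (t z)) ->
        exists h : {linear Z -> E}, forall z, p (h z) = s z /\ q (h z) = t z].
Proof.
have [|E [i [iinj iE]]] := @ex_sub L (A * B)%type (fun z => f z.1 = g z.2).
  by split=> [|a x y /= xE yE]; rewrite ?linear0 // !linearP xE yE.
have [p pE] := ex_fst A B; have [q qE] := ex_snd A B.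
exists E, (p \o i), (q \o i); split=> [e|a b ab|e|Z s t st] /=.
- by rewrite pE qE; apply/iE; exists e.
- by have /iE[e eE] : f (a, b).1 = g (a, b).2 by []; exists e; rewrite pE qE eE.
- rewrite pE qE => e1 e2; apply: (linear_inj0 iinj).
  by rewrite [i e]surjective_pairing e1 e2.
- have [h hE] := ex_pair s t.
  have [|k kE] := @factor_inj _ _ _ i h iinj.
    by move=> z; apply/iE; rewrite hE; exact: st.
  by exists k => z; rewrite pE qE kE hE.
Qed.

Lemma pushout K A B (u : {linear K -> A}) (v : {linear K -> B}) :
  exists G (i : {linear A -> G}) (j : {linear B -> G}),
  [/\ forall k, i (u k) = j (v k),
      forall g, exists a b, g = i a + j b,
      forall a b, i a = j b -> exists k, a = u k /\ b = v k
    & forall Z (s : {linear A -> Z}) (t : {linear B -> Z}),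
        (forall k, s (u k) = t (v k)) ->
        exists h : {linear G -> Z}, (forall a, h (i a) = s a) /\ (forall b, h (j b) = t b)].
Proof.
have [v' v'E] := ex_opp v; have [d dE] := ex_pair u v'.
have [G [p [psurj pE]]] := ex_coker d.
have [i iE] := ex_inl A B; have [j jE] := ex_inr A B.
exists G, (p \o i), (p \o j); split=> [k|g|a b|Z s t st] /=.
- apply/eqP; rewrite -subr_eq0 -linearB; apply/eqP/pE; exists k.
  by rewrite dE v'E iE jE; congr pair; rewrite /= ?subr0 ?sub0r.
- have [[a b] <-] := psurj g; exists a, b; rewrite iE jE -linearD; congr (p _).
  by congr pair; rewrite /= ?addr0 ?add0r.
- move=> e; have /pE[k] : p (i a - j b) = 0 by rewrite linearB e subrr.
  rewrite dE iE jE v'E => -[e1 e2].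
  exists k; rewrite e1 subr0; split=> //.
  by apply: oppr_inj; rewrite e2 sub0r.
- have [h hE] := ex_copair s t.
  have [|k kE] := @factor_surj _ _ _ p h psurj.
    by move=> x /pE[k <-]; rewrite dE hE v'E linearN st subrr.
  by exists k; split=> x; rewrite kE ?iE ?jE hE linear0 ?addr0 ?add0r.
Qed.

End Toolkit.

(** * Short exact sequences *)

Definition isomorphic (L : pzRingType) (M N : lmodType L) : Prop :=
  exists f : {linear M -> N}, injective f /\ surj f.

(** Ext^1(Z, Y) = 0 in Yoneda's sense, expressed by splitting alone. *)
Definition ext_vanish (L : pzRingType) (Z Y : lmodType L) : Prop :=
  forall (B : lmodType L) (u : {linear Y -> B}) (v : {linear B -> Z}),
    short_exact u v -> split_mono u.

Section Sequences.

Variable L : pzRingType.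
Implicit Types A B C E G I J K M N P Q U V W X Y Z : lmodType L.

Lemma iso_sym M N : isomorphic M N -> isomorphic N M.
Proof.
move=> [f [finj fsurj]]; have [g [fg gf]] := ex_inverse finj fsurj.
exists g; split=> [|x]; first exact: can_inj gf.
by exists (f x).
Qed.

Lemma iso_trans M N P : isomorphic M N -> isomorphic N P -> isomorphic M P.
Proof.
move=> [f [finj fsurj]] [g [ginj gsurj]]; exists (g \o f); split.
  by move=> x y /ginj/finj.
by move=> z; have [y <-] := gsurj z; have [x <-] := fsurj y; exists x.
Qed.

Lemma split_mono_inj M N (f : {linear M -> N}) : split_mono f -> injective f.
Proof. by move=> [r rf]; apply: can_inj rf. Qed.

Lemma ses_ker M N (f : {linear M -> N}) : surj f ->
  exists K (i : {linear K -> M}), short_exact i f.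
Proof. by move=> fs; have [K [i [ii ie]]] := ex_ker f; exists K, i. Qed.

Lemma ses_coker M N (f : {linear M -> N}) : injective f ->
  exists Q (p : {linear N -> Q}), short_exact f p.
Proof. by move=> fi; have [K [i [ii ie]]] := ex_coker f; exists K, i. Qed.

Lemma ses_pair M N : exists (i : {linear M -> (M * N)%type})
  (p : {linear (M * N)%type -> N}),
  [/\ short_exact i p, forall x, i x = (x, 0), forall x, p x = x.2,
   split_mono i & split_epi p].
Proof.
have [i iE] := ex_inl M N; have [p pE] := ex_snd M N.
have [j jE] := ex_inr M N; have [q qE] := ex_fst M N.
exists i, p; split=> //; first split.
- by move=> x y; rewrite !iE => -[].
- move=> [x y]; rewrite pE /=; split=> [->|[x' ]]; first by exists x.
  by rewrite iE => -[_ <-].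
- by move=> y; exists (0, y); rewrite pE.
- by exists q => x; rewrite iE qE.
- by exists j => x; rewrite jE pE.
Qed.

Lemma split_mono_epi A B C (u : {linear A -> B}) (v : {linear B -> C}) :
  short_exact u v -> split_mono u -> split_epi v.
Proof.
move=> [uinj uv vsurj] [r ru].
have [d dE] := ex_sub_map (idfun : {linear B -> B}) (u \o r).
have [|s sE] := @factor_surj _ _ _ _ v d vsurj.
  by move=> x /uv[a <-]; rewrite dE /= ru subrr.
exists s => y; have [x <-] := vsurj y.
by rewrite sE dE linearB /= (exact_comp0 _ uv) subr0.
Qed.

Lemma split_epi_mono A B C (u : {linear A -> B}) (v : {linear B -> C}) :
  short_exact u v -> split_epi v -> split_mono u.
Proof.
move=> [uinj uv vsurj] [s vs].
have [d dE] := ex_sub_map (idfun : {linear B -> B}) (s \o v).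
have [|r rE] := @factor_inj _ _ _ _ u d uinj.
  by move=> x; apply/uv; rewrite dE linearB /= vs subrr.
exists r => a; apply: uinj; rewrite rE dE /= (exact_comp0 _ uv) linear0.
by rewrite subr0.
Qed.

Lemma splits_mono A B C (u : {linear A -> B}) (v : {linear B -> C}) :
  short_exact u v -> (splits u v <-> split_mono u).
Proof.
move=> [uinj uv vsurj]; split=> [[h [hu hv]]|[r ru]].
  have [p pE] := ex_fst A C; exists (p \o h) => x /=.
  by rewrite pE hu.
have [h hE] := ex_pair r v; exists h; split=> x; rewrite hE //.
by rewrite ru (exact_comp0 _ uv).
Qed.

Lemma ses_iso A B C (u : {linear A -> B}) (v : {linear B -> C}) :
  short_exact u v -> split_mono u -> isomorphic B (A * C)%type.
Proof.
move=> uvs [r ru]; have [s vs] := split_mono_epi uvs (ex_intro _ r ru).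
case: uvs => uinj uv vsurj.
have [h hE] := ex_pair r v; exists h; split.
  apply: linear_inj => x; rewrite hE => -[rx /uv[a xE]].
  by move: rx; rewrite -xE ru => ->; rewrite linear0.
move=> [a c]; exists (u (a - r (s c)) + s c); rewrite hE (linearD r) (linearD v) ru vs.
by rewrite (exact_comp0 _ uv) add0r subrK.
Qed.

Lemma ses_isol A A' B C (u : {linear A -> B}) (v : {linear B -> C})
  (f : {linear A' -> A}) : short_exact u v -> injective f -> surj f ->
  short_exact (u \o f) v.
Proof.
move=> [uinj uv vsurj] finj fsurj; split=> //.
- by move=> x y /uinj/finj.
- move=> y; split=> [/uv[a <-]|[x <-]]; last exact: exact_comp0 uv.
  by have [x <-] := fsurj a; exists x.
Qed.

Lemma ses_isor A B C C' (u : {linear A -> B}) (v : {linear B -> C})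
  (f : {linear C -> C'}) : short_exact u v -> injective f -> surj f ->
  short_exact u (f \o v).
Proof.
move=> [uinj uv vsurj] finj fsurj; split=> //.
- move=> y; split=> [fy|[x <-]]; last by rewrite /= (exact_comp0 _ uv) linear0.
  by apply/uv; apply: (linear_inj0 finj).
- by move=> z; have [y <-] := fsurj z; have [x <-] := vsurj y; exists x.
Qed.

(** The fourth clause, with its dual in [ses_pushout], replaces the connecting map of the long exact
    sequence: the pulled back class vanishes exactly when f lifts through v. *)
Lemma ses_pullback A B C Z (u : {linear A -> B}) (v : {linear B -> C})
    (f : {linear Z -> C}) : short_exact u v ->
  exists E (u' : {linear A -> E}) (v' : {linear E -> Z}) (q : {linear E -> B}),
  [/\ short_exact u' v', forall a, q (u' a) = u a, forall e, v (q e) = f (v' e),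
    split_mono u' <-> exists h : {linear Z -> B}, forall z, v (h z) = f z
    & forall W (s : {linear W -> B}) (t : {linear W -> Z}),
        (forall w, v (s w) = f (t w)) ->
        exists h : {linear W -> E}, forall w, q (h w) = s w /\ v' (h w) = t w].
Proof.
move=> [uinj uv vsurj].
have [E [q [v' [comm full joint univ]]]] := pullback v f.
have [z0 z0E] : exists z0 : {linear A -> Z}, forall a, z0 a = 0.
  by exists \0.
have [|u' u'E] := univ _ u z0.
  by move=> a; rewrite (exact_comp0 _ uv) z0E linear0.
have uvs : short_exact u' v'.
  split.
  - by move=> x y e; apply: uinj; rewrite -!(proj1 (u'E _)) e.
  - move=> e; split=> [e0|[a <-]]; last by rewrite (proj2 (u'E a)) z0E.
    have /uv[a aE] : v (q e) = 0 by rewrite comm e0 linear0.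
    exists a; apply/eqP; rewrite -subr_eq0; apply/eqP/joint; rewrite linearB.
      by rewrite (proj1 (u'E a)) aE subrr.
    by rewrite (proj2 (u'E a)) z0E e0 subrr.
  - move=> z; have [b bE] := vsurj (f z).
    by have [e [_ eE]] := full _ _ bE; exists e.
exists E, u', v', q; split=> // [a|]; first exact: proj1 (u'E a).
split=> [/(split_mono_epi uvs)[s sE]|[h hE]].
  by exists (q \o s) => z; rewrite /= comm sE.
apply: (split_epi_mono uvs).
have [s sE] := univ Z h idfun hE.
by exists s => z; rewrite (proj2 (sE z)).
Qed.

Lemma ses_pushout A B C Y (u : {linear A -> B}) (v : {linear B -> C})
    (f : {linear A -> Y}) : short_exact u v ->
  exists G (u' : {linear Y -> G}) (v' : {linear G -> C}) (q : {linear B -> G}),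
  [/\ short_exact u' v', forall a, q (u a) = u' (f a), forall b, v' (q b) = v b,
    split_mono u' <-> exists h : {linear B -> Y}, forall a, h (u a) = f a
    & forall Z (s : {linear Y -> Z}) (t : {linear B -> Z}),
        (forall a, s (f a) = t (u a)) ->
        exists h : {linear G -> Z}, (forall a, h (u' a) = s a) /\ (forall b, h (q b) = t b)].
Proof.
move=> [uinj uv vsurj].
have [G [u' [q [comm gen ker univ]]]] := pushout f u.
have [z0 z0E] : exists z0 : {linear Y -> C}, forall a, z0 a = 0.
  by exists \0.
have [|v' [v'u v'q]] := univ _ z0 v.
  by move=> a; rewrite (exact_comp0 _ uv) z0E.
have uvs : short_exact u' v'.
  split.
  - apply: linear_inj => y; rewrite -[RHS](linear0 q) => /ker[a [-> a0]].
    by rewrite (linear_inj0 uinj (esym a0)) linear0.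
  - move=> g; split=> [g0|[a <-]]; last by rewrite v'u z0E.
    have [y [b gE]] := gen g; move: g0.
    rewrite gE linearD v'u z0E v'q add0r => /uv[a <-].
    by exists (y + f a); rewrite linearD comm.
  - by move=> c; have [b <-] := vsurj c; exists (q b); rewrite v'q.
exists G, u', v', q; split=> //.
split=> [[r rE]|[h hE]].
  by exists (r \o q) => a; rewrite /= -comm rE.
have [|r [rE _]] := univ Y idfun h; first by move=> a; rewrite hE.
by exists r => y; rewrite rE.
Qed.

Lemma ext_vanish_lift A B C Z (u : {linear A -> B}) (v : {linear B -> C})
    (f : {linear Z -> C}) : short_exact u v -> ext_vanish Z A ->
  exists h : {linear Z -> B}, forall z, v (h z) = f z.
Proof.
move=> uvs ZA; have [E [u' [v' [q [uvs' _ _ <- _]]]]] := ses_pullback f uvs.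
exact: ZA uvs'.
Qed.

Lemma ext_vanish_extend A B C Y (u : {linear A -> B}) (v : {linear B -> C})
    (f : {linear A -> Y}) : short_exact u v -> ext_vanish C Y ->
  exists h : {linear B -> Y}, forall a, h (u a) = f a.
Proof.
move=> uvs CY; have [G [u' [v' [q [uvs' _ _ <- _]]]]] := ses_pushout f uvs.
exact: CY uvs'.
Qed.

Lemma ses_projective A B C (u : {linear A -> B}) (v : {linear B -> C}) :
  short_exact u v -> projective C -> split_epi v.
Proof.
move=> [_ _ vsurj] Cproj; have [s sE] := Cproj _ _ v idfun vsurj.
by exists s.
Qed.

Lemma projective_ext C X : projective C -> ext_vanish C X.
Proof. by move=> Cp B u v uvs; apply: (split_epi_mono uvs); apply: ses_projective uvs Cp. Qed.

(* Ext^1(C, Y) computed from a projective presentation of C. *)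
Lemma ext_vanishP A B C Y (u : {linear A -> B}) (v : {linear B -> C}) :
  short_exact u v -> projective B ->
  (forall f : {linear A -> Y}, exists h : {linear B -> Y}, forall a, h (u a) = f a) ->
  ext_vanish C Y.
Proof.
move=> [uinj uv vsurj] Bproj ext G i p ips; have [iinj ip psurj] := ips.
apply: (split_epi_mono ips).
have [g gE] := Bproj _ _ p v psurj.
have [|f fE] := @factor_inj _ _ _ _ i (g \o u) iinj.
  by move=> a; apply/ip; rewrite /= gE (exact_comp0 _ uv).
have [h hE] := ext f.
have [d dE] := ex_sub_map g (i \o h).
have [|s sE] := @factor_surj _ _ _ _ v d vsurj.
  by move=> x /uv[a <-]; rewrite dE /= hE fE subrr.
exists s => c; have [b <-] := vsurj c.
by rewrite sE dE linearB gE /= (exact_comp0 _ ip) subr0.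
Qed.

(** The sequence 0 -> Ker f -> Ker (g f) -> Ker g -> 0 of two epimorphisms. *)
Lemma ses_comp_ker A B C K K' K'' (f : {linear A -> B}) (g : {linear B -> C})
    (h : {linear A -> C}) (i : {linear K -> A}) (j : {linear K' -> A})
    (k : {linear K'' -> B}) :
  (forall x, h x = g (f x)) ->
  short_exact i f -> short_exact j h -> short_exact k g ->
  exists (s : {linear K -> K'}) (t : {linear K' -> K''}), short_exact s t.
Proof.
move=> hE [iinj if_ fsurj] [jinj jh hsurj] [kinj kg gsurj].
have [|s sE] := @factor_inj _ _ _ _ j i jinj.
  by move=> x; apply/jh; rewrite hE (exact_comp0 _ if_) linear0.
have [|t tE] := @factor_inj _ _ _ _ k (f \o j) kinj.
  by move=> x; apply/kg; rewrite /= -hE (exact_comp0 _ jh).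
exists s, t; split.
- by move=> x y e; apply: iinj; rewrite -!sE e.
- move=> y; split=> [y0|[x <-]].
    have /if_[x xE] : f (j y) = 0 by rewrite -[LHS]tE y0 linear0.
    by exists x; apply: jinj; rewrite sE.
  by apply: (linear_inj0 kinj); rewrite tE /= sE (exact_comp0 _ if_).
- move=> z; have [x xE] := fsurj (k z).
  have /jh[y yE] : h x = 0 by rewrite hE xE (exact_comp0 _ kg).
  by exists y; apply: kinj; rewrite tE /= yE.
Qed.

(** Both projections of a pullback of two epimorphisms have the kernel of the opposite map. This is
    the common core of Schanuel's lemma, of [pdim_le_sub] and of the gluing of precovers. *)
Lemma ses_double_pullback A A' B B' C (u : {linear A -> B}) (v : {linear B -> C})
    (u' : {linear A' -> B'}) (v' : {linear B' -> C}) :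
  short_exact u v -> short_exact u' v' ->
  exists E (i : {linear A -> E}) (p : {linear E -> B'})
    (j : {linear A' -> E}) (q : {linear E -> B}),
    [/\ short_exact i p, short_exact j q & forall e, v (q e) = v' (p e)].
Proof.
move=> uvs uvs'; have [E [i [p [q [ips qi vq _ _]]]]] := ses_pullback v' uvs.
have [uinj uv vsurj] := uvs; have [uinj' uv' vsurj'] := uvs'.
have [iinj ip psurj] := ips.
have qsurj : surj q.
  move=> b; have [b' b'E] := vsurj' (v b); have [e eE] := psurj b'.
  have /uv[a aE] : v (b - q e) = 0 by rewrite linearB vq eE b'E subrr.
  by exists (i a + e); rewrite linearD qi aE subrK.
have [K [k [kinj kq]]] := ex_ker q.
have [|f fE] := @factor_inj _ _ _ _ u' (p \o k) uinj'.
  by move=> x; apply/uv'; rewrite /= -vq (exact_comp0 _ kq) linear0.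
have finj : injective f.
  apply: linear_inj => x fx; apply: (linear_inj0 kinj).
  have /ip[a aE] : p (k x) = 0 by rewrite -[LHS]fE fx linear0.
  have a0 : a = 0 by apply: (linear_inj0 uinj); rewrite -qi aE (exact_comp0 _ kq).
  by rewrite -aE a0 linear0.
have fsurj : surj f.
  move=> a'; have [e eE] := psurj (u' a').
  have /uv[a aE] : v (q e) = 0 by rewrite vq eE (exact_comp0 _ uv').
  have /kq[x xE] : q (e - i a) = 0 by rewrite linearB qi aE subrr.
  exists x; apply: uinj'; rewrite fE /= xE linearB eE (exact_comp0 _ ip) subr0 //.
have [g [fg gf]] := ex_inverse finj fsurj.
exists E, i, p, (k \o g), q; split=> //; apply: ses_isol => //.
  exact: can_inj gf.
by move=> x; exists (f x).
Qed.

End Sequences.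

(** * Powers and finitely generated modules *)

Section Powers.

Variable L : pzRingType.
Implicit Types A B C M N P : lmodType L.

Lemma ex_tuple n M N (f : 'I_n -> {linear M -> N}) :
  exists h : {linear M -> ('I_n -> N)}, forall x i, h x i = f i x.
Proof.
have [|h hE] := @ex_linear L M ('I_n -> N) (fun x i => f i x).
  by move=> a x y; apply: funext => i; rewrite linearP.
by exists h => x i; rewrite hE.
Qed.

Lemma ex_sum_tuple n M N (f : 'I_n -> {linear M -> N}) :
  exists h : {linear ('I_n -> M) -> N}, forall x, h x = \sum_i f i (x i).
Proof.
apply: ex_linear => a x y; rewrite scaler_sumr -big_split /=.
by apply: eq_bigr => i _; rewrite -linearP.
Qed.

Lemma ex_nth n M (i : 'I_n) :
  exists h : {linear ('I_n -> M) -> M}, forall x, h x = x i.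
Proof. by apply: ex_linear. Qed.

Lemma ex_free_map n M (g : 'I_n -> M) :
  exists h : {linear ('I_n -> L^o) -> M}, forall c, h c = \sum_i (c i : L) *: g i.
Proof.
apply: ex_linear => a x y; rewrite scaler_sumr -big_split /=.
by apply: eq_bigr => i _; rewrite scalerA -scalerDl.
Qed.

Definition unit_vec n (i : 'I_n) : 'I_n -> L^o := fun j => (i == j)%:R.

Lemma unit_vecE n (c : 'I_n -> L^o) : c = \sum_i (c i : L) *: unit_vec i.
Proof.
have scaleE (a : L) (f : 'I_n -> L^o) i : (a *: f) i = a * (f i : L) by [].
apply: funext => j; rewrite fct_sumE (bigD1 j) //= big1 => [|i /negbTE ij].
  by rewrite addr0 scaleE /unit_vec eqxx mulr1.
by rewrite scaleE /unit_vec ij mulr0.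
Qed.

Lemma sum_unit_vec n M (g : 'I_n -> M) i : \sum_j (unit_vec i j : L) *: g j = g i.
Proof.
rewrite (bigD1 i) //= big1 => [|j /negbTE ij].
  by rewrite addr0 /unit_vec eqxx scale1r.
by rewrite /unit_vec eq_sym ij scale0r.
Qed.

Lemma ex_delta n M : exists d : 'I_n -> {linear M -> ('I_n -> M)},
  (forall x, x = \sum_j d j (x j)) /\
  forall j x k, d j x k = if j == k then x else 0.
Proof.
have /choice[d dE] : forall j, exists d : {linear M -> ('I_n -> M)},
    forall x k, d x k = if j == k then x else 0.
  move=> j; have [d dE] := ex_tuple (fun k => if j == k then (idfun : {linear M -> M}) else \0).
  by exists d => x k; rewrite dE; case: eqP.
exists d; split=> // x; apply: funext => k; rewrite fct_sumE (bigD1 k) //= dE eqxx.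
by rewrite big1 ?addr0 // => j /negbTE jk; rewrite dE jk.
Qed.

Lemma free_projective n : projective ('I_n -> L^o).
Proof.
move=> M N f g fsurj; have [s sE] := choice (fun i : 'I_n => fsurj (g (unit_vec i))).
have [h hE] := ex_free_map s; exists h => c.
rewrite hE linear_sum [in RHS](unit_vecE c) linear_sum.
by apply: eq_bigr => i _; rewrite !linearZ_LR sE.
Qed.

Lemma fin_gen_free n : fin_gen ('I_n -> L^o).
Proof. by exists n, (@unit_vec n) => c; exists c; apply: unit_vecE. Qed.

Lemma fin_gen_cover M : fin_gen M ->
  exists n (p : {linear ('I_n -> L^o) -> M}), surj p.
Proof.
move=> [n [g gE]]; have [p pE] := ex_free_map g; exists n, p => x.
by have [c ->] := gE x; exists c; rewrite pE.
Qed.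

Lemma fin_gen_quo M N (f : {linear M -> N}) : surj f -> fin_gen M -> fin_gen N.
Proof.
move=> fsurj [n [g gE]]; exists n, (f \o g) => y; have [x <-] := fsurj y.
have [c ->] := gE x; exists c; rewrite linear_sum.
by apply: eq_bigr => i _; rewrite linearZ_LR.
Qed.

Lemma fin_gen_ses A B C (u : {linear A -> B}) (v : {linear B -> C}) :
  short_exact u v -> fin_gen A -> fin_gen C -> fin_gen B.
Proof.
move=> [uinj uv vsurj] [n [g gE]] [m [k kE]].
have [l lE] := choice (fun i => vsurj (k i)).
exists (n + m)%N, (fun i => match fintype.split i with inl a => u (g a) | inr b => l b end).
move=> x; have [c cE] := kE (v x).
have /uv[a aE] : v (x - \sum_i c i *: l i) = 0.
  rewrite linearB linear_sum cE -sumrB big1 // => i _.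
  by rewrite linearZ_LR lE subrr.
have [d dE] := gE a.
exists (fun i => match fintype.split i with inl a => d a | inr b => c b end).
rewrite big_split_ord /= -[LHS](subrK (\sum_i c i *: l i)) -aE dE linear_sum.
congr (_ + _); apply: eq_bigr => i _.
  by rewrite (unsplitK (inl _ i)) linearZ_LR.
by rewrite (unsplitK (inr _ i)).
Qed.

Lemma fin_gen_iso M N : isomorphic M N -> fin_gen M -> fin_gen N.
Proof. by move=> [f [_ fsurj]]; apply: fin_gen_quo fsurj. Qed.

Lemma fin_gen_pairl M N : fin_gen (M * N)%type -> fin_gen M.
Proof.
have [p pE] := ex_fst M N; apply: (@fin_gen_quo _ _ p) => x.
by exists (x, 0); rewrite pE.
Qed.

Lemma pow0 M (x : 'I_0 -> M) : x = 0.
Proof. by apply: funext => -[]. Qed.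

Lemma ses_pow n M : exists (f : {linear M -> ('I_n.+1 -> M)})
  (p : {linear ('I_n.+1 -> M) -> ('I_n -> M)}), short_exact f p.
Proof.
have [f fE] : exists f : {linear M -> ('I_n.+1 -> M)}, forall x i,
    f x i = if unlift ord0 i is Some j then 0 else x.
  have [f fE] := @ex_tuple n.+1 M M
    (fun i => if unlift ord0 i is Some j then \0 else idfun).
  by exists f => x i; rewrite fE; case: unlift.
have [p pE] : exists p : {linear ('I_n.+1 -> M) -> ('I_n -> M)}, forall x i,
    p x i = x (lift ord0 i).
  have [|p pE] := @ex_linear L ('I_n.+1 -> M) ('I_n -> M)
    (fun x i => x (lift ord0 i)); first by [].
  by exists p => x i; rewrite pE.
exists f, p; split.
- by move=> x y e; have := congr1 (fun h => h ord0) e; rewrite !fE unlift_none.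
- move=> x; split=> [x0|[y <-]].
    exists (x ord0); apply: funext => i; rewrite fE; case: unliftP => [j ->|->//].
    by rewrite -pE x0.
  by apply: funext => i; rewrite pE fE liftK.
- move=> x; exists (fun i => if unlift ord0 i is Some j then x j else 0).
  by apply: funext => i; rewrite pE liftK.
Qed.

Lemma fin_gen_pow n M : fin_gen M -> fin_gen ('I_n -> M).
Proof.
move=> Mfg; elim: n => [|n IH].
  by exists 0%N, (fun _ => 0) => x; exists (fun _ => 0); rewrite [LHS]pow0 [RHS]pow0.
by have [f [p fps]] := ses_pow n M; apply: fin_gen_ses fps Mfg IH.
Qed.

End Powers.

(** * Projective dimension *)

Section ProjectiveDimension.

Variable L : pzRingType.
Implicit Types A B C E G I J K M N P Q U V W X Y Z : lmodType L.

(** Only some cover with a good syzygy is required; that every cover then has one is Schanuel's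
    lemma, in [pdim_le_ker]. *)
Fixpoint pdim_le n M : Prop :=
  if n is m.+1 then
    exists K P (u : {linear K -> P}) (v : {linear P -> M}),
      [/\ short_exact u v, projective P & pdim_le m K]
  else projective M.

Lemma projective_summand M N (f : {linear M -> N}) (g : {linear N -> M}) :
  (forall x, g (f x) = x) -> projective N -> projective M.
Proof.
move=> gf Nproj A B h k hsurj; have [l lE] := Nproj _ _ h (k \o g) hsurj.
by exists (l \o f) => x; rewrite /= lE /= gf.
Qed.

Lemma projective_iso M N : isomorphic M N -> projective M -> projective N.
Proof.
move=> [f [fi fs]]; have [g [fg gf]] := ex_inverse fi fs.
exact: projective_summand gf.
Qed.

Lemma projective_pair M N : projective M -> projective N -> projective (M * N)%type.
Proof.
move=> Mp Np A B h k hsurj.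
have [i iE] := ex_inl M N; have [j jE] := ex_inr M N.
have [s sE] := Mp _ _ h (k \o i) hsurj; have [t tE] := Np _ _ h (k \o j) hsurj.
have [l lE] := ex_copair s t; exists l => -[x y].
rewrite lE linearD sE tE /= iE jE -linearD; congr (k _).
by congr pair; rewrite /= ?addr0 ?add0r.
Qed.

Lemma projective_pairl M N : projective (M * N)%type -> projective M.
Proof.
have [i iE] := ex_inl M N; have [p pE] := ex_fst M N.
by apply: (@projective_summand _ _ i p) => x; rewrite pE iE.
Qed.

Lemma projective0 M : (forall x : M, x = 0) -> projective M.
Proof.
move=> M0 A B f g _; exists \0 => x /=.
by rewrite (M0 x) !linear0.
Qed.

Lemma pdim_le_iso n M N : isomorphic M N -> pdim_le n M -> pdim_le n N.
Proof.
case: n => [|n] MN; first exact: projective_iso.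
move=> [K [P [u [v [uvs Pp Kn]]]]]; have [f [fi fs]] := MN.
by exists K, P, u, (f \o v); split=> //; apply: ses_isor.
Qed.

(** The zero syzygy of a projective module lets n = 0 and n > 0 be treated by one sequence. *)
Lemma pdim_le_ses n M : pdim_le n M ->
  exists K P (u : {linear K -> P}) (v : {linear P -> M}),
      [/\ short_exact u v, projective P, pdim_le n.-1 K
        & n = 0%N -> forall x : K, x = 0].
Proof.
case: n => [Mp|n [K [P [u [v [uvs Pp Kn]]]]]]; last by exists K, P, u, v.
have [K [u uvs]] := @ses_ker _ M M idfun (fun x => ex_intro _ x erefl).
have K0 (x : K) : x = 0.
  case: uvs => uinj uv _; apply: (linear_inj0 uinj).
  exact: (exact_comp0 x uv).
exists K, M, u, idfun; split=> //=; exact: projective0.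
Qed.

Lemma pdim_leS n M : pdim_le n M -> pdim_le n.+1 M.
Proof.
elim: n M => [|n IH] M; last first.
  by move=> [K [P [u [v [uvs Pp Kn]]]]]; exists K, P, u, v; split=> //; apply: IH.
by move=> /pdim_le_ses[K [P [u [v [uvs Pp Kn _]]]]]; exists K, P, u, v.
Qed.

Lemma pdim_leW n m M : (n <= m)%N -> pdim_le n M -> pdim_le m M.
Proof.
move=> /subnK <-; elim: (m - n)%N => // k IH /IH.
exact: pdim_leS.
Qed.

Lemma schanuel K P K' P' M (u : {linear K -> P}) (v : {linear P -> M})
    (u' : {linear K' -> P'}) (v' : {linear P' -> M}) :
  short_exact u v -> short_exact u' v' -> projective P -> projective P' ->
  isomorphic (K * P')%type (K' * P)%type.
Proof.
move=> uvs uvs' Pp Pp'.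
have [E [i [p [j [q [ips jqs _]]]]]] := ses_double_pullback uvs uvs'.
apply: (iso_trans (N := E)).
  by apply/iso_sym/(ses_iso ips)/(split_epi_mono ips)/(ses_projective ips).
by apply/(ses_iso jqs)/(split_epi_mono jqs)/(ses_projective jqs).
Qed.

Lemma ses_pair_ses A B C A' B' C' (u : {linear A -> B}) (v : {linear B -> C})
    (u' : {linear A' -> B'}) (v' : {linear B' -> C'}) :
  short_exact u v -> short_exact u' v' ->
  exists (f : {linear (A * A')%type -> (B * B')%type})
         (g : {linear (B * B')%type -> (C * C')%type}), short_exact f g.
Proof.
move=> [uinj uv vsurj] [uinj' uv' vsurj'].
have [a aE] := ex_fst A A'; have [a' a'E] := ex_snd A A'.
have [b bE] := ex_fst B B'; have [b' b'E] := ex_snd B B'.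
have [f fE] := ex_pair (u \o a) (u' \o a').
have [g gE] := ex_pair (v \o b) (v' \o b').
exists f, g; split.
- by move=> [x x'] [y y']; rewrite !fE /= !aE !a'E /= => -[/uinj -> /uinj' ->].
- move=> [x x']; rewrite gE /= bE b'E /=; split.
    move=> [/uv[y yE] /uv'[y' yE']]; exists (y, y').
    by rewrite fE /= aE a'E yE yE'.
  move=> [[y y']]; rewrite fE /= aE a'E /= => -[<- <-].
  by rewrite (exact_comp0 _ uv) (exact_comp0 _ uv').
- move=> [c c']; have [x <-] := vsurj c; have [x' <-] := vsurj' c'.
  by exists (x, x'); rewrite gE /= bE b'E.
Qed.

Lemma pdim_le_addproj n M P : projective P -> pdim_le n M -> pdim_le n (M * P)%type.
Proof.
case: n => [|n] Pp; first by move=> Mp; apply: projective_pair.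
move=> [K [Q [u [v [uvs Qp Kn]]]]].
have [Z [i ips]] := @ses_ker _ P P idfun (fun x => ex_intro _ x erefl).
have Z0 (x : Z) : x = 0.
  case: ips => iinj ip _; apply: (linear_inj0 iinj).
  exact: (exact_comp0 x ip).
have [f [g fgs]] := ses_pair_ses uvs ips.
exists (K * Z)%type, (Q * P)%type, f, g; split=> //; first exact: projective_pair.
apply: pdim_le_iso Kn; have [h hE] := ex_inl K Z; exists h; split.
  by move=> x y; rewrite !hE => -[].
by move=> [x z]; exists x; rewrite hE (Z0 z).
Qed.

(** The part N of the cover Q lying over M is the kernel of an epimorphism Q -> P, hence a summand
    of Q, and it covers M with the same kernel K. *)
Lemma pdim_le_subproj n M P : projective P -> pdim_le n (M * P)%type -> pdim_le n M.
Proof.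
case: n => [|n] Pp; first exact: projective_pairl.
move=> [K [Q [u [v [uvs Qp Kn]]]]].
have [i [p [ips iE pE ismono pepi]]] := ses_pair M P.
have [_ _ psurj] := ips; have [_ _ vsurj] := uvs.
have pvs : surj (p \o v).
  by move=> z; have [y <-] := psurj z; have [x <-] := vsurj y; exists x.
have [N [j js]] := ses_ker pvs.
have [s [t sts]] := ses_comp_ker (fun x => erefl ((p \o v) x)) uvs js ips.
exists K, N, s, t; split=> //.
apply: (@projective_pairl N P); apply: projective_iso Qp.
exact/(ses_iso js)/(split_epi_mono js)/(ses_projective js).
Qed.

Lemma pdim_le_ker n K P M (u : {linear K -> P}) (v : {linear P -> M}) :
  short_exact u v -> projective P -> pdim_le n.+1 M -> pdim_le n K.
Proof.
move=> uvs Pp [K' [P' [u' [v' [uvs' Pp' Kn]]]]].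
apply: (pdim_le_subproj Pp').
apply: pdim_le_iso (iso_sym (schanuel uvs uvs' Pp Pp')) _.
exact: pdim_le_addproj.
Qed.

Lemma horseshoe A B C P Q K J (u : {linear A -> B}) (v : {linear B -> C})
    (k : {linear K -> P}) (p : {linear P -> A})
    (j : {linear J -> Q}) (q : {linear Q -> C}) :
  short_exact u v -> short_exact k p -> short_exact j q -> projective Q ->
  exists N (i : {linear N -> (P * Q)%type}) (r : {linear (P * Q)%type -> B})
    (s : {linear K -> N}) (t : {linear N -> J}),
  short_exact i r /\ short_exact s t.
Proof.
move=> [uinj uv vsurj] [kinj kp psurj] [jinj jq qsurj] Qp.
have [l lE] := Qp _ _ v q vsurj.
have [r rE] := ex_copair (u \o p) l.
have rsurj : surj r.
  move=> b; have [y yE] := qsurj (v b).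
  have /uv[a aE] : v (b - l y) = 0 by rewrite linearB lE yE subrr.
  by have [x xE] := psurj a; exists (x, y); rewrite rE /= xE aE subrK.
have [N [i irs]] := ses_ker rsurj; have [iinj ir _] := irs.
have [f fE] := ex_inl P Q; have [g gE] := ex_snd P Q.
have [|s sE] := @factor_inj _ _ _ _ i (f \o k) iinj.
  move=> x; apply/ir; rewrite /= fE rE /= (exact_comp0 _ kp) !linear0.
  by rewrite addr0.
have vr x : v (r x) = q x.2.
  by case: x => x y; rewrite rE /= linearD (exact_comp0 _ uv) add0r lE.
have [|t tE] := @factor_inj _ _ _ _ j (g \o i) jinj.
  by move=> x; apply/jq; rewrite /= gE -vr (exact_comp0 _ ir) linear0.
exists N, i, r, s, t; split=> //; split.
- by move=> x y e; apply: kinj; have := congr1 i e; rewrite !sE /= !fE => -[].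
- move=> n; split=> [n0|[x <-]].
    have i2 : (i n).2 = 0 by have := tE n; rewrite n0 linear0 /= gE.
    have := exact_comp0 n ir; rewrite [i n]surjective_pairing i2 rE /= linear0 addr0.
    move=> /(linear_inj0 uinj)/kp[x xE].
    by exists x; apply: iinj; rewrite sE /= fE xE -i2 -surjective_pairing.
  by apply: (linear_inj0 jinj); rewrite tE /= sE /= gE fE.
- move=> x.
  have /uv[a aE] : v (l (j x)) = 0 by rewrite lE (exact_comp0 _ jq).
  have [y yE] := psurj (- a).
  have /ir[n nE] : r (y, j x) = 0 by rewrite rE /= yE linearN aE addNr.
  by exists n; apply: jinj; rewrite tE /= gE nE.
Qed.

Lemma pdim_le_ext n A B C (u : {linear A -> B}) (v : {linear B -> C}) :
  short_exact u v -> pdim_le n A -> pdim_le n C -> pdim_le n B.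
Proof.
elim: n A B C u v => [|n IH] A B C u v uvs.
  move=> Ap Cp; apply: (projective_iso _ (projective_pair Ap Cp)).
  exact/iso_sym/(ses_iso uvs)/(split_epi_mono uvs)/(ses_projective uvs).
move=> [K [P [k [p [kps Pp Kn]]]]] [J [Q [j [q [jqs Qp Jn]]]]].
have [N [i [r [s [t [irs sts]]]]]] := horseshoe uvs kps jqs Qp.
exists N, (P * Q)%type, i, r; split=> //; first exact: projective_pair.
exact: IH sts Kn Jn.
Qed.

(** The pullback E of B -> C along a cover P -> C is an extension of B by the syzygy K, and it is
    also A (+) P. *)
Lemma pdim_le_sub n A B C (u : {linear A -> B}) (v : {linear B -> C}) :
  short_exact u v -> pdim_le n B -> pdim_le n.+1 C -> pdim_le n A.
Proof.
move=> uvs Bn [K [P [k [p [kps Pp Kn]]]]].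
have [E [i [r [j [q [irs jqs _]]]]]] := ses_double_pullback uvs kps.
apply: (pdim_le_subproj Pp).
apply: pdim_le_iso (pdim_le_ext jqs Kn Bn).
exact/(ses_iso irs)/(split_epi_mono irs)/(ses_projective irs).
Qed.

(** Composing a cover P -> B with B -> C gives a syzygy of C that is an extension of A by the syzygy
    K of B. *)
Lemma pdim_le_quo n A B C (u : {linear A -> B}) (v : {linear B -> C}) :
  short_exact u v -> pdim_le n A -> pdim_le n B -> pdim_le n.+1 C.
Proof.
move=> uvs An /pdim_le_ses[K [P [k [p [kps Pp Kn _]]]]].
have [_ _ vsurj] := uvs; have [_ _ psurj] := kps.
have vps : surj (v \o p).
  by move=> z; have [y <-] := vsurj z; have [x <-] := psurj y; exists x.
have [G [g gs]] := ses_ker vps.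
have [s [t sts]] := ses_comp_ker (fun x => erefl ((v \o p) x)) kps gs uvs.
exists G, P, g, (v \o p); split=> //; apply: pdim_le_ext sts _ An.
by apply: pdim_leW Kn; apply: leq_pred.
Qed.

(* The kernels of the two components of a cover P -> A (+) B add up to a
   syzygy of A (+) B with respect to the cover P (+) P. *)
Lemma pdim_le_pairl n A B : pdim_le n (A * B)%type -> pdim_le n A.
Proof.
elim: n A B => [|n IH] A B; first exact: projective_pairl.
move=> ABn; have [K [P [k [p [[_ _ psurj] Pp _]]]]] := ABn.
have [a aE] := ex_fst A B; have [b bE] := ex_snd A B.
have aps : surj (a \o p).
  by move=> x; have [y yE] := psurj (x, 0); exists y; rewrite /= aE yE.
have bps : surj (b \o p).
  by move=> x; have [y yE] := psurj (0, x); exists y; rewrite /= bE yE.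
have [I [i is_]] := ses_ker aps; have [J [j js]] := ses_ker bps.
have [f [g fgs]] := ses_pair_ses is_ js.
exists I, P, i, (a \o p); split=> //; apply: (IH I J).
by apply: pdim_le_ker fgs _ ABn; apply: projective_pair.
Qed.

End ProjectiveDimension.

(** * Closure properties of P^oo *)

Section FinitePdim.

Variable L : pzRingType.
Implicit Types A B C E G I J K M N P Q U V W X Y Z : lmodType L.

Lemma resolution_pdim_le n M (P : nat -> lmodType L)
    (d : forall i, {linear P i.+1 -> P i}) (e : {linear P 0%N -> M}) :
  projective_resolution d e -> (forall i, (n < i)%N -> forall x : P i, x = 0) ->
  pdim_le n M.
Proof.
elim: n M P d e => [|n IH] M P d e [Pp es de dd] P0.
  apply: (@projective_iso _ (P 0%N)); last exact: Pp.
  exists e; split=> //; apply: linear_inj => x /de[y <-].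
  by rewrite (P0 1%N _ y) // linear0.
have [K [k ks]] := ses_ker es; have [kinj ke _] := ks.
have [|e' e'E] := @factor_inj _ _ _ _ k (d 0%N) kinj.
  by move=> x; apply/ke; rewrite (exact_comp0 _ de).
exists K, (P 0%N), k, e; split=> //.
apply: (IH K (fun i => P i.+1) (fun i => d i.+1) e'); last by move=> i im; apply: (P0 i.+1).
split=> // y.
- have /de[x xE] : e (k y) = 0 by apply: exact_comp0 ke.
  by exists x; apply: kinj; rewrite e'E.
- split=> [y0|[x <-]]; first by apply/dd; rewrite -e'E y0 linear0.
  by apply: (linear_inj0 kinj); rewrite e'E; apply: exact_comp0 (dd _).
Qed.

Lemma pdim_le_finite n M : pdim_le n M -> finite_pdim M.
Proof.
elim: n M => [|n IH] M.
  move=> Mp; pose Z : lmodType L := 'I_0 -> L^o.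
  have Z0 (z : Z) : z = 0 by apply: funext => -[].
  pose P i : lmodType L := if i is _.+1 then Z else M.
  exists P, (fun i => \0), idfun; split; last first.
    by exists 0%N => -[//|i] _ x; apply: Z0.
  split=> [[//|i]|x|y|i y].
  - exact: free_projective.
  - by exists x.
  - by split=> [/= ->|[x <-] //]; exists 0.
  - by split=> // _; exists 0; rewrite [LHS]Z0 [RHS]Z0.
move=> [K [P [u [v [[uinj uv vsurj] Pp Kn]]]]].
have [P' [d' [e' [[Pp' es de dd] [m P0]]]]] := IH _ Kn.
pose R i : lmodType L := if i is j.+1 then P' j else P.
(* The resolution of K is spliced to P through [u \o e'] in degree 0. *)
pose d i : {linear R i.+1 -> R i} := match i return {linear R i.+1 -> R i} with
  | 0%N => u \o e' | j.+1 => d' j end.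
exists R, d, v; split; last by exists m.+1 => -[//|i] im; exact: (P0 i im).
split=> [[//|i]|//|y|[|i] y]; first exact: Pp'.
- split=> [/uv[x <-]|[x <-]]; last exact: exact_comp0 uv.
  by have [z <-] := es x; exists z.
- split=> [/= e0|[x <-]]; last by rewrite /= (exact_comp0 x de) linear0.
  by apply/de; apply: (linear_inj0 uinj).
- exact: dd.
Qed.

Lemma finite_pdimP M : finite_pdim M <-> exists n, pdim_le n M.
Proof.
split=> [[P [d [e [res [n P0]]]]]|[n]]; last exact: pdim_le_finite.
by exists n; apply: resolution_pdim_le res P0.
Qed.

Lemma PinfP M : Pinf M <-> fin_gen M /\ exists n, pdim_le n M.
Proof. by rewrite /Pinf finite_pdimP. Qed.

Lemma Pinf_iso M N : isomorphic M N -> Pinf M -> Pinf N.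
Proof.
move=> MN /PinfP[Mfg [n Mn]]; apply/PinfP; split; first exact: fin_gen_iso MN Mfg.
by exists n; apply: pdim_le_iso Mn.
Qed.

Lemma Pinf_ext A B C (u : {linear A -> B}) (v : {linear B -> C}) :
  short_exact u v -> Pinf A -> Pinf C -> Pinf B.
Proof.
move=> uvs /PinfP[Afg [n An]] /PinfP[Cfg [m Cm]]; apply/PinfP; split.
  exact: fin_gen_ses uvs Afg Cfg.
exists (maxn n m); apply: (pdim_le_ext uvs).
  exact: pdim_leW (leq_maxl n m) An.
exact: pdim_leW (leq_maxr n m) Cm.
Qed.

Lemma Pinf_quo A B C (u : {linear A -> B}) (v : {linear B -> C}) :
  short_exact u v -> Pinf A -> Pinf B -> Pinf C.
Proof.
move=> uvs /PinfP[Afg [n An]] /PinfP[Bfg [m Bm]]; apply/PinfP; split.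
  by have [_ _ vs] := uvs; exact: fin_gen_quo vs Bfg.
exists (maxn n m).+1; apply: (pdim_le_quo uvs).
  exact: pdim_leW (leq_maxl n m) An.
exact: pdim_leW (leq_maxr n m) Bm.
Qed.

Lemma Pinf_sub A B C (u : {linear A -> B}) (v : {linear B -> C}) :
  short_exact u v -> fin_gen A -> Pinf B -> Pinf C -> Pinf A.
Proof.
move=> uvs Afg /PinfP[Bfg [n Bn]] /PinfP[Cfg [m Cm]]; apply/PinfP; split=> //.
exists (maxn n m); apply: (pdim_le_sub uvs).
  exact: pdim_leW (leq_maxl n m) Bn.
exact: pdim_leW (leqW (leq_maxr n m)) Cm.
Qed.

Lemma Pinf_pair M N : Pinf M -> Pinf N -> Pinf (M * N)%type.
Proof. by have [i [p [ips _ _ _ _]]] := ses_pair M N; apply: Pinf_ext ips. Qed.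

Lemma Pinf_pairl M N : Pinf (M * N)%type -> Pinf M.
Proof.
move=> /PinfP[fg [n pd]]; apply/PinfP; split; first exact: fin_gen_pairl fg.
by exists n; apply: pdim_le_pairl pd.
Qed.

Lemma split_mono_pair M N (f : {linear M -> N}) : split_mono f ->
  exists K, isomorphic N (M * K)%type.
Proof.
move=> fsplit; have [C [p fps]] := ses_coker (split_mono_inj fsplit).
by exists C; apply: ses_iso fps fsplit.
Qed.

Lemma Pinf_summand M N (f : {linear M -> N}) : split_mono f -> Pinf N -> Pinf M.
Proof.
by move=> /split_mono_pair[K NMK] /(Pinf_iso NMK); apply: Pinf_pairl.
Qed.

Lemma pdim_le_summand n M N (f : {linear M -> N}) :
  split_mono f -> pdim_le n N -> pdim_le n M.
Proof.
by move=> /split_mono_pair[K NMK] /(pdim_le_iso NMK); apply: pdim_le_pairl.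
Qed.

Lemma Pinf_free n : Pinf ('I_n -> L^o).
Proof.
apply/PinfP; split; first exact: fin_gen_free.
by exists 0%N; apply: free_projective.
Qed.

Lemma Pinf_pow n M : Pinf M -> Pinf ('I_n -> M).
Proof.
move=> MP; elim: n => [|n IH].
  apply: Pinf_iso (Pinf_free 0); exists \0; split.
    by move=> x y _; rewrite [LHS]pow0 [RHS]pow0.
  by move=> y; exists 0; rewrite [LHS]pow0 [RHS]pow0.
by have [f [p fps]] := ses_pow n M; apply: Pinf_ext fps MP IH.
Qed.

End FinitePdim.

(** * Modules of finite length *)

Section Length.

Variable L : pzRingType.
Implicit Types A B C E G I J K M N Q S U V W X Y Z : lmodType L.

(** Bounds strict chains of submodules instead of asking for a composition series: upper bounds
    suffice throughout, and no Jordan-Hoelder theorem is involved. *)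
Fixpoint length_le n M : Prop :=
  if n is m.+1 then
    forall N (f : {linear N -> M}), injective f -> ~ surj f -> length_le m N
  else forall x : M, x = 0.

Definition finite_length M : Prop := exists n, length_le n M.

Definition simple S : Prop :=
  (exists x : S, x <> 0) /\
  forall N (f : {linear N -> S}), injective f -> surj f \/ forall x : N, x = 0.

Lemma length_le_inj n M N (f : {linear N -> M}) :
  injective f -> length_le n M -> length_le n N.
Proof.
case: n => [|n] finj Mn.
  by move=> x; apply: (linear_inj0 finj); exact: (Mn (f x)).
move=> K g ginj gns; apply: (Mn K (f \o g)) => [x y /finj/ginj //|fgs].
by apply: gns => y; have [x /finj] := fgs (f y); exists x.
Qed.

Lemma length_leS n M : length_le n M -> length_le n.+1 M.
Proof. by move=> Mn N f finj _; apply: length_le_inj finj Mn. Qed.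

Lemma length_leW n m M : (n <= m)%N -> length_le n M -> length_le m M.
Proof.
move=> /subnK <-; elim: (m - n)%N => // k IH /IH.
exact: length_leS.
Qed.

Lemma proper_sub_length n M N (f : {linear N -> M}) :
  injective f -> ~ surj f -> length_le n M -> length_le n.-1 N /\ (0 < n)%N.
Proof.
case: n => [|n] finj fns Mn; last by split=> //; apply: Mn fns.
by case: fns => y; exists 0; rewrite [RHS]Mn linear0.
Qed.

Lemma ex_restr M Q N (f : {linear M -> Q}) (i : {linear N -> Q}) :
  injective i -> surj f ->
  exists G (j : {linear G -> M}) (g : {linear G -> N}),
    [/\ injective j, surj g, forall x, i (g x) = f (j x)
      & forall m n, f m = i n -> exists x, j x = m /\ g x = n].
Proof.
move=> iinj fsurj; have [G [j [g [comm full joint _]]]] := pullback f i.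
exists G, j, g; split=> //.
- apply: linear_inj => x jx; apply: joint => //; apply: iinj.
  by rewrite -comm jx !linear0.
- by move=> n; have [m mE] := fsurj (i n); have [x [_ xE]] := full _ _ mE; exists x.
Qed.

Lemma length_le_surj n M Q (f : {linear M -> Q}) :
  surj f -> length_le n M -> length_le n Q.
Proof.
elim: n M Q f => [|n IH] M Q f fsurj Mn.
  by move=> y; have [x <-] := fsurj y; rewrite (Mn x) linear0.
move=> N i iinj ins; have [G [j [g [jinj gsurj comm full]]]] := ex_restr iinj fsurj.
apply: (IH G N g gsurj); apply: (Mn G j) => // jsurj; apply: ins => y.
have [x xE] := fsurj y; have [z zE] := jsurj x.
by exists (g z); rewrite comm zE.
Qed.

(** A proper submodule N of Q has a proper preimage G in M, and G -> N still has the nonzero kernel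
    of f; so the strict inequality passes to N by induction. *)
Lemma length_le_proper_quo n M Q (f : {linear M -> Q}) :
  surj f -> ~ injective f -> length_le n.+1 M -> length_le n Q.
Proof.
elim: n M Q f => [|n IH] M Q f fsurj fni Mn.
  have [K [k [kinj kf]]] := ex_ker f => y; apply: contrapT => y0.
  apply: fni; apply: linear_inj => x /kf[z <-].
  have K0 := Mn K k kinj; rewrite (K0 _ z) ?linear0 // => ksurj.
  by apply: y0; have [m <-] := fsurj y; apply/kf; apply: ksurj.
move=> N i iinj ins; have [G [j [g [jinj gsurj comm full]]]] := ex_restr iinj fsurj.
apply: (IH G N g gsurj).
  move=> ginj; apply: fni; apply: linear_inj => x fx.
  have [|z [<- z0]] := full x 0; first by rewrite linear0.
  by rewrite (linear_inj0 ginj z0) linear0.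
apply: (Mn G j) => // jsurj; apply: ins => y.
have [x xE] := fsurj y; have [z zE] := jsurj x.
by exists (g z); rewrite comm zE.
Qed.

(** A proper submodule N of B either meets A in a proper submodule K or has a proper image I in C,
    so one of the two bounds drops. *)
Lemma length_le_ext a c A B C (u : {linear A -> B}) (v : {linear B -> C}) :
  short_exact u v -> length_le a A -> length_le c C -> length_le (a + c) B.
Proof.
move: {2}(a + c)%N (erefl (a + c)%N) => n.
elim: n a c A B C u v => [|n IH] a c A B C u v acE [uinj uv vsurj] Aa Cc.
  move: acE Aa Cc => /eqP; rewrite addn_eq0 => /andP[/eqP-> /eqP->] /= A0 C0.
  by move=> x; have /uv[y <-] := C0 (v x); rewrite (A0 y) linear0.
rewrite acE => N f finj fns.
have [I [p [i [psurj iinj ipE]]]] := ex_image (v \o f).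
have [K [k [kinj kp]]] := ex_ker p.
have [|g gE] := @factor_inj _ _ _ _ u (f \o k) uinj.
  by move=> x; apply/uv; rewrite /= -[LHS]ipE (exact_comp0 _ kp) linear0.
have ginj : injective g.
  by move=> x y e; apply: kinj; apply: finj; rewrite -[LHS]gE -[RHS]gE e.
have [isurj|ins] := pselect (surj i).
  have gns : ~ surj g.
    move=> gsurj; apply: fns => b; have [y yE] := isurj (v b).
    have [x xE] := psurj y.
    have /uv[z zE] : v (b - f x) = 0 by rewrite linearB -[X in _ - X]ipE xE yE subrr.
    have [w wE] := gsurj z; exists (k w + x).
    by rewrite linearD -[X in X + _]gE wE zE subrK.
  have [Ka a0] := proper_sub_length ginj gns Aa.
  have e : (a.-1 + c)%N = n by case: a a0 acE {Aa Ka} => //= a _ [].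
  by rewrite -e; apply: (IH _ _ K N I k p e _ Ka (length_le_inj iinj Cc)).
have [Kc c0] := proper_sub_length iinj ins Cc.
have e : (a + c.-1)%N = n by case: c c0 acE {Cc Kc} => //= c _; rewrite addnS => -[].
by rewrite -e; apply: (IH _ _ K N I k p e _ (length_le_inj ginj Aa) Kc).
Qed.

Lemma finite_length_inj M N (f : {linear N -> M}) :
  injective f -> finite_length M -> finite_length N.
Proof. by move=> finj [n Mn]; exists n; apply: length_le_inj finj Mn. Qed.

Lemma finite_length_surj M N (f : {linear M -> N}) :
  surj f -> finite_length M -> finite_length N.
Proof. by move=> finj [n Mn]; exists n; apply: length_le_surj finj Mn. Qed.

Lemma finite_length_ext A B C (u : {linear A -> B}) (v : {linear B -> C}) :
  short_exact u v -> finite_length A -> finite_length C -> finite_length B.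
Proof. by move=> uvs [a Aa] [c Cc]; exists (a + c)%N; apply: length_le_ext uvs Aa Cc. Qed.

Lemma finite_length_pair M N :
  finite_length M -> finite_length N -> finite_length (M * N)%type.
Proof. by have [i [p [ips _ _ _ _]]] := ses_pair M N; apply: finite_length_ext ips. Qed.

Lemma finite_length_pow n M : finite_length M -> finite_length ('I_n -> M).
Proof.
move=> Ml; elim: n => [|n IH]; first by exists 0%N => x; apply: pow0.
by have [f [p fps]] := ses_pow n M; apply: finite_length_ext fps Ml IH.
Qed.

Lemma least_nat (P : nat -> Prop) : (exists n, P n) ->
  exists n, P n /\ forall m, P m -> (n <= m)%N.
Proof.
move=> Pex; have Pex' : exists n, `[< P n >] by case: Pex => n Pn; exists n; apply/asboolP.
have [/= n /asboolP Pn nmin] := ex_minnP Pex'.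
by exists n; split=> // m Pm; apply: nmin; apply/asboolP.
Qed.

(** As [length_le] gives upper bounds only, the comparison of lengths is an implication between
    bounds, applied at the least bound of N. *)
Lemma inj_length_surj M N (f : {linear N -> M}) : finite_length N -> injective f ->
  (forall n, length_le n N -> length_le n M) -> surj f.
Proof.
move=> /least_nat[n [Nn nmin]] finj NM; apply: contrapT => fns.
have [Nn1 n0] := proper_sub_length finj fns (NM n Nn).
by have := nmin _ Nn1; case: n n0 {Nn Nn1 nmin} => // n _; rewrite ltnn.
Qed.

Lemma surj_length_inj M N (f : {linear M -> N}) : finite_length N -> surj f ->
  (forall n, length_le n N -> length_le n M) -> injective f.
Proof.
move=> /least_nat[n [Nn nmin]] fsurj NM; apply: contrapT => fni.
have := NM n Nn; case: n Nn nmin => [|n] Nn nmin Mn.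
  apply: fni; apply: linear_inj => x _; exact: Mn.
by have := nmin _ (length_le_proper_quo fsurj fni Mn); rewrite ltnn.
Qed.

(** A member of F strictly inside the present one is shorter, so the search stops. *)
Lemma submodule_min M (F : (M -> Prop) -> Prop) : finite_length M ->
  (forall P, F P -> submodule P) -> (exists P, F P) ->
  exists P, F P /\ forall D, F D -> (forall x, D x -> P x) -> forall x, P x -> D x.
Proof.
move=> [n Mn] Fsub [P0 FP0].
have {Mn} [N [i [iinj iP Nn]]] : exists N (i : {linear N -> M}),
    [/\ injective i, forall x, P0 x <-> exists y, i y = x & length_le n N].
  have [N [i [iinj iP]]] := ex_sub (Fsub _ FP0).
  by exists N, i; split=> //; apply: length_le_inj iinj Mn.
elim: n P0 FP0 N i iinj iP Nn => [|n IH] P0 FP0 N i iinj iP Nn.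
  exists P0; split=> // D /Fsub[D0 _] _ x /iP[y <-].
  by rewrite (Nn y) linear0.
have [Pmin|/existsNP[Q /not_implyP[FQ /not_implyP[QP /existsNP[x /not_implyP[Px Qx]]]]]] :=
  pselect (forall D, F D -> (forall x, D x -> P0 x) -> forall x, P0 x -> D x).
  by exists P0.
have [K [j [jinj jQ]]] := ex_sub (Fsub _ FQ).
apply: (IH Q FQ K j jinj jQ).
have [|h hE] := @factor_inj _ _ _ _ i j iinj.
  by move=> y; apply/iP/QP/jQ; exists y.
apply: (Nn K h) => [y z e|hsurj]; first by apply: jinj; rewrite -!hE e.
have /iP[y yE] := Px; have [z zE] := hsurj y.
by apply: Qx; apply/jQ; exists z; rewrite -hE zE.
Qed.

Lemma finite_length_fin_gen M : finite_length M -> fin_gen M.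
Proof.
move=> [n]; elim: n M => [|n IH] M Mn.
  by exists 0%N, (fun _ => 0) => x; exists (fun _ => 0); rewrite (Mn x) big_ord0.
have [M0|/existsNP[x x0]] := pselect (forall x : M, x = 0).
  by apply: IH; apply: (length_leW (leq0n n)).
(* The cyclic module L x is nonzero, so the quotient by it is shorter and the induction applies
   there. *)
have [f fE] : exists f : {linear L^o -> M}, forall a, f a = (a : L) *: x.
  by apply: ex_linear => a b c; rewrite scalerDl scalerA.
have [Q [p [psurj fp]]] := ex_coker f.
have [K [k kps]] := ses_ker psurj; have [kinj kp _] := kps.
apply: (fin_gen_ses kps).
  have [|g gE] := @factor_inj _ _ _ _ k f kinj.
    by move=> y; apply/kp; apply: exact_comp0 fp.
  apply: (@fin_gen_quo _ _ _ g).
    move=> y; have /fp[z zE] : p (k y) = 0 by apply: exact_comp0 kp.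
    by exists z; apply: kinj; rewrite gE.
  by exists 1%N, (fun _ => 1) => y; exists (fun _ => y); rewrite big_ord1 [RHS]mulr1.
apply: IH; apply: (length_le_proper_quo psurj _ Mn) => pinj.
apply: x0; apply: (linear_inj0 pinj); apply/fp; exists 1.
by rewrite fE scale1r.
Qed.

Lemma simple_quotient M : finite_length M -> (exists x : M, x <> 0) ->
  exists S (p : {linear M -> S}), surj p /\ simple S.
Proof.
move=> [n]; elim: n M => [|n IH] M Mn [x x0]; first by case: x0.
have [Ms|/existsNP[N /existsNP[f /not_implyP[finj /not_orP[fns /existsNP[y y0]]]]]] :=
  pselect (forall N (f : {linear N -> M}), injective f -> surj f \/ forall x : N, x = 0).
  exists M, idfun; split; first by move=> z; exists z.
  by split=> //; exists x.
have [Q [p [psurj fp]]] := ex_coker f.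
have [||S [q [qsurj Ss]]] := IH Q.
- apply: (length_le_proper_quo psurj _ Mn) => pinj.
  by apply: y0; apply: (linear_inj0 finj); apply: (linear_inj0 pinj); apply: exact_comp0 fp.
- apply: contrapT => /forallNP Q0; apply: fns => z; apply/fp.
  by have /contrapT := Q0 (p z).
exists S, (q \o p); split=> // z; have [w <-] := qsurj z.
by have [v <-] := psurj w; exists v.
Qed.

Lemma ex_iter M (f : {linear M -> M}) n :
  exists g : {linear M -> M}, forall x, g x = iter n f x.
Proof.
elim: n => [|n [g gE]]; first by exists idfun.
by exists (f \o g) => x; rewrite /= gE.
Qed.

(** The half of Fitting's lemma used below: the smallest image V of a power of f is a summand, since
    that power restricts to an automorphism of V. The exponent is positive so that V = M forces f
    itself to be surjective. *)
Lemma fitting M (f : {linear M -> M}) : finite_length M ->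
  exists n V (j : {linear V -> M}) (a : {linear M -> V}),
    [/\ split_mono j, surj a & forall x, j (a x) = iter n.+1 f x].
Proof.
move=> Ml.
have [||_ [[n ->] nmin]] := @submodule_min M
    (fun P => exists n, P = fun y => exists x, y = iter n.+1 f x) Ml.
- move=> _ [n ->]; have [g gE] := ex_iter f n.+1; split.
    by exists 0; rewrite -gE linear0.
  by move=> a _ _ [x ->] [y ->]; exists (a *: x + y); rewrite -!gE linearP.
- by exists (fun y => exists x, y = iter 1 f x), 0%N.
have [g gE] := ex_iter f n.+1.
have [V [a [j [asurj jinj jaE]]]] := ex_image g.
have ajsurj : surj (a \o j).
  move=> v; have [x xE] := asurj v.
  have [|||z zE] := nmin (fun y => exists x, y = iter (n.+1 + n.+1) f x) _ _ (j v).
  - by exists (n + n.+1)%N.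
  - by move=> y [w ->]; exists (iter n.+1 f w); rewrite iterD.
  - by exists x; rewrite -xE jaE gE.
  exists (a z); apply: jinj; rewrite /= jaE gE jaE gE -iterD.
  by rewrite zE.
have ajinj : injective (a \o j).
  by apply: (surj_length_inj _ ajsurj) => //; apply: finite_length_inj jinj Ml.
have [b [baj ajb]] := ex_inverse ajinj ajsurj.
exists n, V, j, a; split=> //; last by move=> x; rewrite jaE gE.
by exists (b \o a) => x; apply: baj.
Qed.

Lemma indecomposable_endo M (f : {linear M -> M}) :
  finite_length M -> indecomposable M ->
  (injective f /\ surj f) \/ exists n, forall x, iter n f x = 0.
Proof.
move=> Ml [_ Mind]; have [n [V [j [a [jsplit asurj jaE]]]]] := fitting f Ml.
have [C [p jps]] := ses_coker (split_mono_inj jsplit).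
have [h [hinj hsurj]] := iso_sym (ses_iso jps jsplit).
have hbij : bijective h by have [g [hg gh]] := ex_inverse hinj hsurj; exists g.
have [V0|C0] := Mind _ _ h hbij.
  by right; exists n.+1 => x; rewrite -jaE (V0 (a x)) linear0.
left; have jsurj : surj j.
  by case: jps => _ jp _ y; apply/jp; apply: C0.
have fsurj : surj f.
  move=> y; have [v <-] := jsurj y; have [x <-] := asurj v.
  by rewrite jaE; exists (iter n f x).
by split=> //; apply: (surj_length_inj Ml fsurj).
Qed.

End Length.

(** * Commutative artinian rings have finite length *)

Section Zorn.

Variable L : pzRingType.
Implicit Types A B C E G I J K M N Q S U V W X Y Z : lmodType L.

(** Divides by a submodule maximal among those avoiding x, so that the image of x lies in every
    nonzero submodule. This yields simple pieces before any finiteness is known. *)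
Lemma zorn_quotient M (x : M) : x <> 0 ->
  exists Q (p : {linear M -> Q}), [/\ surj p, p x <> 0
    & forall y, y <> 0 -> exists a : L, p x = a *: y].
Proof.
move=> x0; pose T := {P : M -> Prop | submodule P /\ ~ P x}.
pose R (P D : T) := `[< forall y, sval P y -> sval D y >].
have T0 : submodule (fun y : M => y = 0) /\ ~ x = 0.
  by split=> //; split=> // a y z -> ->; rewrite scaler0 addr0.
have [|||C Ctot|P Pmax] := @Zorn T R.
- by move=> P; apply/asboolP.
- by move=> P D E /asboolP PD /asboolP DE; apply/asboolP => y /PD/DE.
- move=> [P Pp] [D Dp] /asboolP /= PD /asboolP /= DP.
  have PDE : P = D by apply: funext => y; apply: propext; split; [apply: PD|apply: DP].
  by case: D / PDE Dp PD DP => Dp _ _; congr exist; apply: Prop_irrelevance.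
(* The disjunct y = 0 provides the upper bound of the empty chain. *)
- have U : submodule (fun y => y = 0 \/ exists2 P : T, C P & sval P y) /\
           ~ (x = 0 \/ exists2 P : T, C P & sval P x).
    split; last by case=> // -[[P /= []]].
    split; first by left.
    move=> a y z [->|[P CP Py]] [->|[D CD Dz]].
    - by left; rewrite scaler0 addr0.
    - by right; exists D; rewrite // scaler0 add0r.
    - right; exists P; rewrite // addr0; case: P Py {CP} => P /= [[P0 Psub] _] Py.
      by rewrite -[_ *: _]addr0; apply: Psub.
    - have [/asboolP PD|/asboolP DP] := Ctot P D CP CD; right.
        exists D => //; have [[_ Dsub] _] := svalP D.
        by apply: Dsub => //; apply: PD.
      exists P => //; have [[_ Psub] _] := svalP P.
      by apply: Psub => //; apply: DP.
  exists (exist (fun P : M -> Prop => submodule P /\ ~ P x) _ U) => P CP; apply/asboolP => y Py /=.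
  by right; exists P.
- have [Psub Px] := svalP P; have [Q [p [psurj pE]]] := ex_quo Psub.
  exists Q, p; split=> // [/pE //|q]; have [y <-] := psurj q => y0.
  apply: contrapT => /forallNP nx.
  (* Otherwise P + L y still avoids x; by maximality it equals P, so y is zero in the quotient. *)
  have D : submodule (fun z => exists a : L, sval P (z - a *: y)) /\
      ~ exists a : L, sval P (x - a *: y).
    split; last by move=> [a /pE]; rewrite linearB linearZ_LR => /subr0_eq; apply: nx.
    split; first by exists 0; rewrite scale0r subr0; case: Psub.
    move=> a z w [b zb] [c wc]; exists (a * b + c).
    rewrite scalerDl -scalerA opprD addrACA -scalerBr.
    by case: Psub => _ Psub; apply: Psub.
  have DP : exist (fun P : M -> Prop => submodule P /\ ~ P x) _ D = P.
    apply: Pmax; apply/asboolP => z Pz /=.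
    by exists 0; rewrite scale0r subr0.
  apply: y0; apply/pE; rewrite -DP /=.
  by exists 1; rewrite scale1r subrr; case: Psub.
Qed.

End Zorn.

Section Hopkins.

Variable R : comPzRingType.
Hypothesis Rart : artinian R.
Implicit Types J K M N Q S T U V W : lmodType R.

Lemma ideal_submodule (P : R -> Prop) : is_ideal P <-> @submodule R R^o P.
Proof.
split=> [[P0 PD PZ]|[P0 Plin]]; first by split=> // a x y Px Py; apply: PD => //; apply: PZ.
split=> // [x y Px Py|a x Px].
  by have := Plin 1 x y Px Py; rewrite scale1r.
by have := Plin a x 0 Px P0; rewrite addr0.
Qed.

Lemma ideal_min (F : (R -> Prop) -> Prop) :
  (forall P, F P -> @submodule R R^o P) -> (exists P, F P) ->
  exists P, F P /\ forall D, F D -> (forall x, D x -> P x) -> forall x, P x -> D x.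
Proof.
move=> Fsub [P0 FP0]; apply: contrapT => /forallNP nmin.
pose T := {P : R -> Prop | F P}.
pose below (P D : T) := (forall x, sval D x -> sval P x) /\
  exists x, sval P x /\ ~ sval D x.
have step (P : T) : {D : T | below P D}.
  apply: cid; have := nmin (sval P).
  move=> /not_andP[|/existsNP[D /not_implyP[FD /not_implyP[DP /existsNP[x /not_implyP[Px Dx]]]]]].
    by case; apply: (svalP P).
  by exists (exist _ D FD); split=> //; exists x.
have [f [f0 fS]] := dependent_choice step (exist _ P0 FP0).
have [||n nE] := Rart (I := fun n => sval (f n)).
- by move=> n; apply/ideal_submodule/Fsub; apply: (svalP (f n)).
- by move=> n x; have [sub _] := fS n; apply: sub.
have [_ [x [xn xn1]]] := fS n.
by apply: xn1; apply/(nE n.+1 (leqnSn n)).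
Qed.

(** R acts on S through the field R / Ann(S), in which r is invertible. *)
Lemma simple_annihilator S (s : S) (r : R) : simple S -> r *: s <> 0 ->
  exists r', forall t : S, r' *: (r *: t) = t.
Proof.
move=> [_ Ss] rs.
have [f fE] : exists f : {linear R^o -> S}, forall a, f a = (a : R) *: (r *: s).
  by move: (r *: s) => t; apply: ex_linear => a b c; rewrite scalerDl scalerA.
have [I [p [i [psurj iinj ipE]]]] := ex_image f.
have isurj : surj i.
  have [//|I0] := Ss _ i iinj; case: rs.
  by rewrite -[LHS]scale1r -[LHS](fE 1) -ipE (I0 (p _)) linear0.
have gen (t : S) : exists a, t = a *: (r *: s).
  have [y <-] := isurj t; have [a <-] := psurj y.
  by exists a; rewrite ipE fE.
have [r' r'E] := gen s; exists r' => t.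
have [a ->] := gen t.
rewrite [in RHS]r'E !scalerA; congr (_ * _ *: s).
by rewrite mulrC [r' * r]mulrC mulrA.
Qed.

Lemma length1_cyclic N (x : N) : (forall y, y <> 0 -> exists a : R, x = a *: y) ->
  (forall y, exists a : R, y = a *: x) -> length_le 1 N.
Proof.
move=> xy yx K i iinj ins k; apply: contrapT => k0; apply: ins => y.
have [|a aE] := xy (i k); first by move=> /(linear_inj0 iinj).
have [b ->] := yx y; exists (b *: (a *: k)).
by rewrite (linearZ_LR i) (linearZ_LR i) aE.
Qed.

Definition cofinite (P : R -> Prop) : Prop :=
  exists Q (p : {linear R^o -> Q}),
    [/\ surj p, forall x, p x = 0 <-> P x & finite_length Q].

Lemma cofinite_submodule P : cofinite P -> @submodule R R^o P.
Proof.
move=> [Q [p [_ pP _]]]; split=> [|a x y /pP px /pP py]; first by apply/pP; rewrite linear0.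
by apply/pP; rewrite linearP px py scaler0 addr0.
Qed.

Lemma cofinite_ker Q (p : {linear R^o -> Q}) : surj p -> finite_length Q ->
  cofinite (fun x => p x = 0).
Proof. by move=> psurj Ql; exists Q, p. Qed.

(** * The least ideal of finite colength *)

Section LeastCofinite.

Variable I : R -> Prop.
Hypothesis Icof : cofinite I.
Hypothesis Imin : forall D, cofinite D -> forall x, I x -> D x.

(* Otherwise I / Ann(S) I would have a simple quotient, and the kernel of
   I -> I / Ann(S) I -> simple would be a smaller cofinite ideal. *)
Lemma least_cofinite_simple S (D : R -> Prop) : simple S -> @submodule R R^o D ->
  (forall a b, (forall t : S, a *: t = 0) -> I b -> D (a * b)) ->
  forall x, I x -> D x.
Proof.
move=> Ss Dsub DI x Ix; apply: contrapT => Dx.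
have [J [i [iinj iE]]] := ex_sub (cofinite_submodule Icof).
have [T [t [tsurj tE]]] := ex_quo Dsub.
have [W [w [j [wsurj jinj jwE]]]] := ex_image (t \o i).
have [x' x'E] : exists x', i x' = x by apply/iE.
have [|Q [q [qsurj qx qgen]]] := @zorn_quotient R W (w x').
  move=> w0; apply: Dx; apply/tE; rewrite -x'E -[LHS]jwE w0 linear0 //.
have qS a : (forall s : S, a *: s = 0) -> forall y : Q, a *: y = 0.
  move=> aS y; have [z <-] := qsurj y; have [b <-] := wsurj z.
  rewrite -(linearZ_LR q) -(linearZ_LR w); suff -> : w (a *: b) = 0 by rewrite linear0.
  apply: (linear_inj0 jinj); rewrite jwE /= (linearZ_LR i) (linearZ_LR t).
  by rewrite -(linearZ_LR t); apply/tE; apply: DI => //; apply/iE; exists b.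
(* Q is a vector space over the field R / Ann(S), and each of its lines contains [q (w x')], so it
   is one-dimensional. *)
have Ql : length_le 1 Q.
  apply: (length1_cyclic qgen) => y.
  have [->|y0] := pselect (y = 0); first by exists 0; rewrite scale0r.
  have [a aE] := qgen y y0.
  have /existsNP[s as_] : ~ forall s : S, a *: s = 0.
    by move=> /qS ay; apply: qx; rewrite aE ay.
  have [r rE] := simple_annihilator Ss as_; exists r; rewrite aE.
  have /qS/(_ y)/eqP : forall t : S, (r * a - 1) *: t = 0.
    by move=> u; rewrite scalerBl scale1r -scalerA rE subrr.
  by rewrite scalerBl scale1r -scalerA subr_eq0 => /eqP.
have [h hE] := ex_comp q w.
have hsurj : surj h.
  by move=> y; have [z <-] := qsurj y; have [b <-] := wsurj z; exists b.
pose K (r : R) := exists z, i z = r /\ h z = 0.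
have Ksub : @submodule R R^o K.
  split=> [|a _ _ [z [<- hz]] [y [<- hy]]]; first by exists 0; rewrite !linear0.
  by exists (a *: z + y); rewrite (linearP i) (linearP h) hz hy scaler0 addr0.
have [U [u [usurj uE]]] := ex_quo Ksub.
have [U0 [u0 [u0surj u0E U0l]]] := Icof.
have [|f fE] := @factor_surj _ _ _ _ h (u \o i) hsurj.
  by move=> z hz; apply/uE; exists z.
have [|g gE] := @factor_surj _ _ _ _ u u0 usurj.
  by move=> r /uE[z [<- _]]; apply/u0E/iE; exists z.
have fgs : short_exact f g.
  split.
  - apply: linear_inj => y; have [z <-] := hsurj y; rewrite fE => /uE[z' [/iinj <-]] //.
  - move=> y; have [r <-] := usurj y; rewrite gE; split.
      by move=> /u0E/iE[z <-]; exists (h z); rewrite fE.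
    move=> [z ez]; have [z' zE] := hsurj z.
    by rewrite -gE -ez -zE fE /= gE; apply/u0E/iE; exists z'.
  - by move=> y; have [r <-] := u0surj y; exists (u r); rewrite gE.
have Kcof : cofinite K.
  exists U, u; split=> //; apply: finite_length_ext fgs _ U0l.
  by exists 1%N.
have [z [zE hz]] := Imin Kcof Ix; apply: qx.
by rewrite -[RHS]hz hE; congr (q (w _)); apply: iinj; rewrite x'E zE.
Qed.

(** Induction on the length of N: Ann(K) Ann(S) kills N, so for a in Ann(K) the simple case applies
    to the ideal of all y with [D (a * y)]. *)
Lemma least_cofinite_annihilator N (D : R -> Prop) : finite_length N ->
  @submodule R R^o D ->
  (forall a b, (forall t : N, a *: t = 0) -> I b -> D (a * b)) ->
  forall x, I x -> D x.
Proof.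
move=> [n]; elim: n N D => [|n IH] N D Nn Dsub DI x Ix.
  by rewrite -[x]mul1r; apply: DI => // t; rewrite scale1r; apply: Nn.
have [N0|/existsNP Nn0] := pselect (forall t : N, t = 0).
  by rewrite -[x]mul1r; apply: DI => // t; rewrite scale1r.
have [S [p [psurj Ss]]] := @simple_quotient R N (ex_intro (fun m => length_le m N) _ Nn) Nn0.
have [K [k [kinj kp _]]] := ses_ker psurj.
apply: (IH K D) => //.
  apply: (Nn K k kinj) => ksurj; case: Ss => -[s s0] _.
  by apply: s0; have [y <-] := psurj s; apply/kp.
move=> a b aK Ib.
apply: (@least_cofinite_simple S (fun y => D (a * y))) => //.
  case: Dsub => D0 Dlin; split=> [|r y z Dy Dz]; first by rewrite mulr0.
  rewrite [a * _]mulrDr; have -> : a * (r *: (y : R^o)) = r * (a * y) by rewrite mulrCA.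
  exact: Dlin.
move=> c d cS Id; rewrite mulrA; apply: DI => // t.
have /kp[y yE] : p (c *: t) = 0 by rewrite (linearZ_LR p) cS.
by rewrite -scalerA -yE -(linearZ_LR k) aK linear0.
Qed.

(** The previous lemma for N = R / I, whose annihilator is I itself. *)
Lemma least_cofinite_idempotent (D : R -> Prop) : @submodule R R^o D ->
  (forall a b, I a -> I b -> D (a * b)) -> forall x, I x -> D x.
Proof.
have [U [u [usurj uE Ul]]] := Icof => Dsub DI.
apply: (@least_cofinite_annihilator U D Ul Dsub) => a b aU Ib; apply: DI => //.
by apply/uE; rewrite -[a]mulr1 -(aU (u 1)) -(linearZ_LR u).
Qed.

(** Otherwise R / (1 - c) has a quotient of length 1. The kernel of R onto it is cofinite, so it
    contains c as well as 1 - c, hence 1. *)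
Lemma least_cofinite_jacobson c : I c -> exists r, r * (1 - c) = 1.
Proof.
move=> Ic; apply: contrapT => nr.
pose D (z : R) := exists r, r * (1 - c) = z.
have Dsub : @submodule R R^o D.
  split=> [|a _ _ [r <-] [s <-]]; first by exists 0; rewrite mul0r.
  by exists (a * r + s); rewrite mulrDl -mulrA.
have [T [t [tsurj tE]]] := ex_quo Dsub.
have [|Q [q [qsurj q1 qgen]]] := @zorn_quotient R T (t 1); first by move=> /tE.
have qtsurj : surj (q \o t).
  by move=> y; have [z <-] := qsurj y; have [r <-] := tsurj z; exists r.
have Ql : length_le 1 Q.
  apply: (length1_cyclic qgen) => y; have [a <-] := qtsurj y.
  by exists a; rewrite /= -(linearZ_LR q) -(linearZ_LR t); congr (q (t _)); rewrite [RHS]mulr1.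
have qc : q (t c) = 0.
  by apply: (Imin (@cofinite_ker Q (q \o t) qtsurj _) Ic); exists 1%N.
have q1c : q (t (1 - c)) = 0.
  suff -> : t (1 - c) = 0 by rewrite linear0.
  by apply/tE; exists 1; rewrite mul1r.
by apply: q1; rewrite -[1](subrK c) (linearD t) (linearD q) q1c qc addr0.
Qed.

(** For J minimal with J I <> 0 and a' in J not killing I, also a' I I <> 0 by idempotence. So J =
    a' I, hence a' = a' c with c in I, and 1 - c is invertible. *)
Lemma least_cofinite_eq0 x : I x -> x = 0.
Proof.
move=> Ix; apply: contrapT => x0.
have [a [b [Ia Ib ab0]]] : exists a b, [/\ I a, I b & a * b <> 0].
  apply: contrapT => nab; apply: x0.
  apply: (least_cofinite_idempotent (D := fun z => z = 0)) Ix.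
    by split=> // c y z -> ->; rewrite scaler0 addr0.
  move=> a b Ia Ib; apply: contrapT => ab0; apply: nab.
  by exists a, b.
have [||J [[Jsub [{Ia}a' [{Ib}b' [Ja Ib ab0']]]] Jmin]] := @ideal_min
   (fun J : R -> Prop => @submodule R R^o J /\ exists a b, [/\ J a, I b & a * b <> 0]).
- by move=> J [].
- by exists I; split; [apply: cofinite_submodule|exists a, b].
have Isub := cofinite_submodule Icof.
have Jsub' := Jsub; case/ideal_submodule: Jsub' => _ _ JZ.
pose E (z : R) := exists c, I c /\ z = a' * c.
have Esub : @submodule R R^o E.
  case: Isub => I0 Ilin; split=> [|r _ _ [c [Ic ->]] [d [Id ->]]].
    by exists 0; rewrite mulr0.
  exists (r * c + d); split; first exact: Ilin.
  by rewrite mulrDr; congr (_ + _); rewrite [LHS]mulrCA.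
have [c [Ic ac]] : E a'.
  apply: Jmin => //; last by move=> _ [c [Ic ->]]; rewrite mulrC; apply: JZ.
  split=> //; apply: contrapT => nE; apply: ab0'.
  apply: (least_cofinite_idempotent (D := fun z => a' * z = 0)) Ib.
    split=> [|r y z y0 z0]; first by rewrite mulr0.
    by rewrite mulrDr z0 addr0 [LHS]mulrCA y0 mulr0.
  move=> c d Ic Id; rewrite mulrA; apply: contrapT => cd; apply: nE.
  by exists (a' * c), d; split=> //; exists c.
have [r rE] := least_cofinite_jacobson Ic; apply: ab0'.
have a0 : a' * (1 - c) = 0 by rewrite mulrBr mulr1 -ac subrr.
by rewrite -[a']mulr1 -rE mulrCA a0 mulr0 mul0r.
Qed.

End LeastCofinite.

(* The least cofinite ideal I is idempotent and contained in every maximal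
   ideal, so a minimal J with J I <> 0 would have to vanish. *)
Lemma finite_length_regular : finite_length (R^o : lmodType R).
Proof.
have [||I [Icof Imin]] := @ideal_min cofinite.
- exact: cofinite_submodule.
- exists (fun _ => True); have [|Q [p [psurj pE]]] := @ex_quo R R^o (fun _ => True).
    by [].
  exists Q, p; split=> //; exists 0%N => y; have [x <-] := psurj y; exact/pE.
(* A minimal cofinite ideal is the least one, because R / (D and I) embeds in R / D x R / I. *)
have Ileast D : cofinite D -> forall x, I x -> D x.
  move=> Dcof x Ix.
  have [Q [p [psurj pE Ql]]] := Dcof; have [Q' [p' [psurj' pE' Ql']]] := Icof.
  have [h hE] := ex_pair p p'.
  have [W [w [j [wsurj jinj jwE]]]] := ex_image h.
  have kerE y : w y = 0 <-> D y /\ I y.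
    split=> [w0|[/pE py /pE' py']].
      have := jwE y; rewrite w0 linear0 hE => -[e e'].
      by split; [apply/pE|apply/pE'].
    by apply: (linear_inj0 jinj); rewrite jwE hE py py'.
  suff [] : D x /\ I x by [].
  apply: (Imin (fun y => D y /\ I y)) => //; last by move=> y [].
  exists W, w; split=> //; apply: finite_length_inj jinj _.
  exact: finite_length_pair.
have [Q [p [psurj pE Ql]]] := Icof.
apply: (@finite_length_inj _ _ _ p) Ql; apply: linear_inj => x /pE.
exact: (least_cofinite_eq0 Icof Ileast).
Qed.

End Hopkins.

(** * The injective cogenerator *)

Section InjectiveCogenerator.

Variable R : comPzRingType.
Hypothesis Rlen : finite_length (R^o : lmodType R).
Implicit Types A B E G H J K M N Q S T U V W : lmodType R.

(* The simple submodules of E are pairwise non-isomorphic; among the modules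
   with this property, those of maximal length are injective cogenerators. *)
Definition simple_multiplicity1 E : Prop :=
  forall S (f g : {linear S -> E}), simple S -> (exists s, f s <> 0) ->
  exists r : R, forall s, g s = r *: f s.

Lemma simple_cyclic S (s t : S) : simple S -> s <> 0 -> exists r : R, t = r *: s.
Proof.
move=> [_ Ss] s0.
have [f fE] : exists f : {linear R^o -> S}, forall a, f a = (a : R) *: s.
  by apply: ex_linear => a b c; rewrite scalerDl scalerA.
have [I [p [i [psurj iinj ipE]]]] := ex_image f.
have [isurj|I0] := Ss _ i iinj; last first.
  by case: s0; rewrite -[s]scale1r -[LHS](fE 1) -ipE (I0 (p _)) linear0.
have [y <-] := isurj t; have [a <-] := psurj y.
by exists a; rewrite ipE fE.
Qed.

Lemma simple_inj S M (f : {linear S -> M}) : simple S -> (exists s, f s <> 0) ->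
  injective f.
Proof.
move=> [_ Ss] [s fs]; have [K [k [kinj kf]]] := ex_ker f.
have [ksurj|K0] := Ss K k kinj.
  by case: fs; apply/kf; apply: ksurj.
by apply: linear_inj => x /kf[y <-]; rewrite (K0 y) linear0.
Qed.

Lemma simple_bij S T (f : {linear S -> T}) : simple S -> simple T ->
  (exists s, f s <> 0) -> injective f /\ surj f.
Proof.
move=> Ss [_ Ts] f0; have finj := simple_inj Ss f0; split=> //.
have [//|S0] := Ts S f finj; case: f0 => s [].
by rewrite (S0 s) linear0.
Qed.

(** H stands for any submodule of Hom(V, E), a form stable under restriction to K. The kernel of
    that restriction lies in Hom(S, E), which multiplicity one bounds by length 1. *)
Lemma dual_length E n V H (ev : {linear H -> (V -> E)}) :
  simple_multiplicity1 E -> injective ev -> (forall h, linear (ev h)) ->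
  length_le n V -> length_le n H.
Proof.
move=> E1; elim: n V H ev => [|n IH] V H ev evinj evlin Vn.
  move=> h; apply: (linear_inj0 evinj); apply: funext => v.
  by have [g gE] := ex_linear (evlin h); rewrite -gE (Vn v) linear0.
have [V0|/existsNP Vn0] := pselect (forall v : V, v = 0).
  by apply: length_leS; apply: (IH V H ev evinj evlin); apply: (length_leW (leq0n n)).
have [S [p [psurj Ss]]] := @simple_quotient R V (ex_intro (fun m => length_le m V) _ Vn) Vn0.
have [K [k kps]] := ses_ker psurj; have [kinj kp _] := kps.
have Kn : length_le n K.
  apply: (Vn K k kinj) => ksurj; case: Ss => -[s s0] _.
  by apply: s0; have [y <-] := psurj s; apply/kp.
have [r rE] : exists r : {linear H -> (K -> E)}, forall h x, r h x = ev h (k x).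
  have [|r rE] := @ex_linear R H (K -> E) (fun h x => ev h (k x)).
    by move=> a x y; rewrite linearP.
  by exists r => h x; rewrite rE.
have [I [q [i [qsurj iinj iqE]]]] := ex_image r.
have [H' [h' [h'inj h'q]]] := ex_ker q.
have In : length_le n I.
  apply: (IH K I i iinj _ Kn) => y; have [h <-] := qsurj y.
  by rewrite iqE => a u v; rewrite !rE linearP (evlin h).
apply: (length_le_ext (a := 1) (And3 h'inj h'q qsurj) _ In).
have evK x y : ev (h' x) (k y) = 0.
  by rewrite -rE -iqE (exact_comp0 _ h'q) linear0.
have [s sE] := choice psurj.
have evs x v : ev (h' x) (s (p v)) = ev (h' x) v.
  have [g gE] := ex_linear (evlin (h' x)); rewrite -!gE.
  have /kp[y yE] : p (s (p v) - v) = 0 by rewrite linearB sE subrr.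
  by apply/eqP; rewrite -subr_eq0 -linearB -yE gE evK.
have evp x : exists f : {linear S -> E}, forall v, f (p v) = ev (h' x) v.
  have [g gE] := ex_linear (evlin (h' x)).
  have [|f fE] := @factor_surj _ _ _ _ p g psurj.
    by move=> v /kp[y <-]; rewrite gE evK.
  by exists f => v; rewrite fE gE.
(* A nonzero y in N induces a nonzero map S -> E, of which every other one is a multiple; then N
   would be everything. *)
move=> N j jinj jns y; apply: contrapT => y0; apply: jns => x.
have [f fE] := evp (j y); have [g gE] := evp x.
have [|c cE] := E1 S f g Ss.
  apply: contrapT => /forallNP f0; apply: y0; apply: jinj; apply: h'inj.
  rewrite !linear0; apply: evinj; rewrite linear0; apply: funext => v.
  by rewrite -fE; have /contrapT -> := f0 (p v).
exists (c *: y); apply: h'inj; apply: evinj; apply: funext => v.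
rewrite (linearZ_LR j) (linearZ_LR h') (linearZ_LR ev) -gE cE -[RHS]/(c *: (f (p v))) fE //.
Qed.

(** E is Hom(R, E), so it is no longer than R. *)
Lemma simple_multiplicity1_bound : exists n, forall E,
  simple_multiplicity1 E -> length_le n E.
Proof.
have [n Rn] := Rlen; exists n => E E1.
have [ev evE] : exists ev : {linear E -> (R^o -> E)}, forall e r, ev e r = (r : R) *: e.
  have [|ev evE] := @ex_linear R E (R^o -> E) (fun e r => (r : R) *: e).
    move=> a x y; apply: funext => r.
    by rewrite scalerDr scalerA mulrC -scalerA.
  by exists ev => e r; rewrite evE.
apply: (dual_length (ev := ev)) Rn => //.
  by apply: linear_inj => x /(congr1 (fun f => f 1)); rewrite evE scale1r.
by move=> e a r r'; rewrite !evE scalerDl scalerA.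
Qed.

Lemma ex_maximal_multiplicity1 : exists E, simple_multiplicity1 E /\
  forall E' (j : {linear E -> E'}), simple_multiplicity1 E' -> injective j -> surj j.
Proof.
have [n [En nmin]] := least_nat simple_multiplicity1_bound.
suff [E [E1 Emin]] : exists E, simple_multiplicity1 E /\ forall m, length_le m E -> (n <= m)%N.
  exists E; split=> // E' j E'1 jinj; apply: contrapT => jns.
  have [/Emin] := proper_sub_length jinj jns (En _ E'1).
  by case: n {En nmin Emin} => // n; rewrite ltnn.
(* The least common bound is attained: by the zero module if n = 0, and otherwise because n - 1
   would also be a bound. *)
have [n0|n0] := eqVneq n 0%N.
  exists ('I_0 -> R^o); split; last by move=> m _; rewrite n0.
  by move=> S f g _ [s []]; apply: pow0.
apply: contrapT => /forallNP nE.
have : (n <= n.-1)%N; last by case: n n0 {En nmin nE} => // n _; rewrite ltnn.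
apply: nmin => E E1; have := nE E => /not_andP[//|/existsNP[m /not_implyP[Em]]].
move=> /negP; rewrite -ltnNge => mn; apply: length_leW Em.
by case: n mn {En nE n0} => // n; rewrite ltnS.
Qed.

(** An essential extension has no new simple submodules. *)
Lemma essential_multiplicity1 E E' (j : {linear E -> E'}) :
  simple_multiplicity1 E -> injective j ->
  (forall N (i : {linear N -> E'}), injective i -> (exists x : N, x <> 0) ->
     exists x e, i x = j e /\ i x <> 0) ->
  simple_multiplicity1 E'.
Proof.
move=> E1 jinj ess S f g Ss f0.
have lift (h : {linear S -> E'}) : (exists s, h s <> 0) ->
    exists h' : {linear S -> E}, forall s, j (h' s) = h s.
  move=> h0; have hinj := simple_inj Ss h0.
  have [s0 [e [he hs0]]] := ess S h hinj (proj1 Ss).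
  apply: factor_inj jinj _ => s.
  have [|r ->] := simple_cyclic (s := s0) s Ss.
    by move=> s00; apply: hs0; rewrite s00 linear0.
  by exists (r *: e); rewrite !linearZ_LR -he.
have [g0|/forallNP g0] := pselect (exists s, g s <> 0); last first.
  by exists 0 => s; rewrite scale0r; apply: contrapT; apply: g0.
have [f' f'E] := lift f f0; have [g' g'E] := lift g g0.
have [|r rE] := E1 S f' g' Ss.
  by have [s s0] := f0; exists s => fs; apply: s0; rewrite -f'E fs linear0.
by exists r => s; rewrite -g'E rE linearZ_LR f'E.
Qed.

Variable E : lmodType R.
Hypothesis E1 : simple_multiplicity1 E.
Hypothesis Emax : forall E' (j : {linear E -> E'}),
  simple_multiplicity1 E' -> injective j -> surj j.

Lemma cogenerator_finite_length : finite_length E.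
Proof. by have [n nE] := simple_multiplicity1_bound; exists n; apply: nE. Qed.

(** In the pushout G of the extension along f, a shortest quotient Q in which E still embeds is an
    essential extension of E: a submodule missing E could be divided out. By maximality Q is E,
    which retracts G onto E. *)
Lemma cogenerator_injective A B (i : {linear A -> B}) (f : {linear A -> E}) :
  injective i -> finite_length B -> exists g : {linear B -> E}, forall a, g (i a) = f a.
Proof.
move=> iinj Bl; have [C [p ips]] := ses_coker iinj.
have [G [u [v [q [uvs _ _ <- _]]]]] := ses_pushout f ips.
have [uinj uv vsurj] := uvs.
have Gl : finite_length G.
  apply: (finite_length_ext uvs cogenerator_finite_length).
  by have [_ _ psurj] := ips; apply: finite_length_surj psurj Bl.
have [|n [[Q [t [tsurj tuinj Qn]]] nmin]] := @least_nat (fun n => exists Q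
    (t : {linear G -> Q}), [/\ surj t, injective (t \o u) & length_le n Q]).
  by have [n Gn] := Gl; exists n, G, idfun; split=> // x; exists x.
suff Q1 : simple_multiplicity1 Q.
  have [r [rt tr]] := ex_inverse tuinj (Emax Q1 tuinj).
  by exists (r \o t) => x; apply: rt.
apply: (essential_multiplicity1 E1 tuinj) => N j jinj [x x0].
apply: contrapT => /forallNP ness.
have [D [d [dsurj jd]]] := ex_coker j.
have dtuinj : injective ((d \o t) \o u).
  apply: linear_inj => e /jd[y yE]; apply: (linear_inj0 tuinj).
  have /forallNP/(_ e)/not_andP[|] := ness y; first by case.
  by rewrite yE => /contrapT.
have ndinj : ~ injective d.
  move=> dinj; apply: x0; apply: (linear_inj0 jinj); apply: (linear_inj0 dinj).
  exact: exact_comp0 jd.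
case: n Qn nmin => [|n] Qn nmin; first by apply: x0; apply: jinj; rewrite [LHS]Qn [RHS]Qn.
have : (n.+1 <= n)%N; last by rewrite ltnn.
apply: nmin; exists D, (d \o t); split=> //.
  by move=> y; have [z <-] := dsurj y; have [w <-] := tsurj z; exists w.
exact: length_le_proper_quo dsurj ndinj Qn.
Qed.

(** If S did not embed in E, then E (+) S would still have multiplicity one, against maximality. *)
Lemma cogenerator_simple S : simple S -> exists (f : {linear S -> E}) s, f s <> 0.
Proof.
move=> Ss; apply: contrapT => /forallNP nf.
have fS0 (f : {linear S -> E}) s : f s = 0.
  by have /forallNP/(_ s)/contrapT := nf f.
have [i iE] := ex_inl E S.
have iinj : injective i by move=> x y; rewrite !iE => -[].
suff ES1 : simple_multiplicity1 (E * S)%type.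
  have [[s s0] _] := Ss; have [e] := Emax ES1 iinj (0, s).
  by rewrite iE => -[_ /esym].
have [p pE] := ex_fst E S; have [q qE] := ex_snd E S.
have S'0 S' (f : {linear S' -> E}) (g : {linear S' -> S}) : simple S' ->
    (exists s, g s <> 0) -> forall s, f s = 0.
  move=> Ss' g0 s; have [ginj gsurj] := simple_bij Ss' Ss g0.
  by have [h [gh hg]] := ex_inverse ginj gsurj; rewrite -(gh s); apply: (fS0 (f \o h)).
move=> S' f g Ss' [s fs].
(* If f has a nonzero component in S, then S' is isomorphic to S, the components in E vanish, and
   the commutativity of R makes g a multiple of f. Otherwise f and g both land in E. *)
have [f20|/forallNP f20] := pselect (exists s, q (f s) <> 0).
  have [finj fsurj] := simple_bij (f := q \o f) Ss' Ss f20.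
  have [h [fh hf]] := ex_inverse finj fsurj.
  have [[s0 s00] _] := Ss.
  have [r rE] := simple_cyclic (s := s0) (q (g (h s0))) Ss s00.
  exists r => t; rewrite [LHS]surjective_pairing [f t]surjective_pairing -!pE -!qE.
  have e1 := S'0 _ (p \o f) (q \o f) Ss' f20 t.
  have e2 := S'0 _ (p \o g) (q \o f) Ss' f20 t.
  rewrite /= in e1 e2; rewrite e1 e2; congr pair; first by rewrite /= scaler0.
  have [c cE] := simple_cyclic (s := s0) (q (f t)) Ss s00.
  have -> : t = c *: h s0 by rewrite -[LHS]fh /= cE (linearZ_LR h).
  rewrite (linearZ_LR g) (linearZ_LR q) rE (linearZ_LR f) (linearZ_LR q) /=.
  by rewrite [q (f _)]hf !scalerA mulrC.
have f2 t : q (f t) = 0 by apply: contrapT; apply: f20.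
have f10 : exists s, (p \o f) s <> 0.
  exists s => /= e; apply: fs; rewrite [LHS]surjective_pairing -pE -qE.
  by rewrite e f2.
have g2 t : q (g t) = 0.
  apply: contrapT => g20; have [s' []] := f10.
  by apply: (S'0 _ _ (q \o g)) => //; exists t.
have [r rE] : exists r : R, forall t, (p \o g) t = r *: (p \o f) t by apply: E1.
exists r => t; rewrite [LHS]surjective_pairing [f t]surjective_pairing -!pE -!qE.
rewrite f2 g2; have /= -> := rE t; congr pair.
by rewrite /= scaler0.
Qed.

(** A simple quotient of R x embeds in E, and the map extends from R x to M. *)
Lemma cogenerator_separates M (x : M) : finite_length M -> x <> 0 ->
  exists f : {linear M -> E}, f x <> 0.
Proof.
move=> Ml x0.
have [f fE] : exists f : {linear R^o -> M}, forall a, f a = (a : R) *: x.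
  by apply: ex_linear => a b c; rewrite scalerDl scalerA.
have [I [p [i [psurj iinj ipE]]]] := ex_image f.
have ip1 : i (p 1) = x by rewrite ipE fE scale1r.
have gen y : exists a : R, y = a *: p 1.
  have [a <-] := psurj y; exists a.
  by rewrite -(linearZ_LR p) [_ *: _]mulr1.
have [||S [q [qsurj Ss]]] := @simple_quotient R I.
- exact: finite_length_inj iinj Ml.
- by exists (p 1) => p1; apply: x0; rewrite -ip1 p1 linear0.
have [g [s gs]] := cogenerator_simple Ss.
have [h hE] := cogenerator_injective (g \o q) iinj Ml.
exists h; rewrite -ip1 hE /= => e; apply: gs.
have [y <-] := qsurj s; have [a ->] := gen y.
by rewrite (linearZ_LR q) (linearZ_LR g) e scaler0.
Qed.

End InjectiveCogenerator.

(** * Double annihilators with respect to E *)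

Section DoubleAnnihilator.

Variable R : comPzRingType.
Implicit Types A E H T V : lmodType R.

(** Let H be the maps vanishing on the annihilator T of A, and Q = V / T. Then A lies in H, H embeds
    in Hom(Q, E) and Q in Hom(A, E); two uses of [dual_length] make H no longer than A. *)
Lemma double_annihilator E V A (ev : {linear A -> (V -> E)}) (f : {linear V -> E}) :
  simple_multiplicity1 E -> finite_length V ->
  injective ev -> (forall a, linear (ev a)) ->
  (forall v, (forall a, ev a v = 0) -> f v = 0) ->
  exists a, forall v, ev a v = f v.
Proof.
move=> E1 [m Vm] evinj evlin fT.
have ev0 a : ev a 0 = 0 by have [g gE] := ex_linear (evlin a); rewrite -gE linear0.
have [|T [t [tinj tE]]] := @ex_sub R V (fun v => forall a, ev a v = 0).
  by split=> // c u v u0 v0 a; rewrite evlin u0 v0 scaler0 addr0.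
have [Q [q [qsurj tq]]] := ex_coker t.
have tqE v : q v = 0 <-> forall a, ev a v = 0.
  by split=> [/tq|v0]; [move/tE|apply/tq/tE].
pose P (h : V -> E) := linear h /\ forall v, q v = 0 -> h v = 0.
have [|H [j [jinj jE]]] := @ex_sub R (V -> E) P.
  split; first by split=> // c u v; rewrite scaler0 addr0.
  move=> c h k [hl h0] [kl k0]; split=> [d u v|v v0]; last first.
    by rewrite -[LHS]/(c *: h v + k v) h0 // k0 // scaler0 addr0.
  rewrite -[LHS]/(c *: h (d *: u + v) + k (d *: u + v)) hl kl.
  rewrite -[RHS]/(d *: (c *: h u + k u) + (c *: h v + k v)) !scalerDr !scalerA.
  by rewrite [c * d]mulrC addrACA.
have [|i iE] := @factor_inj _ _ _ _ j ev jinj.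
  move=> a; apply/jE; split; first exact: evlin.
  by move=> v /tqE.
have iinj : injective i by move=> x y e; apply: evinj; rewrite -!iE e.
have Afl : finite_length A by exists m; apply: dual_length E1 evinj evlin Vm.
have isurj : surj i.
  apply: (inj_length_surj Afl iinj) => n An.
  have [e eE] : exists e : {linear V -> (A -> E)}, forall v a, e v a = ev a v.
    have [|e eE] := @ex_linear R V (A -> E) (fun v a => ev a v).
      by move=> c u v; apply: funext => a; rewrite evlin.
    by exists e => v a; rewrite eE.
  have [|k kE] := @factor_surj _ _ _ _ q e qsurj.
    by move=> v /tqE v0; apply: funext => a; rewrite eE v0.
  have Qn : length_le n Q.
    apply: (dual_length (ev := k) E1) An.
      apply: linear_inj => y; have [v <-] := qsurj y; rewrite kE => e0.
      by apply/tqE => a; rewrite -eE e0.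
    by move=> y c a b; have [v <-] := qsurj y; rewrite kE !eE linearP.
  have jP h : P (j h) by apply/jE; exists h.
  have [s sE] := choice qsurj.
  have js h v : j h (s (q v)) = j h v.
    have [hl h0] := jP h; have [g gE] := ex_linear hl; rewrite -!gE.
    by apply/eqP; rewrite -subr_eq0 -linearB gE h0 // linearB sE subrr.
  have [l lE] : exists l : {linear H -> (Q -> E)}, forall h y, l h y = j h (s y).
    have [|l lE] := @ex_linear R H (Q -> E) (fun h y => j h (s y)).
      by move=> c h k'; apply: funext => y; rewrite linearP.
    by exists l => h y; rewrite lE.
  apply: (dual_length (ev := l) E1) Qn.
    apply: linear_inj => h lh; apply: jinj; rewrite linear0; apply: funext => v.
    by rewrite -js -lE lh.
  move=> h c y z; rewrite !lE; have [hl h0] := jP h.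
  have [u <-] := qsurj y; have [v <-] := qsurj z.
  by rewrite -linearP !js hl.
have [h hE] : exists h, j h = f.
  apply/jE; split; first exact: linearP.
  by move=> v /tqE; apply: fT.
by have [a aE] := isurj h; exists a => v; rewrite -iE aE hE.
Qed.

End DoubleAnnihilator.

(** * Restriction of scalars *)

(** A synonym of M tagged with phi, so that the R-action and the L-action live on different
    types. *)
Definition restrict (R L : pzRingType) (phi : {rmorphism R -> L})
  (M : lmodType L) : Type := M.

Section RestrictInstances.

Variables (R L : pzRingType) (phi : {rmorphism R -> L}) (M : lmodType L).

HB.instance Definition _ := GRing.Zmodule.on (restrict phi M).

Definition restrict_scale (r : R) (x : restrict phi M) : restrict phi M :=
  phi r *: (x : M).

Lemma restrict_scaleA a b x :
  restrict_scale a (restrict_scale b x) = restrict_scale (a * b) x.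
Proof. by rewrite /restrict_scale scalerA rmorphM. Qed.

Lemma restrict_scale1 : left_id 1 restrict_scale.
Proof. by move=> x; rewrite /restrict_scale rmorph1 scale1r. Qed.

Lemma restrict_scaleDr : right_distributive restrict_scale +%R.
Proof. by move=> a x y; rewrite /restrict_scale scalerDr. Qed.

Lemma restrict_scaleDl x : {morph restrict_scale^~ x : a b / a + b}.
Proof. by move=> a b; rewrite /restrict_scale rmorphD scalerDl. Qed.

HB.instance Definition _ := GRing.Zmodule_isLmodule.Build R (restrict phi M)
  restrict_scaleA restrict_scale1 restrict_scaleDr restrict_scaleDl.

End RestrictInstances.

Section Restriction.

Variables (R : comPzRingType) (L : pzRingType) (phi : {rmorphism R -> L}).
Hypothesis phiC : forall r x, phi r * x = x * phi r.
Local Notation res := (restrict phi).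

Implicit Types A B C M N Q U V W X Y Z : lmodType L.

Lemma ex_restrict M N (f : {linear M -> N}) :
  exists g : {linear res M -> res N}, forall x, g x = f x.
Proof. by apply: ex_linear => a x y; exact: (linearP f (phi a)). Qed.

Lemma restrict_length n M : length_le n (res M : lmodType R) -> length_le n M.
Proof.
elim: n M => [//|n IH] M Mn N f finj fns.
have [g gE] := ex_restrict f; apply: IH; apply: (Mn _ g).
  by move=> x y; rewrite !gE => /finj.
by move=> gsurj; apply: fns => y; have [x xE] := gsurj y; exists x; rewrite -gE.
Qed.

Hypothesis Rlen : finite_length (R^o : lmodType R).
Hypothesis Lfg : exists (n : nat) (g : 'I_n -> L),
  forall x, exists c : 'I_n -> R, x = \sum_(i < n) phi (c i) * g i.

Lemma finite_length_fin_gen_com (V : lmodType R) : fin_gen V -> finite_length V.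
Proof.
move=> /fin_gen_cover[n [p psurj]]; apply: finite_length_surj psurj _.
exact: finite_length_pow.
Qed.

Lemma finite_length_algebra : finite_length (res L^o : lmodType R).
Proof. exact: finite_length_fin_gen_com. Qed.

Lemma finite_length_restrict M : fin_gen M -> finite_length (res M : lmodType R).
Proof.
move=> /fin_gen_cover[n [p psurj]].
have [|q qE] := @ex_linear R ('I_n -> res L^o) (res M) p.
  by move=> a x y; exact: (linearP p (phi a)).
apply: (@finite_length_surj _ _ _ q).
  by move=> y; have [x xE] := psurj y; exists x; rewrite qE.
exact: finite_length_pow finite_length_algebra.
Qed.

Lemma fin_gen_finite_length M : fin_gen M -> finite_length M.
Proof. by move=> /finite_length_restrict[n Mn]; exists n; apply: restrict_length. Qed.

Lemma fin_gen_sub M N (i : {linear N -> M}) : injective i -> fin_gen M -> fin_gen N.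
Proof.
by move=> iinj /fin_gen_finite_length/(finite_length_inj iinj)/finite_length_fin_gen.
Qed.

End Restriction.

(** * The dual of the algebra and the Auslander-Reiten formula *)

Section Dual.

Variables (R : comPzRingType) (L : pzRingType) (phi : {rmorphism R -> L}).
Hypothesis phiC : forall r x, phi r * x = x * phi r.
Local Notation res := (restrict phi).
Variable E : lmodType R.

Definition scalar_linear (f : L -> E) : Prop :=
  forall r x y, f (phi r * x + y) = r *: f x + f y.

Lemma scalar_linear_submodule : @submodule R (L -> E) scalar_linear.
Proof.
split=> [r x y|c f g fl gl r x y]; first by rewrite scaler0 addr0.
rewrite -[LHS]/(c *: f (phi r * x + y) + g (phi r * x + y)) fl gl.
rewrite -[RHS]/(r *: (c *: f x + g x) + (c *: f y + g y)) !scalerDr !scalerA.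
by rewrite [c * r]mulrC addrACA.
Qed.

Definition dual_sub : lmodType R := sval (cid (ex_sub scalar_linear_submodule)).

Lemma dual_subP : exists i : {linear dual_sub -> (L -> E)},
  injective i /\ forall f, scalar_linear f <-> exists y, i y = f.
Proof. exact: svalP (cid (ex_sub scalar_linear_submodule)). Qed.

(** A synonym keeping only the additive group, so that L can act on it; the R-action comes back by
    restriction along phi. *)
Definition dual : Type := dual_sub.

HB.instance Definition _ := GRing.Zmodule.on dual.

Definition dual_eval (f : dual) : L -> E := sval (cid dual_subP) f.

Lemma dual_evalP f : scalar_linear (dual_eval f).
Proof. by have [_ iP] := svalP (cid dual_subP); apply/iP; exists f. Qed.

Lemma dual_intro (f : L -> E) : scalar_linear f ->
  exists g : dual, forall x, dual_eval g x = f x.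
Proof.
have [_ iP] := svalP (cid dual_subP) => /iP[g gE].
by exists g => x; rewrite -gE.
Qed.

Lemma dual_ext (f g : dual) : (forall x, dual_eval f x = dual_eval g x) -> f = g.
Proof.
have [iinj _] := svalP (cid dual_subP) => fg.
by apply: iinj; apply: funext.
Qed.

Lemma dual_addE f g x : dual_eval (f + g) x = dual_eval f x + dual_eval g x.
Proof. by rewrite /dual_eval linearD. Qed.

Lemma dual_eval0l x : dual_eval 0 x = 0.
Proof. by rewrite /dual_eval linear0. Qed.

Lemma dual_eval_sum n (f : 'I_n -> dual) x :
  dual_eval (\sum_i f i) x = \sum_i dual_eval (f i) x.
Proof.
apply: (big_morph (fun f => dual_eval f x)) => [g h|]; first exact: dual_addE.
exact: dual_eval0l.
Qed.

Lemma dual_scale_subproof (a : L) (f : dual) :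
  exists g : dual, forall x, dual_eval g x = dual_eval f (x * a).
Proof. by apply: dual_intro => r x y; rewrite mulrDl -mulrA dual_evalP. Qed.

Definition dual_scale (a : L) (f : dual) : dual := sval (cid (dual_scale_subproof a f)).

Lemma dual_scaleE a f x : dual_eval (dual_scale a f) x = dual_eval f (x * a).
Proof. exact: svalP (cid (dual_scale_subproof a f)) x. Qed.

Lemma dual_scaleA a b f : dual_scale a (dual_scale b f) = dual_scale (a * b) f.
Proof. by apply: dual_ext => x; rewrite !dual_scaleE mulrA. Qed.

Lemma dual_scale1 : left_id 1 dual_scale.
Proof. by move=> f; apply: dual_ext => x; rewrite dual_scaleE mulr1. Qed.

Lemma dual_scaleDr : right_distributive dual_scale +%R.
Proof. by move=> a f g; apply: dual_ext => x; rewrite dual_addE !dual_scaleE dual_addE. Qed.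

Lemma dual_evalD f x y : dual_eval f (x + y) = dual_eval f x + dual_eval f y.
Proof.
by have := dual_evalP f 1 x y; rewrite rmorph1 mul1r scale1r.
Qed.

Lemma dual_eval0 f : dual_eval f 0 = 0.
Proof. by apply: (addrI (dual_eval f 0)); rewrite -dual_evalD !addr0. Qed.

Lemma dual_scaleDl f : {morph dual_scale^~ f : a b / a + b}.
Proof.
move=> a b; apply: dual_ext => x.
by rewrite dual_addE !dual_scaleE mulrDr dual_evalD.
Qed.

HB.instance Definition _ := GRing.Zmodule_isLmodule.Build L dual
  dual_scaleA dual_scale1 dual_scaleDr dual_scaleDl.

Lemma dual_evalZ (a : L) (f : dual) x : dual_eval (a *: f) x = dual_eval f (x * a).
Proof. exact: dual_scaleE. Qed.

Lemma ex_dual_eval (x : L) :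
  exists h : {linear res dual -> E}, forall f : dual, h f = dual_eval f x.
Proof.
apply: (@ex_linear R (res dual) E (fun f : dual => dual_eval f x)) => a f g.
rewrite [LHS]dual_addE; congr (_ + _).
by rewrite [LHS]dual_evalZ -phiC -[_ * _]addr0 dual_evalP dual_eval0 addr0.
Qed.

Implicit Types A B C I J K M N Q S T U V W X Y Z : lmodType L.

(** The adjunction between restriction and coinduction: an R-linear form on X gives an L-linear map
    to D. Injectivity and separation pass from E to D this way. *)
Lemma coinduce X (t : {linear res X -> E}) :
  exists g : {linear X -> dual}, forall x l, dual_eval (g x) l = t (l *: x).
Proof.
have fE x : scalar_linear (fun l => t (l *: (x : X))).
  move=> r a b; rewrite -linearP; congr (t _).
  by rewrite scalerDl -scalerA.
have [g gE] := choice (fun x => dual_intro (fE x)).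
have [|h hE] := @ex_linear L X dual g; last by exists h => x l; rewrite hE gE.
move=> a x y; apply: dual_ext => l.
by rewrite dual_addE dual_evalZ !gE scalerDr -scalerA -linearD.
Qed.

Hypothesis Rlen : finite_length (R^o : lmodType R).
Hypothesis Lfg : exists (n : nat) (g : 'I_n -> L),
  forall x, exists c : 'I_n -> R, x = \sum_(i < n) phi (c i) * g i.
Hypothesis E1 : simple_multiplicity1 E.
Hypothesis Emax : forall (E' : lmodType R) (j : {linear E -> E'}),
  simple_multiplicity1 E' -> injective j -> surj j.

Lemma fin_gen_dual : fin_gen (dual : lmodType L).
Proof.
have [n Ln] := finite_length_algebra Rlen Lfg.
apply: finite_length_fin_gen; exists n; apply: (restrict_length (phi := phi)).
have [ev evE] : exists ev : {linear res dual -> (res L^o -> E)},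
    forall (f : dual) (x : L), ev f x = dual_eval f x.
  have [|ev evE] := @ex_linear R (res dual) (res L^o -> E) (fun f : dual => dual_eval f).
    move=> a f g; apply: funext => x.
    by have [h hE] := ex_dual_eval x; rewrite -[LHS]hE linearP !hE.
  by exists ev => f x; rewrite evE.
apply: (dual_length (ev := ev) E1) Ln.
- by move=> f g e; apply: dual_ext => x; rewrite -!evE e.
- by move=> f a x y; rewrite !evE; apply: dual_evalP.
Qed.

Lemma dual_injective A B (i : {linear A -> B}) (f : {linear A -> dual}) :
  injective i -> fin_gen B -> exists g : {linear B -> dual}, forall a, g (i a) = f a.
Proof.
move=> iinj Bfg; have [i' i'E] := ex_restrict phi i.
have [f' f'E] := ex_restrict phi f; have [e eE] := ex_dual_eval 1.
have [||t tE] := cogenerator_injective Rlen E1 Emax (i := i') (e \o f').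
- by move=> x y; rewrite !i'E => /iinj.
- exact: finite_length_restrict.
have [g gE] := coinduce t; exists g => a; apply: dual_ext => l.
rewrite gE -(linearZ_LR i) -i'E tE /= f'E eE linearZ_LR dual_evalZ.
by rewrite mul1r.
Qed.

Lemma dual_separates M (x : M) : fin_gen M -> x <> 0 ->
  exists g : {linear M -> dual}, g x <> 0.
Proof.
move=> /(finite_length_restrict Rlen Lfg) Ml x0.
have [t tx] := @cogenerator_separates R Rlen E E1 Emax (res M) x Ml x0.
have [g gE] := coinduce t; exists g => /(congr1 (fun f => dual_eval f 1)).
rewrite gE scale1r => tx0; apply: tx.
by rewrite tx0 dual_eval0l.
Qed.

(** Among the maps to powers of D one with smallest kernel is injective, since a further component
    would separate a nonzero element of the kernel. *)
Lemma dual_embedding M : fin_gen M ->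
  exists n (g : {linear M -> ('I_n -> dual)}), injective g.
Proof.
move=> Mfg; have Ml := fin_gen_finite_length Rlen Lfg Mfg.
have [||_ [[n [g ->]] gmin]] := @submodule_min L M (fun P => exists n
   (g : {linear M -> ('I_n -> dual)}), P = fun x => g x = 0) Ml.
- move=> _ [n [g ->]]; split; first by rewrite linear0.
  by move=> a x y x0 y0; rewrite linearP x0 y0 scaler0 addr0.
- by exists (fun x => (\0 : {linear M -> ('I_0 -> dual)}) x = 0), 0%N, \0.
exists n, g; apply: linear_inj => x gx; apply: contrapT => x0.
have [h hx] := dual_separates Mfg x0.
have /choice[k kE] : forall j : 'I_n, exists k : {linear M -> dual}, forall y, k y = g y j.
  move=> j; have [p pE] := @ex_nth L n (dual : lmodType L) j.
  by exists (p \o g) => y; rewrite /= pE.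
have [f fE] := ex_tuple (fun i : 'I_n.+1 =>
  if unlift ord0 i is Some j then k j else h).
have f0 y : f y = 0 -> g y = 0 /\ h y = 0.
  move=> fy; split.
    apply: funext => j; rewrite -kE; have := fE y (lift ord0 j).
    by rewrite liftK fy => <-.
  by have := fE y ord0; rewrite unlift_none fy => <-.
have /f0[_ //] : f x = 0.
by apply: (gmin (fun y => f y = 0)) gx; [exists n.+1, f|move=> y /f0[]].
Qed.

Section Transposes.

(* W is the dual of the transpose of C = L^n / K; the statement is the
   Auslander-Reiten formula DExt^1(C, X) = Hom(X, DTr C) modulo injectives. *)
Lemma dual_transpose n K (u : {linear K -> ('I_n -> L^o)}) : injective u ->
  exists W, fin_gen W /\ forall X (al : {linear K -> X}), fin_gen X ->
    ~ (exists h : {linear ('I_n -> L^o) -> X}, forall k, h (u k) = al k) ->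
    exists g : {linear X -> W},
    ~ (exists h : {linear ('I_n -> L^o) -> W}, forall k, h (u k) = g (al k)).
Proof.
move=> uinj; have [m [r rE]] := fin_gen_sub Rlen Lfg uinj (fin_gen_free L n).
(* The entries [u (r j) i] form a presentation matrix of C. P says that f, a functional on L^m,
   kills the image of the transposed matrix, so W is the dual of its cokernel Tr C. *)
pose P (f : 'I_m -> dual) := forall i l, \sum_j dual_eval (f j) (u (r j) i * l) = 0.
have [|W [w [winj wP]]] := @ex_sub L ('I_m -> dual) P.
  split=> [i l|a f g fP gP i l]; first by apply: big1 => j _; apply: dual_eval0l.
  transitivity (\sum_j dual_eval (f j) (u (r j) i * (l * a)) +
    \sum_j dual_eval (g j) (u (r j) i * l)); last by rewrite fP gP addr0.
  rewrite -big_split /=.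
  apply: eq_bigr => j _; rewrite -[LHS]/(dual_eval (a *: f j + g j) _) dual_addE.
  by rewrite dual_evalZ mulrA.
exists W; split.
  by apply: (fin_gen_sub Rlen Lfg winj); apply: fin_gen_pow; apply: fin_gen_dual.
move=> X al Xfg alext; have Xl := finite_length_restrict Rlen Lfg Xfg.
(* A vector y of X^n is a map L^n -> X and T y lists its values at the generators of K. So al
   extends exactly when x, its list of values, lies in the image of T. *)
have [T TE] : exists T : {linear ('I_n -> res X) -> ('I_m -> res X)},
    forall y j, T y j = \sum_i (u (r j) i : L) *: (y i : X).
  have [|T TE] := @ex_linear R ('I_n -> res X) ('I_m -> res X)
      (fun y j => \sum_i (u (r j) i : L) *: (y i : X) : X).
    move=> a x y; apply: funext => j.
    rewrite -[RHS]/(phi a *: (\sum_i (u (r j) i : L) *: (x i : X)) +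
      \sum_i (u (r j) i : L) *: (y i : X)) scaler_sumr -big_split /=.
    apply: eq_bigr => i _.
    by rewrite -[LHS]/((u (r j) i : L) *: (phi a *: (x i : X) + (y i : X)))
      scalerDr !scalerA phiC.
  by exists T => y j; rewrite TE.
have [Q [q [qsurj Tq]]] := ex_coker T.
pose x : 'I_m -> res X := fun j => al (r j).
have qx : q x <> 0.
  move=> /Tq[y yE]; apply: alext; have [h hE] := ex_free_map (y : 'I_n -> X).
  exists h => k; have [c ->] := rE k; rewrite !linear_sum; apply: eq_bigr => j _.
  by rewrite !linearZ_LR hE -[al (r j)]/(x j) -yE TE.
have Ql : finite_length Q by apply: finite_length_surj qsurj _; apply: finite_length_pow.
have [t tqx] := cogenerator_separates Rlen E1 Emax Ql qx.
have [d [dsum dE]] := @ex_delta R m (res X).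
have [d' [d'sum d'E]] := @ex_delta R n (res X).
(* The components of g are coinduced from t on the m coordinates; g lands in W because t kills the
   image of T. *)
have [g0 g0E] := choice (fun j => coinduce (t \o q \o d j)).
have [g1 g1E] := ex_tuple g0.
have [|g gE] := @factor_inj _ _ _ _ w g1 winj.
  move=> y; apply/wP => i l.
  have -> : \sum_j dual_eval (g1 y j) (u (r j) i * l) =
      t (q (T (d' i ((l : L) *: (y : X))))).
    rewrite [T _]dsum !linear_sum; apply: eq_bigr => j _.
    rewrite g1E g0E /= -scalerA; congr (t (q (d j _))).
    rewrite TE (bigD1 i) //= d'E eqxx big1 ?addr0 // => k.
    by rewrite eq_sym => /negbTE ik; rewrite d'E ik [LHS]scaler0.
  by rewrite (exact_comp0 _ Tq) linear0.
exists g => -[h hE]; apply: tqx.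
rewrite [x]dsum !linear_sum.
(* An extension h turns t (q x) into a sum over i of the equations defining W, taken at l = 1. *)
transitivity (\sum_j \sum_i dual_eval (w (h (unit_vec L i)) j) (u (r j) i * 1)).
  apply: eq_bigr => j _.
  have -> : t (q (d j (x j))) = dual_eval (g1 (al (r j)) j) 1.
    by rewrite g1E g0E scale1r.
  rewrite -gE -hE [u (r j)]unit_vecE !linear_sum fct_sumE dual_eval_sum.
  apply: eq_bigr => i _; rewrite !linearZ_LR -unit_vecE mulr1.
  by rewrite -[LHS]/(dual_eval ((u (r j) i : L) *: w (h (unit_vec L i)) j) 1) dual_evalZ mul1r.
rewrite exchange_big big1 // => i _ /=.
have /wP wi : exists y, w y = w (h (unit_vec L i)) by exists (h (unit_vec L i)).
exact: wi.
Qed.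

(* M is the transpose of the dual of A. *)
Lemma transpose_dual n A B (u : {linear A -> ('I_n -> dual)})
    (v : {linear ('I_n -> dual) -> B}) : short_exact u v ->
  exists M, fin_gen M /\ forall X (be : {linear X -> B}), fin_gen X ->
    ~ (exists h : {linear X -> ('I_n -> dual)}, forall x, v (h x) = be x) ->
    exists g : {linear M -> X},
    ~ (exists h : {linear M -> ('I_n -> dual)}, forall x, v (h x) = be (g x)).
Proof.
move=> [uinj uv vsurj].
pose V : lmodType R := 'I_n -> res L^o.
have Vl : finite_length V := finite_length_pow n (finite_length_algebra Rlen Lfg).
pose pair (f : 'I_n -> dual) (s : V) := \sum_i dual_eval (f i) (s i).
have pairD a f g s : pair (a *: f + g) s = pair f (fun i => s i * a : L) + pair g s.
  rewrite /pair -big_split /=; apply: eq_bigr => i _.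
  by rewrite -[LHS]/(dual_eval (a *: f i + g i) _) dual_addE dual_evalZ.
have pair0 s : pair 0 s = 0 by apply: big1 => i _; apply: dual_eval0l.
have pair_delta f i x : pair f (fun k => if k == i then x else 0) = dual_eval (f i) x.
  rewrite /pair (bigD1 i) //= eqxx big1 ?addr0 // => k /negbTE ki.
  by rewrite ki dual_eval0.
have pair_lin f : linear (pair f).
  move=> r s s'; rewrite /pair scaler_sumr -big_split /=.
  apply: eq_bigr => i _; exact: (dual_evalP (f i)).
have pair_phi r f s : pair (phi r *: f) s = r *: pair f s.
  have := pairD (phi r) f 0 s; rewrite !addr0 pair0 addr0 => ->.
  rewrite scaler_sumr; apply: eq_bigr => i _.
  by rewrite -phiC -[_ * _]addr0 (dual_evalP (f i)) dual_eval0 addr0.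
(* S is the annihilator of A in L^n, so that L^n / S is the dual of A. *)
have [|S [s [sinj sE]]] := @ex_sub R V (fun t => forall a, pair (u a) t = 0).
  split=> [a|r t t' t0 t0' a]; last by rewrite pair_lin t0 t0' scaler0 addr0.
  by have [f fE] := ex_linear (pair_lin (u a)); rewrite -fE linear0.
have [m [t tE]] := finite_length_fin_gen (finite_length_inj sinj Vl).
have tu j a : pair (u a) (s (t j)) = 0 by move: a; apply/sE; exists (t j).
(* By double annihilation, a functional that vanishes on S comes from A, that is, from the kernel of
   v. *)
have annih f : (forall j, pair f (s (t j)) = 0) -> v f = 0.
  move=> f0.
  have [ev evE] : exists ev : {linear res A -> (V -> E)}, forall a t, ev a t = pair (u a) t.
    have [|ev evE] := @ex_linear R (res A) (V -> E) (fun a : A => pair (u a)).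
      move=> r a b; apply: funext => x.
      rewrite -[LHS]/(pair (u (phi r *: (a : A) + (b : A))) x) linearP.
      have := pairD 1 (phi r *: u a) (u b) x; rewrite scale1r => ->.
      have -> : (fun i => x i * 1 : L) = x by apply: funext => i; rewrite mulr1.
      by rewrite pair_phi.
    by exists ev => a x; rewrite evE.
  have [p pE] := ex_linear (pair_lin f).
  have [|||a aE] := double_annihilator (ev := ev) (f := p) E1 Vl.
  - apply: linear_inj => a ea; apply: (linear_inj0 uinj); apply: funext => i.
    apply: dual_ext => x; rewrite dual_eval0l.
    have := congr1 (fun h => h (fun k => if k == i then x else 0)) ea.
    by rewrite evE pair_delta.
  - by move=> a r x y; rewrite !evE pair_lin.
  - move=> x x0; have [y <-] : exists y, s y = x.
      by apply/(sE x) => a; rewrite -evE x0.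
    have [c ->] := tE y; rewrite !linear_sum big1 // => j _.
    by rewrite (linearZ_LR s) (linearZ_LR p) pE f0 scaler0.
  apply/uv; exists a; apply: funext => i; apply: dual_ext => x.
  have := aE (fun k => if k == i then x else 0).
  by rewrite evE pE !pair_delta.
(* The [t j] generate the relations S of the dual of A; z is their transposed matrix and its
   cokernel M is the transpose. *)
have [z zE] := ex_free_map (fun i : 'I_n => (fun j : 'I_m => s (t j) i) : 'I_m -> L^o).
have [M [c [csurj zc]]] := ex_coker z.
exists M; split; first by apply: fin_gen_quo csurj _; apply: fin_gen_free.
move=> X be Xfg nolift; have Xl := finite_length_restrict Rlen Lfg Xfg.
have [v' v'E] := ex_restrict phi v.
have v'surj : surj v' by move=> b; have [f fE] := vsurj b; exists f; rewrite v'E.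
have /choice[ka kaE] : forall j, exists k : {linear res B -> E},
    forall f, k (v f) = pair f (s (t j)).
  move=> j.
  have [|p pE] := @ex_linear R (res ('I_n -> dual)) E (fun f => pair f (s (t j))).
    move=> r f g; rewrite -[LHS]/(pair (phi r *: (f : 'I_n -> dual) + (g : 'I_n -> dual)) _).
    have := pairD 1 (phi r *: f) g (s (t j)); rewrite scale1r => ->.
    have -> : (fun i => s (t j) i * 1 : L) = s (t j) by apply: funext => i; rewrite mulr1.
    by rewrite pair_phi.
  have [|k kE] := @factor_surj R _ _ _ v' p v'surj.
    move=> f; rewrite v'E => /uv[a fE]; rewrite pE -fE; exact: tu.
  by exists k => f; rewrite -v'E kE pE.
have [T TE] : exists T : {linear ('I_m -> res X) -> ('I_n -> res X)},
    forall y i, T y i = \sum_j (s (t j) i : L) *: (y j : X).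
  have [|T TE] := @ex_linear R ('I_m -> res X) ('I_n -> res X)
      (fun y i => \sum_j (s (t j) i : L) *: (y j : X) : X).
    move=> a x y; apply: funext => i.
    rewrite -[RHS]/(phi a *: (\sum_j (s (t j) i : L) *: (x j : X)) +
      \sum_j (s (t j) i : L) *: (y j : X)) scaler_sumr -big_split /=.
    apply: eq_bigr => j _.
    by rewrite -[LHS]/((s (t j) i : L) *: (phi a *: (x j : X) + (y j : X)))
      scalerDr !scalerA phiC.
  by exists T => y i; rewrite TE.
have [be' be'E] := ex_restrict phi be.
have [Th ThE] := ex_sum_tuple (fun j => ka j \o be').
(* Ker T is Hom(M, X). If Th vanished there, it would factor through T, extend to X^n by injectivity
   of E, and coinduce a lift of be. So some map M -> X, encoded by x, has Th x <> 0. *)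
have [ThT|/existsNP[x /not_implyP[Tx Thx]]] :=
  pselect (forall x, T x = 0 -> Th x = 0).
  exfalso; apply: nolift.
  have [I [p [i [psurj iinj ipE]]]] := ex_image T.
  have [|th0 th0E] := @factor_surj R _ _ _ p Th psurj.
    by move=> x px; apply: ThT; rewrite -ipE px linear0.
  have [th thE] := cogenerator_injective Rlen E1 Emax th0 iinj (finite_length_pow n Xl).
  have thT x : th (T x) = Th x by rewrite -ipE thE th0E.
  have [d [dsum dE]] := @ex_delta R n (res X).
  have [d' [d'sum d'E]] := @ex_delta R m (res X).
  have [g0 g0E] := choice (fun k => coinduce (th \o d k)).
  have [g gE] := ex_tuple g0; exists g => x.
  have [f fE] := vsurj (be x); rewrite -fE; apply/eqP.
  rewrite -subr_eq0 -linearB; apply/eqP/annih => j.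
  have -> : pair (g x - f) (s (t j)) = pair (g x) (s (t j)) - pair f (s (t j)).
    have := pairD (-1) f (g x) (s (t j)); rewrite scaleN1r addrC => ->.
    rewrite addrC; congr (_ + _); have := pair_phi (-1) f (s (t j)).
    by rewrite rmorphN1 !scaleN1r => <-; rewrite -scaleN1r; have := pairD (-1) f 0 (s (t j));
      rewrite pair0 !addr0 => ->.
  apply/eqP; rewrite subr_eq0 -(kaE j f) fE; apply/eqP.
  have -> : pair (g x) (s (t j)) = th (T (d' j x)).
    rewrite [T _]dsum linear_sum; apply: eq_bigr => k _.
    rewrite gE g0E /=; congr (th (d k _)).
    rewrite TE (bigD1 j) //= d'E eqxx big1 ?addr0 // => l.
    by rewrite eq_sym => /negbTE jl; rewrite d'E jl [LHS]scaler0.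
  rewrite thT ThE (bigD1 j) //= d'E eqxx big1 ?addr0 ?be'E // => l.
  by rewrite eq_sym => /negbTE jl; rewrite d'E jl !linear0.
have [g1 g1E] := ex_free_map (x : 'I_m -> X).
have [|g gE] := @factor_surj _ _ _ _ c g1 csurj.
  move=> y /zc[w <-]; rewrite zE linear_sum big1 // => i _.
  rewrite linearZ_LR g1E.
  have -> : \sum_j (s (t j) i : L) *: (x j : X) = T x i by rewrite TE.
  by rewrite Tx [LHS]scaler0.
exists g => -[h hE]; apply: Thx; rewrite ThE.
pose f j := h (c (unit_vec L j)).
(* For a lift h, Th x is the sum over i of the i-th coordinates of h at the relations
   [z (unit_vec L i)] of M, evaluated at 1. *)
transitivity (\sum_j \sum_i dual_eval (f j i) (s (t j) i)).
  apply: eq_bigr => j _; rewrite /= be'E.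
  have <- : v (f j) = be (x j) by rewrite hE gE g1E sum_unit_vec.
  exact: kaE.
rewrite exchange_big big1 // => i _ /=.
transitivity (dual_eval (h (c (z (unit_vec L i))) i) 1).
  rewrite zE sum_unit_vec (unit_vecE (fun j => s (t j) i)) !linear_sum fct_sumE dual_eval_sum.
  apply: eq_bigr => j _; rewrite !linearZ_LR.
  by rewrite -[RHS]/(dual_eval ((s (t j) i : L) *: f j i) 1) dual_evalZ mul1r.
rewrite (_ : c _ = 0); last by apply/zc; exists (unit_vec L i).
by rewrite linear0; apply: dual_eval0l.
Qed.

End Transposes.

End Dual.

(** * Finiteness of Hom *)

Section HomModules.

Variables (R : comPzRingType) (L : pzRingType) (phi : {rmorphism R -> L}).
Hypothesis phiC : forall r x, phi r * x = x * phi r.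
Hypothesis Rlen : finite_length (R^o : lmodType R).
Hypothesis Lfg : exists (n : nat) (g : 'I_n -> L),
  forall x, exists c : 'I_n -> R, x = \sum_(i < n) phi (c i) * g i.
Local Notation res := (restrict phi).
Implicit Types A B C F I J K M N Q U V W X Y Z : lmodType L.

Lemma ex_central_scale X (r : R) :
  exists s : {linear X -> X}, forall x, s x = phi r *: x.
Proof.
by apply: ex_linear => a x y; rewrite scalerDr !scalerA phiC.
Qed.

(** Hom(M, X) embeds in a power of X by values at the generators of M, whence its finite length over
    R. *)
Lemma hom_module M X : fin_gen M -> fin_gen X ->
  exists (H : lmodType R) (j : {linear H -> (M -> res X)}),
  [/\ finite_length H, injective j
    & forall f : M -> X, @GRing.linear_for L M X *:%R f <-> exists h, forall x, j h x = f x].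
Proof.
move=> [n [m mE]] Xfg; have Xl := finite_length_restrict Rlen Lfg Xfg.
pose P (f : M -> res X) := @GRing.linear_for L M X *:%R f.
have [|H [j [jinj jE]]] := @ex_sub R (M -> res X) P.
  split=> [a x y|r f g fl gl a x y]; first by rewrite [RHS]addr0 [RHS]scaler0.
  rewrite -[LHS]/(phi r *: (f (a *: x + y) : X) + (g (a *: x + y) : X)).
  rewrite -[RHS]/(a *: (phi r *: (f x : X) + (g x : X)) +
                  (phi r *: (f y : X) + (g y : X))) fl gl !scalerDr !scalerA phiC.
  by rewrite addrACA.
exists H, j; split=> //; last first.
  move=> f; split=> [/jE[h hE]|[h hE]]; first by exists h => x; rewrite hE.
  by apply/jE; exists h; apply: funext.
have [k kE] : exists k : {linear H -> ('I_n -> res X)}, forall h i, k h i = j h (m i).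
  have [|k kE] := @ex_linear R H ('I_n -> res X) (fun h i => j h (m i)).
    by move=> a x y; apply: funext => i; rewrite linearP.
  by exists k => h i; rewrite kE.
apply: (@finite_length_inj _ _ _ k); last exact: finite_length_pow.
apply: linear_inj => h kh; apply: jinj; rewrite linear0; apply: funext => x.
have jh : P (j h) by apply/jE; exists h.
have [f fE] := @ex_linear L M X (j h) jh.
have [c ->] := mE x; rewrite -[LHS]fE linear_sum big1 // => i _.
by rewrite linearZ_LR fE -kE kh [LHS]scaler0.
Qed.

(** The components of e generate Hom(M, X) over R, and scalars of R act on X by L-linear maps
    because their images are central. *)
Lemma hom_approximation M X : fin_gen M -> fin_gen X ->
  exists n (e : {linear M -> ('I_n -> X)}), forall f : {linear M -> X},
    exists h : {linear ('I_n -> X) -> X}, forall x, h (e x) = f x.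
Proof.
move=> Mfg Xfg; have [H [j [Hl jinj jE]]] := hom_module Mfg Xfg.
have [n [g gE]] := finite_length_fin_gen Hl.
have /choice[e eE] : forall i, exists e : {linear M -> X}, forall x, e x = j (g i) x.
  by move=> i; apply: ex_linear; apply/jE; exists (g i).
have [e' e'E] := ex_tuple e; exists n, e' => f.
have /jE[h hE] : @GRing.linear_for L M X *:%R f by exact: linearP.
have [c hc] := gE h.
have /choice[s sE] : forall i, exists s : {linear X -> X}, forall x, s x = phi (c i) *: x.
  by move=> i; apply: ex_central_scale.
have [k kE] := ex_sum_tuple s; exists k => x.
rewrite kE -hE hc linear_sum fct_sumE; apply: eq_bigr => i _.
by rewrite sE e'E eE linearZ_LR.
Qed.

(* al represents a class of Ext^1 with minimal End(W)-orbit, F being projective;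
   the classes are the maps K -> W modulo those which extend to F. *)
Lemma nonextendable_min K F W (u : {linear K -> F}) : fin_gen K -> fin_gen W ->
  (exists al : {linear K -> W}, ~ exists h : {linear F -> W}, forall x, h (u x) = al x) ->
  exists al : {linear K -> W},
    ~ (exists h : {linear F -> W}, forall x, h (u x) = al x) /\
    forall h : {linear W -> W},
      ~ (exists k : {linear F -> W}, forall x, k (u x) = h (al x)) ->
      exists (k : {linear W -> W}) (l : {linear F -> W}),
        forall x, al x = k (h (al x)) + l (u x).
Proof.
move=> Kfg Wfg [al0 al0P]; have [H [j [Hl jinj jE]]] := hom_module Kfg Wfg.
pose orbit (al : {linear K -> W}) (z : H) := exists (h : {linear W -> W})
  (l : {linear F -> W}), forall x, j z x = h (al x) + l (u x).
pose nonext (al : {linear K -> W}) :=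
  ~ exists h : {linear F -> W}, forall x, h (u x) = al x.
(* If h al does not extend either, its orbit lies in the minimal one, hence equals it and contains
   al. *)
have [||_ [[al [alP ->]] almin]] := @submodule_min R H
    (fun P => exists al, nonext al /\ P = orbit al) Hl.
- move=> _ [al [_ ->]]; split.
    by exists \0, \0 => x; rewrite linear0 /= addr0.
  move=> r z z' [h [l hl]] [h' [l' hl']].
  have [s sE] := ex_central_scale W r.
  have [h1 h1E] := ex_add (s \o h) h'; have [l1 l1E] := ex_add (s \o l) l'.
  exists h1, l1 => x; rewrite linearP -[LHS]/(phi r *: (j z x : W) + j z' x) hl hl'.
  by rewrite h1E l1E /= !sE scalerDr addrACA.
- by exists (orbit al0), al0.
exists al; split=> // h hP.
have /jE[z zE] : @GRing.linear_for L K W *:%R al by exact: linearP.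
have [k [l kl]] : orbit (h \o al) z.
  apply: almin; first by exists (h \o al).
    by move=> y [k [l kl]]; exists (k \o h), l => x; rewrite kl.
  by exists idfun, \0 => x; rewrite zE /= addr0.
by exists k, l => x; rewrite -[LHS]zE kl.
Qed.

(** The dual of [nonextendable_min]: with F injective and A = Ker v, maps N -> W modulo those
    lifting to F are classes of Ext^1(N, A), acted on by End(N). *)
Lemma nonliftable_min N F W (v : {linear F -> W}) : fin_gen N -> fin_gen W ->
  (exists be : {linear N -> W}, ~ exists h : {linear N -> F}, forall x, v (h x) = be x) ->
  exists be : {linear N -> W},
    ~ (exists h : {linear N -> F}, forall x, v (h x) = be x) /\
    forall h : {linear N -> N},
      ~ (exists k : {linear N -> F}, forall x, v (k x) = be (h x)) ->
      exists (k : {linear N -> N}) (l : {linear N -> F}),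
        forall x, be x = be (h (k x)) + v (l x).
Proof.
move=> Nfg Wfg [be0 be0P]; have [H [j [Hl jinj jE]]] := hom_module Nfg Wfg.
pose orbit (be : {linear N -> W}) (z : H) := exists (h : {linear N -> N})
  (l : {linear N -> F}), forall x, j z x = be (h x) + v (l x).
pose nonlift (be : {linear N -> W}) :=
  ~ exists h : {linear N -> F}, forall x, v (h x) = be x.
have [||_ [[be [beP ->]] bemin]] := @submodule_min R H
    (fun P => exists be, nonlift be /\ P = orbit be) Hl.
- move=> _ [be [_ ->]]; split.
    by exists \0, \0 => x; rewrite linear0 /= !linear0 addr0.
  move=> r z z' [h [l hl]] [h' [l' hl']].
  have [s sE] := ex_central_scale N r; have [t tE] := ex_central_scale F r.
  have [h1 h1E] := ex_add (s \o h) h'; have [l1 l1E] := ex_add (t \o l) l'.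
  exists h1, l1 => x; rewrite linearP -[LHS]/(phi r *: (j z x : W) + j z' x) hl hl'.
  by rewrite h1E l1E /= !sE tE !linearP scalerDr addrACA.
- by exists (orbit be0), be0.
exists be; split=> // h hP.
have /jE[z zE] : @GRing.linear_for L N W *:%R be by exact: linearP.
have [k [l kl]] : orbit (be \o h) z.
  apply: bemin; first by exists (be \o h).
    by move=> y [k [l kl]]; exists (h \o k), l => x; rewrite kl.
  by exists idfun, \0 => x; rewrite zE /= linear0 addr0.
by exists k, l => x; rewrite -[LHS]zE kl.
Qed.

End HomModules.

(** * Special precovers and covariant finiteness *)

Section ExtClosure.

Variable L : pzRingType.
Implicit Types A B C E G I J K M N P Q S T U V W X Y Z : lmodType L.

Lemma ext_vanish0 Z X : (forall x : X, x = 0) -> ext_vanish Z X.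
Proof. by move=> X0 B u v _; exists \0 => x; rewrite (X0 x). Qed.

(** In an extension G of Z by B, p extends to G -> C; the kernel of this map is an extension of Z by
    A, and its splitting splits G. *)
Lemma ext_vanish_ext A B C Z (i : {linear A -> B}) (p : {linear B -> C}) :
  short_exact i p -> ext_vanish Z A -> ext_vanish Z C -> ext_vanish Z B.
Proof.
move=> ips ZA ZC G u v uvs; have [iinj ip psurj] := ips; have [uinj uv vsurj] := uvs.
apply: (split_epi_mono uvs).
have [h hE] := ext_vanish_extend p uvs ZC.
have [K [k [kinj kh]]] := ex_ker h.
have [|j jE] := @factor_inj _ _ _ _ k (u \o i) kinj.
  by move=> a; apply/kh; rewrite /= hE (exact_comp0 _ ip).
have js : short_exact j (v \o k).
  split.
  - by move=> x y e; apply/iinj/uinj; rewrite -[LHS]jE -[RHS]jE e.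
  - move=> y; split=> [/uv[b bE]|[x <-]]; last first.
      by rewrite /= jE /= (exact_comp0 _ uv).
    have /ip[a aE] : p b = 0 by rewrite -hE bE (exact_comp0 _ kh).
    by exists a; apply: kinj; rewrite jE /= aE bE.
  - move=> z; have [g gE] := vsurj z; have [b bE] := psurj (h g).
    have /kh[y yE] : h (g - u b) = 0 by rewrite linearB hE bE subrr.
    by exists y; rewrite /= yE linearB (exact_comp0 _ uv) subr0.
have [s sE] := split_mono_epi js (ZA _ _ _ js).
by exists (k \o s) => z; apply: sE.
Qed.

Lemma ext_vanish_pow n Z X : ext_vanish Z X -> ext_vanish Z ('I_n -> X).
Proof.
move=> ZX; elim: n => [|n IH]; first by apply: ext_vanish0; apply: pow0.
by have [f [p fps]] := ses_pow n X; apply: ext_vanish_ext fps ZX IH.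
Qed.

Lemma simple_surj_inj S M (h : {linear S -> M}) : simple S -> surj h ->
  (exists x : M, x <> 0) -> injective h.
Proof.
move=> [_ Ss] hsurj [x x0]; have [K [k [kinj kh]]] := ex_ker h.
have [ksurj|K0] := Ss K k kinj.
  by case: x0; have [s <-] := hsurj x; apply/kh.
by apply: linear_inj => s /kh[y <-]; rewrite (K0 y) linear0.
Qed.

End ExtClosure.

Section SpecialPrecovers.

Variable L : pzRingType.
Implicit Types A B C E G I J K M N P Q S T U V W X Y Z : lmodType L.

Hypothesis Llen : forall M, fin_gen M -> finite_length M.
Hypothesis hP : contravariantly_finite (@Pinf L).

Lemma fin_gen_submod M N (i : {linear N -> M}) : injective i -> fin_gen M -> fin_gen N.
Proof. by move=> iinj /Llen/(finite_length_inj iinj)/finite_length_fin_gen. Qed.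

(** The kernel condition makes f a right P^oo-approximation when A is in P^oo, and, unlike mere
    approximations, it is stable under extensions of M. *)
Definition special_precover n M : Prop :=
  exists Y A (i : {linear Y -> A}) (f : {linear A -> M}),
    [/\ short_exact i f, fin_gen A, pdim_le n A
      & forall Z, Pinf Z -> ext_vanish Z Y].

Lemma special_precoverW n m M : (n <= m)%N -> special_precover n M ->
  special_precover m M.
Proof.
move=> nm [Y [A [i [f [ifs Afg An Yext]]]]]; exists Y, A, i, f; split=> //.
exact: pdim_leW nm An.
Qed.

Lemma special_precover_iso n M N : isomorphic M N -> special_precover n M ->
  special_precover n N.
Proof.
move=> [g [ginj gsurj]] [Y [A [i [f [ifs Afg An Yext]]]]].
by exists Y, A, i, (g \o f); split=> //; apply: ses_isor.
Qed.

(** An approximation of least length is minimal: by Fitting's lemma an endomorphism over M cuts out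
    a summand that is again an approximation. Surjectivity holds because free modules are in
    P^oo. *)
Lemma minimal_approximation M : fin_gen M ->
  exists A (f : {linear A -> M}),
  [/\ Pinf A, surj f,
     forall B (g : {linear B -> M}), Pinf B -> exists h : {linear B -> A}, forall x, f (h x) = g x
   & forall h : {linear A -> A}, (forall x, f (h x) = f x) -> injective h /\ surj h].
Proof.
move=> Mfg.
have [|n [[A [f [AP fapp An]]] nmin]] := @least_nat (fun n => exists A
  (f : {linear A -> M}), [/\ Pinf A, forall B (g : {linear B -> M}), Pinf B ->
     exists h : {linear B -> A}, forall x, f (h x) = g x & length_le n A]).
  have [A [f [AP fapp]]] := hP Mfg; have [n An] := Llen (proj1 AP).
  by exists n, A, f.
have Al : finite_length A by exists n.
exists A, f; split=> //.
  have [m [p psurj]] := fin_gen_cover Mfg; have [h hE] := fapp _ p (Pinf_free L m).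
  by move=> x; have [y <-] := psurj x; exists (h y).
move=> h fh; have fiter m x : f (iter m h x) = f x.
  by elim: m => //= m IH; rewrite fh.
have [m [V [j [a [jsplit asurj jaE]]]]] := fitting h Al.
have jsurj : surj j.
  apply: contrapT => jns.
  have [Vn n0] := proper_sub_length (split_mono_inj jsplit) jns An.
  have : (n <= n.-1)%N; last by case: n n0 {An nmin Vn} => // n _; rewrite ltnn.
  apply: nmin; exists V, (f \o j); split=> //; first exact: Pinf_summand jsplit AP.
  move=> B g BP; have [k kE] := fapp B g BP.
  by exists (a \o k) => x; rewrite /= jaE fiter.
have hsurj : surj h.
  move=> y; have [v <-] := jsurj y; have [x <-] := asurj v.
  by rewrite jaE; exists (iter m h x).
by split=> //; apply: (surj_length_inj Al hsurj).
Qed.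

(* Wakamatsu's lemma. *)
Lemma minimal_approximation_kernel M A Y (i : {linear Y -> A}) (f : {linear A -> M}) :
  short_exact i f -> Pinf A ->
  (forall B (g : {linear B -> M}), Pinf B -> exists h : {linear B -> A}, forall x, f (h x) = g x) ->
  (forall h : {linear A -> A}, (forall x, f (h x) = f x) -> injective h /\ surj h) ->
  forall Z, Pinf Z -> ext_vanish Z Y.
Proof.
move=> [iinj if_ fsurj] AP fapp fmin Z ZP B u v uvs.
have [G [u' [v' [q [uvs' qu v'q _ univ]]]]] := ses_pushout i uvs.
have GP : Pinf G := Pinf_ext uvs' AP ZP.
(* The map G -> M which is f on A and zero on B factors through A by s. Minimality makes [s \o u']
   an automorphism; corrected by its inverse, s sends B to Y and retracts u. *)
have [|h [hu hq]] := univ M f \0; first by move=> y; rewrite (exact_comp0 _ if_).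
have [s sE] := fapp G h GP.
have [|sinj ssurj] := fmin (s \o u'); first by move=> x; rewrite /= sE hu.
have [w [ws sw]] := ex_inverse sinj ssurj.
have fw x : f (w x) = f x by rewrite -[in RHS](sw x) /= sE hu.
have [|k kE] := @factor_inj _ _ _ _ i (w \o s \o q) iinj.
  by move=> x; apply/if_; rewrite /= fw sE hq.
by exists k => y; apply: iinj; rewrite kE /= qu; apply: ws.
Qed.

Lemma ex_special_precover M : fin_gen M -> exists n, special_precover n M.
Proof.
move=> Mfg; have [A [f [AP fsurj fapp fmin]]] := minimal_approximation Mfg.
have [Y [i ifs]] := ses_ker fsurj; have /PinfP[Afg [n An]] := AP.
exists n, Y, A, i, f; split=> //.
exact: minimal_approximation_kernel ifs AP fapp fmin.
Qed.

(* Horseshoe for special precovers: the extension class of the middle term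
   lifts since its obstruction lies in Ext^2(A'', Y') = 0. *)
Lemma special_precover_ext n M' M M'' (a : {linear M' -> M}) (b : {linear M -> M''}) :
  short_exact a b -> special_precover n M' -> special_precover n M'' ->
  special_precover n M.
Proof.
move=> abs [Y' [X' [i' [f' [ifs' X'fg X'n Y'ext]]]]].
move=> [Y'' [X'' [i'' [f'' [ifs'' X''fg X''n Y''ext]]]]].
have [E [i0 [p0 [j0 [q0 [ips jqs comm]]]]]] := ses_double_pullback abs ifs''.
have [m [c csurj]] := fin_gen_cover X''fg; have [O [o ocs]] := ses_ker csurj.
have X''P : Pinf X'' by apply/PinfP; split=> //; exists n.
have OP : Pinf O.
  have [oinj _ _] := ocs.
  by apply: Pinf_sub ocs (fin_gen_submod oinj (fin_gen_free L m)) (Pinf_free L m) X''P.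
have [i0inj ip0 p0surj] := ips; have [oinj oc _] := ocs.
have [e eE] := free_projective c p0surj.
(* w represents the class of E in Ext^1(X'', M'); its lift w' to X' yields the middle term Z. *)
have [|w wE] := @factor_inj _ _ _ _ i0 (e \o o) i0inj.
  by move=> x; apply/ip0; rewrite /= eE (exact_comp0 _ oc).
have [w' w'E] := ext_vanish_lift w ifs' (Y'ext O OP).
have [Z [u [v [q [uvs qo vq _ univ]]]]] := ses_pushout w' ocs.
have [|h [hu hq]] := univ E (i0 \o f') e; first by move=> x; rewrite /= w'E wE.
have [uinj uv vsurj] := uvs; have [i'inj if' f'surj] := ifs'.
have p0h z : p0 (h z) = v z.
  have [y yE] := csurj (v z).
  have /uv[x xE] : v (z - q y) = 0 by rewrite linearB vq yE subrr.
  rewrite -(subrK (q y) z) -xE !linearD hu hq /= (exact_comp0 _ ip0) eE.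
  by rewrite (exact_comp0 _ uv) vq.
have hs : short_exact (u \o i') h.
  split.
  - by move=> x y /uinj/i'inj.
  - move=> z; split=> [hz|[y <-]]; last by rewrite /= hu /= (exact_comp0 _ if') linear0.
    have /uv[x xE] : v z = 0 by rewrite -p0h hz linear0.
    have /if'[y yE] : f' x = 0.
      by apply: (linear_inj0 i0inj); rewrite -[LHS]hu xE hz.
    by exists y; rewrite /= yE.
  - move=> x; have [z zE] := vsurj (p0 x).
    have /ip0[m' m'E] : p0 (x - h z) = 0 by rewrite linearB p0h zE subrr.
    have [y yE] := f'surj m'; exists (u y + z).
    by rewrite linearD hu /= yE m'E subrK.
have [_ _ hsurj] := hs; have [_ _ q0surj] := jqs.
have qhsurj : surj (q0 \o h).
  by move=> y; have [x <-] := q0surj y; have [z <-] := hsurj x; exists z.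
have [N [k ks]] := ses_ker qhsurj.
(* The kernel of Z -> E -> M is an extension of Y'' by Y', hence Ext-orthogonal to P^oo. *)
have [s [t sts]] := ses_comp_ker (fun x => erefl ((q0 \o h) x)) hs ks jqs.
exists N, Z, k, (q0 \o h); split=> //.
- exact: fin_gen_ses uvs X'fg X''fg.
- exact: pdim_le_ext uvs X'n X''n.
- by move=> W WP; apply: ext_vanish_ext sts (Y'ext W WP) (Y''ext W WP).
Qed.

Lemma special_precover_self M n : fin_gen M -> pdim_le n M -> special_precover n M.
Proof.
move=> Mfg Mn.
have [K [k ks]] := @ses_ker _ M M idfun (fun x => ex_intro _ x erefl).
exists K, M, k, idfun; split=> // Z _; apply: ext_vanish0 => x.
by have [kinj kid _] := ks; apply: (linear_inj0 kinj); apply: (exact_comp0 x kid).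
Qed.

(** Stands in for the finiteness of the number of simple modules: a simple quotient of M is either
    the chosen T or a quotient of the shorter kernel K. *)
Lemma simple_quotient_precover n M : length_le n M -> exists d,
  forall S (p : {linear M -> S}), surj p -> simple S -> special_precover d S.
Proof.
elim: n M => [|n IH] M Mn.
  exists 0%N => S p psurj [[s s0] _]; case: s0.
  by have [x <-] := psurj s; rewrite (Mn x) linear0.
have Ml : finite_length M by exists n.+1.
have [M0|/existsNP Mn0] := pselect (forall x : M, x = 0).
  by apply: IH; apply: (length_leW (leq0n n)).
have [T [q [qsurj Ts]]] := simple_quotient Ml Mn0.
have [K [k kqs]] := ses_ker qsurj; have [kinj kq _] := kqs.
have [|d dE] := IH K.
  apply: (Mn K k kinj) => ksurj; case: Ts => -[s s0] _.
  by apply: s0; have [y <-] := qsurj s; apply/kq.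
have [|d' Td'] := @ex_special_precover T.
  exact: fin_gen_quo qsurj (finite_length_fin_gen Ml).
exists (maxn d d') => S p psurj Ss.
have [pk|/existsNP[x pkx]] := pselect (forall x, p (k x) = 0).
  have [|h hE] := @factor_surj _ _ _ _ q p qsurj; first by move=> x /kq[y <-].
  have hsurj : surj h by move=> s; have [x <-] := psurj s; exists (q x).
  apply: special_precoverW (leq_maxr d d') _.
  apply: (special_precover_iso _ Td'); exists h; split=> //.
  by apply: simple_surj_inj => //; case: Ss.
apply: special_precoverW (leq_maxl d d') _; apply: (dE S (p \o k)) => //.
have [I [r [i [rsurj iinj irE]]]] := ex_image (p \o k).
have [_ Ss'] := Ss; have [isurj|I0] := Ss' I i iinj; last first.
  by case: pkx; rewrite -[LHS]irE (I0 (r x)) linear0.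
by move=> s; have [y <-] := isurj s; have [z <-] := rsurj y; exists z; rewrite irE.
Qed.

(** All simple modules are quotients of L, so one d serves them, and extensions do not increase
    it. *)
Lemma uniform_special_precover : exists d, forall M, fin_gen M -> special_precover d M.
Proof.
have Lfg : fin_gen (L^o : lmodType L).
  by exists 1%N, (fun _ => 1) => y; exists (fun _ => y); rewrite big_ord1 [RHS]mulr1.
have [l Ll] := Llen Lfg; have [d dE] := simple_quotient_precover Ll.
exists d => M /[dup] Mfg /Llen[n]; elim: n M Mfg => [|n IH] M Mfg Mn.
  apply: special_precover_self => //; apply: pdim_leW (leq0n d) _.
  exact: projective0.
have Ml : finite_length M by exists n.+1.
have [M0|/existsNP Mn0] := pselect (forall x : M, x = 0).
  by apply: IH => //; apply: (length_leW (leq0n n)).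
have [S [q [qsurj Ss]]] := simple_quotient Ml Mn0.
have [K [k kqs]] := ses_ker qsurj; have [kinj kq _] := kqs.
apply: (special_precover_ext kqs).
  apply: IH; first exact: fin_gen_submod kinj Mfg.
  apply: (Mn K k kinj) => ksurj; case: Ss => -[s s0] _.
  by apply: s0; have [y <-] := qsurj s; apply/kq.
have [[s s0] Ss'] := Ss.
have [f fE] : exists f : {linear L^o -> S}, forall a, f a = (a : L) *: s.
  by apply: ex_linear => a b c; rewrite scalerDl scalerA.
apply: (dE S f) => //.
have [I [r [i [rsurj iinj irE]]]] := ex_image f.
have [isurj|I0] := Ss' I i iinj; last first.
  by case: s0; rewrite -[s]scale1r -[LHS](fE 1) -irE (I0 (r _)) linear0.
by move=> t; have [y <-] := isurj t; have [z <-] := rsurj y; exists z; rewrite irE.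
Qed.

(** The special precover of Z splits, so Z is a summand of a module of dimension at most d. *)
Lemma Pinf_pdim_bound d : (forall M, fin_gen M -> special_precover d M) ->
  forall Z, Pinf Z -> pdim_le d Z.
Proof.
move=> dE Z ZP; have [Y [A [i [f [ifs Afg Ad Yext]]]]] := dE Z (proj1 ZP).
have [s sE] := split_mono_epi ifs (Yext Z ZP _ _ _ ifs).
by apply: (pdim_le_summand (f := s)) Ad; exists f.
Qed.

Variable D : lmodType L.
Hypothesis Dfg : fin_gen D.
Hypothesis Dinj : forall A B (i : {linear A -> B}) (f : {linear A -> D}),
  injective i -> fin_gen B -> exists g : {linear B -> D}, forall a, g (i a) = f a.
Hypothesis Demb : forall M, fin_gen M ->
  exists n (g : {linear M -> ('I_n -> D)}), injective g.

Lemma ext_vanish_injective Z : fin_gen Z -> ext_vanish Z D.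
Proof.
move=> Zfg B u v uvs; have [uinj _ _] := uvs.
have [g gE] := Dinj idfun uinj (fin_gen_ses uvs Dfg Zfg).
by exists g.
Qed.

(* X plays the role of the strong tilting module. *)
Lemma ex_ext_injective_cogenerator : exists X,
  [/\ Pinf X, forall Z, Pinf Z -> ext_vanish Z X
    & forall A, Pinf A -> exists n B (u : {linear A -> ('I_n -> X)})
        (v : {linear ('I_n -> X) -> B}), short_exact u v /\ Pinf B].
Proof.
have [d dE] := uniform_special_precover.
have [Y [X [i [f [ifs Xfg Xd Yext]]]]] := dE D Dfg.
have XP : Pinf X by apply/PinfP; split=> //; exists d.
exists X; split=> // [Z ZP|A AP].
  by apply: ext_vanish_ext ifs (Yext Z ZP) (ext_vanish_injective (proj1 ZP)).
have [n [g ginj]] := Demb (proj1 AP).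
(* Each component A -> D lifts to X because Ext^1(A, Y) = 0; the lifts are jointly injective since
   the components are. *)
have /choice[h hE] : forall k, exists h : {linear A -> X}, forall x, f (h x) = g x k.
  move=> k; have [p pE] := @ex_nth L n D k.
  have [h hE] := ext_vanish_lift (p \o g) ifs (Yext A AP).
  by exists h => x; rewrite hE /= pE.
have [u uE] := ex_tuple h.
have uinj : injective u.
  apply: linear_inj => x ux; apply: (linear_inj0 ginj); apply: funext => k.
  by rewrite -hE -uE ux linear0.
have [B [v uvs]] := ses_coker uinj; exists n, B, u, v; split=> //.
exact: Pinf_quo uvs AP (Pinf_pow n XP).
Qed.

Hypothesis homapp : forall M X, fin_gen M -> fin_gen X ->
  exists n (e : {linear M -> ('I_n -> X)}), forall f : {linear M -> X},
    exists h : {linear ('I_n -> X) -> X}, forall x, h (e x) = f x.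

(** * Coresolutions by powers of X and left approximations *)

Section Coresolutions.

Variable X : lmodType L.
Hypothesis XP : Pinf X.
Hypothesis Xext : forall Z, Pinf Z -> ext_vanish Z X.
Hypothesis Xcog : forall A, Pinf A -> exists n B (u : {linear A -> ('I_n -> X)})
  (v : {linear ('I_n -> X) -> B}), short_exact u v /\ Pinf B.

Fixpoint coresolved k A : Prop :=
  if k is l.+1 then
    exists n B (u : {linear A -> ('I_n -> X)}) (v : {linear ('I_n -> X) -> B}),
      short_exact u v /\ coresolved l B
  else exists n (u : {linear A -> ('I_n -> X)}), split_mono u.

Lemma pow_approximation M : fin_gen M ->
  exists n (e : {linear M -> ('I_n -> X)}), forall m (f : {linear M -> ('I_m -> X)}),
    exists h : {linear ('I_n -> X) -> ('I_m -> X)}, forall x, h (e x) = f x.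
Proof.
move=> Mfg; have [n [e eE]] := homapp Mfg (proj1 XP); exists n, e => m f.
have /choice[h hE] : forall k, exists h : {linear ('I_n -> X) -> X}, forall x, h (e x) = f x k.
  move=> k; have [p pE] := @ex_nth L m X k; have [h hE] := eE (p \o f).
  by exists h => x; rewrite hE /= pE.
have [g gE] := ex_tuple h; exists g => x; apply: funext => k.
by rewrite gE hE.
Qed.

(** If 0 -> A -> X^l -> B' -> 0, a map M -> A induces a map to B' from the cokernel C of e, and this
    factors through an approximation B of C. The free summand makes X^n (+) L^m -> B surjective,
    which puts its kernel K in P^oo. *)
Lemma coresolved_approximation k M : fin_gen M ->
  exists N (f : {linear M -> N}), Pinf N /\ forall A (g : {linear M -> A}),
    coresolved k A -> exists h : {linear N -> A}, forall x, h (f x) = g x.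
Proof.
elim: k M => [|k IH] M Mfg; have [n [e eE]] := pow_approximation Mfg.
  exists ('I_n -> X), e; split; first exact: Pinf_pow.
  move=> A g [m [u [r ru]]]; have [h hE] := eE m (u \o g).
  by exists (r \o h) => x; rewrite /= hE /= ru.
have TP : Pinf ('I_n -> X) := Pinf_pow n XP.
have [C [c [csurj ec]]] := ex_coker e.
have [B [b [BP bapp]]] := IH C (fin_gen_quo csurj (proj1 TP)).
have [m [p psurj]] := fin_gen_cover (proj1 BP).
have [s sE] := ex_copair (b \o c) p.
have ssurj : surj s by move=> y; have [x <-] := psurj y; exists (0, x); rewrite sE linear0 add0r.
have [K [j js]] := ses_ker ssurj; have [jinj sj _] := js.
have TPP : Pinf (('I_n -> X) * ('I_m -> L^o))%type by apply: Pinf_pair TP (Pinf_free L m).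
have KP : Pinf K by apply: Pinf_sub js (fin_gen_submod jinj (proj1 TPP)) TPP BP.
have [i iE] := ex_inl ('I_n -> X) ('I_m -> L^o).
have [|f fE] := @factor_inj _ _ _ _ j (i \o e) jinj.
  by move=> x; apply/sj; rewrite /= iE sE /= (exact_comp0 _ ec) !linear0 addr0.
exists K, f; split=> // A g [l [B' [u [v [[uinj uv vsurj] B'k]]]]].
have [t tE] := eE l (u \o g).
have [|c' c'E] := @factor_surj _ _ _ _ c (v \o t) csurj.
  by move=> x /ec[y <-]; rewrite /= tE /= (exact_comp0 _ uv).
have [b' b'E] := bapp B' c' B'k.
have [p' p'E] := free_projective (b' \o p) vsurj.
have [w wE] := ex_copair t p'.
have vw x : v (w x) = b' (s x).
  by case: x => x y; rewrite wE sE !linearD p'E /= b'E c'E.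
have [|h hE] := @factor_inj _ _ _ _ u (w \o j) uinj.
  by move=> x; apply/uv; rewrite /= vw (exact_comp0 _ sj) linear0.
exists h => x; apply: uinj; rewrite hE /= fE /= iE wE linear0 addr0.
exact: tE.
Qed.

Lemma Pinf_coresolved d : (forall Z, Pinf Z -> pdim_le d Z) ->
  forall A, Pinf A -> coresolved d A.
Proof.
move=> dE.
(* Dimension shifting: j steps remain, and A is already Ext-orthogonal to the members of P^oo of
   dimension at most k. At k = d the embedding of A into a power of X splits. *)
suff: forall j k A, (j + k)%N = d -> Pinf A ->
    (forall Z, Pinf Z -> pdim_le k Z -> ext_vanish Z A) -> coresolved j A.
  move=> H A AP; apply: (H d 0%N) => //; first by rewrite addn0.
  by move=> Z _ Zp; apply: projective_ext.
elim=> [|j IH] k A jk AP Aext; have [n [B [u [v [uvs BP]]]]] := Xcog AP.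
  exists n, u; apply: (Aext B _ _ _ _ v) => //.
  by rewrite -jk add0n in dE; apply: dE.
exists n, B, u, v; split=> //; apply: (IH k.+1) => //; first by rewrite -jk addnS.
move=> Z ZP Zk; have [m [c csurj]] := fin_gen_cover (proj1 ZP).
have [O [o ocs]] := ses_ker csurj; have [oinj _ _] := ocs.
have OP : Pinf O.
  by apply: Pinf_sub ocs (fin_gen_submod oinj (fin_gen_free L m)) (Pinf_free L m) ZP.
apply: (ext_vanishP ocs (@free_projective L m)) => f.
have Ok : pdim_le k O := pdim_le_ker ocs (@free_projective L m) Zk.
have [g gE] := ext_vanish_lift f uvs (Aext O OP Ok).
have [h hE] := ext_vanish_extend g ocs (@ext_vanish_pow L n Z X (Xext ZP)).
by exists (v \o h) => x; rewrite /= hE gE.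
Qed.

End Coresolutions.

Lemma Pinf_covariantly_finite : covariantly_finite (@Pinf L).
Proof.
move=> M Mfg; have [X [XP Xext Xcog]] := ex_ext_injective_cogenerator.
have [d dE] := uniform_special_precover.
have [N [f [NP fapp]]] := coresolved_approximation XP d Mfg.
exists N, f; split=> // B g BP; apply: fapp.
exact: (Pinf_coresolved Xext Xcog (Pinf_pdim_bound dE)).
Qed.

End SpecialPrecovers.

(** * Almost split sequences *)

Section AlmostSplit.

Variable L : pzRingType.
Implicit Types A B C E F G I J K M N P Q S T U V W X Y Z : lmodType L.

Hypothesis Llen : forall M, fin_gen M -> finite_length M.

(* A map C -> Z -> C through a non-lifting f : Z -> C comes from an endomorphism
   of B which is the identity on A; it can be neither bijective nor nilpotent. *)
Lemma left_almost_split A B C (u : {linear A -> B}) (v : {linear B -> C}) :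
  [/\ Pinf A, Pinf B & Pinf C] -> short_exact u v -> ~ split_mono u ->
  indecomposable A -> indecomposable C ->
  (forall X (f : {linear A -> X}), Pinf X -> ~ split_mono f ->
     exists h : {linear B -> X}, forall a, h (u a) = f a) ->
  almost_split (@Pinf L) u v.
Proof.
move=> [AP BP CP] uvs nsplit Aind Cind left; split=> //; split=> //.
  by move=> /(splits_mono uvs).
move=> Z f ZP fnsplit; apply: contrapT => nlift.
have [E [u' [v' [q [uvs' qu vq uE _]]]]] := ses_pullback f uvs.
have [s su] : exists s : {linear B -> E}, forall a, s (u a) = u' a.
  by apply: left; [apply: Pinf_ext uvs' AP ZP|move=> /uE].
have [uinj uv vsurj] := uvs; have [u'inj u'v' v'surj] := uvs'.
have [|s' s'E] := @factor_surj _ _ _ _ v (v' \o s) vsurj.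
  by move=> x /uv[a <-]; rewrite /= su (exact_comp0 _ u'v').
have [[tinj tsurj]|[n tn]] := indecomposable_endo (f \o s') (Llen (proj1 CP)) Cind.
  have [w [wt tw]] := ex_inverse tinj tsurj.
  by apply: fnsplit; exists (s' \o w).
have viter m x : v (iter m (q \o s) x) = iter m (f \o s') (v x).
  by elim: m => //= m IH; rewrite vq -IH s'E.
have uiter m a : iter m (q \o s) (u a) = u a.
  by elim: m => //= m ->; rewrite su qu.
(* This power of [q \o s] is the identity on A and induces zero on C, so it retracts B onto A. *)
have [b bE] := ex_iter (q \o s) n.
have [|r rE] := @factor_inj _ _ _ _ u b uinj.
  by move=> x; apply/uv; rewrite bE viter tn.
by apply: nsplit; exists r => a; apply: uinj; rewrite rE bE uiter.
Qed.

(** Dually, a map A -> X -> A through a non-extending f comes from an endomorphism of B over C. If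
    it is bijective, f splits; if nilpotent, a power of the endomorphism kills A and gives a section
    of v. *)
Lemma right_almost_split A B C (u : {linear A -> B}) (v : {linear B -> C}) :
  [/\ Pinf A, Pinf B & Pinf C] -> short_exact u v -> ~ split_mono u ->
  indecomposable A -> indecomposable C ->
  (forall X (f : {linear X -> C}), Pinf X -> ~ split_epi f ->
     exists h : {linear X -> B}, forall x, v (h x) = f x) ->
  almost_split (@Pinf L) u v.
Proof.
move=> [AP BP CP] uvs nsplit Aind Cind right; split=> //; split=> //.
  by move=> /(splits_mono uvs).
move=> X f XP fnsplit; apply: contrapT => next.
have [G [u' [v' [q [uvs' qu vq uE _]]]]] := ses_pushout f uvs.
have [s vs] : exists s : {linear G -> B}, forall x, v (s x) = v' x.
  apply: right; first exact: Pinf_ext uvs' XP CP.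
  by move=> /(split_epi_mono uvs')/uE.
have [uinj uv vsurj] := uvs; have [u'inj u'v' v'surj] := uvs'.
have [|r' r'E] := @factor_inj _ _ _ _ u (s \o u') uinj.
  by move=> x; apply/uv; rewrite /= vs (exact_comp0 _ u'v').
have [[tinj tsurj]|[n tn]] := indecomposable_endo (r' \o f) (Llen (proj1 AP)) Aind.
  have [w [wt tw]] := ex_inverse tinj tsurj.
  by apply: fnsplit; exists (w \o r').
have viter m x : v (iter m (s \o q) x) = v x.
  by elim: m => //= m IH; rewrite vs vq.
have uiter m a : iter m (s \o q) (u a) = u (iter m (r' \o f) a).
  by elim: m => //= m ->; rewrite qu r'E.
have [b bE] := ex_iter (s \o q) n.
have [|w wE] := @factor_surj _ _ _ _ v b vsurj.
  by move=> x /uv[a <-]; rewrite bE uiter tn linear0.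
apply: nsplit; apply: (split_epi_mono uvs); exists w => c.
by have [x <-] := vsurj c; rewrite wE bE viter.
Qed.

(** al is the class of the extension in Hom(K, X) modulo the maps that extend to F. *)
Lemma syzygy_class K F C X B (k : {linear K -> F}) (c : {linear F -> C})
    (i : {linear X -> B}) (p : {linear B -> C}) :
  short_exact k c -> projective F -> short_exact i p ->
  exists al : {linear K -> X},
    (exists h : {linear F -> X}, forall x, h (k x) = al x) -> split_mono i.
Proof.
move=> [kinj kc csurj] Fp ips; have [iinj ip psurj] := ips.
have [g gE] := Fp _ _ p c psurj.
have [|al alE] := @factor_inj _ _ _ _ i (g \o k) iinj.
  by move=> x; apply/ip; rewrite /= gE (exact_comp0 _ kc).
exists al => -[h hE]; apply: (split_epi_mono ips).
have [d dE] := ex_sub_map g (i \o h).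
have [|s sE] := @factor_surj _ _ _ _ c d csurj.
  by move=> x /kc[y <-]; rewrite dE /= hE alE subrr.
exists s => y; have [x <-] := csurj y.
by rewrite sE dE linearB gE /= (exact_comp0 _ ip) subr0.
Qed.

(** The extension g of a to B is a parameter rather than a consequence of injectivity, since D is
    injective only with respect to finitely generated modules. *)
Lemma cosyzygy_class A F Q X B (a : {linear A -> F}) (q : {linear F -> Q})
    (i : {linear A -> B}) (p : {linear B -> X}) (g : {linear B -> F}) :
  short_exact a q -> short_exact i p -> (forall x, g (i x) = a x) ->
  exists be : {linear X -> Q},
    (exists h : {linear X -> F}, forall x, q (h x) = be x) -> split_mono i.
Proof.
move=> [ainj aq qsurj] [iinj ip psurj] gi.
have [|be beE] := @factor_surj _ _ _ _ p (q \o g) psurj.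
  by move=> x /ip[y <-]; rewrite /= gi (exact_comp0 _ aq).
exists be => -[h hE]; have [d dE] := ex_sub_map g (h \o p).
have [|r rE] := @factor_inj _ _ _ _ a d ainj.
  by move=> x; apply/aq; rewrite dE linearB /= hE beE subrr.
exists r => x; apply: ainj.
by rewrite rE dE gi /= (exact_comp0 _ ip) linear0 subr0.
Qed.

(** * The almost split sequence with given right end *)

Section RightEnd.

Hypothesis hP : contravariantly_finite (@Pinf L).
Hypothesis transpose : forall n K (u : {linear K -> ('I_n -> L^o)}), injective u ->
  exists W, fin_gen W /\ forall X (al : {linear K -> X}), fin_gen X ->
    ~ (exists h : {linear ('I_n -> L^o) -> X}, forall k, h (u k) = al k) ->
    exists g : {linear X -> W},
    ~ (exists h : {linear ('I_n -> L^o) -> W}, forall k, h (u k) = g (al k)).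
Hypothesis orbit_min : forall K F W (u : {linear K -> F}), fin_gen K -> fin_gen W ->
  (exists al : {linear K -> W}, ~ exists h : {linear F -> W}, forall x, h (u x) = al x) ->
  exists al : {linear K -> W},
    ~ (exists h : {linear F -> W}, forall x, h (u x) = al x) /\
    forall h : {linear W -> W},
      ~ (exists k : {linear F -> W}, forall x, k (u x) = h (al x)) ->
      exists (k : {linear W -> W}) (l : {linear F -> W}),
        forall x, al x = k (h (al x)) + l (u x).

Lemma right_end C : Pinf C -> indecomposable C ->
  (exists X, Pinf X /\ Ext1_neq0 C X) ->
  exists A B (u : {linear A -> B}) (v : {linear B -> C}), almost_split (@Pinf L) u v.
Proof.
move=> CP Cind [X0 [X0P [B0 [i0 [p0 [ips0 nsplit0]]]]]].
have [n [c csurj]] := fin_gen_cover (proj1 CP); have [K [k kcs]] := ses_ker csurj.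
have [kinj kc _] := kcs.
have Kfg : fin_gen K := fin_gen_submod Llen kinj (fin_gen_free L n).
have [W0 [W0fg W0E]] := transpose kinj.
have [W [pw [WP pwE]]] := hP W0fg.
(* The module [W0] need not lie in P^oo, but a detecting map X -> [W0] factors through its
   approximation W, which therefore detects too. *)
have WE X (al : {linear K -> X}) : Pinf X ->
    ~ (exists h : {linear ('I_n -> L^o) -> X}, forall x, h (k x) = al x) ->
    exists g : {linear X -> W},
    ~ (exists h : {linear ('I_n -> L^o) -> W}, forall x, h (k x) = g (al x)).
  move=> XP /(W0E X al (proj1 XP))[g gE]; have [g' g'E] := pwE X g XP.
  exists g' => -[h hE]; apply: gE; exists (pw \o h) => x.
  by rewrite /= hE g'E.
have [al0 al0E] := syzygy_class kcs (@free_projective L n) ips0.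
have [|g0 g0E] := WE X0 al0 X0P; first by move=> /al0E/(splits_mono ips0).
have [|al [alE almin]] := orbit_min (u := k) Kfg (proj1 WP).
  by exists (g0 \o al0).
have Wl := Llen (proj1 WP).
(* V is a shortest summand of W in which the component of the class al is nonzero; it becomes the
   left end. *)
have [|m [[V [j [e [ej eal Vm]]]] mmin]] := @least_nat (fun m => exists V
  (j : {linear V -> W}) (e : {linear W -> V}), [/\ cancel j e,
    ~ (exists h : {linear ('I_n -> L^o) -> V}, forall x, h (k x) = e (al x))
    & length_le m V]).
  by have [m Wm] := Wl; exists m, W, idfun, idfun.
have VP : Pinf V by apply: (Pinf_summand (f := j)) WP; exists e.
have Vl : finite_length V by exists m.
have Vmin U (i : {linear U -> V}) (r : {linear V -> U}) : cancel i r ->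
    ~ (exists h : {linear ('I_n -> L^o) -> U}, forall x, h (k x) = r (e (al x))) -> surj i.
  move=> ir rE; apply: contrapT => ins.
  have [Um m0] := proper_sub_length (can_inj ir) ins Vm.
  have : (m <= m.-1)%N; last by case: m m0 {Vm mmin Um} => // m _; rewrite ltnn.
  apply: mmin; exists U, (j \o i), (r \o e); split=> //.
  by move=> x; rewrite /= ej ir.
(* If V = U1 (+) U2, the class survives in one component, which by minimality is all of V. *)
have Vind : indecomposable V.
  split.
    apply: contrapT => /forallNP V0; apply: eal; exists \0 => x.
    by have := V0 (e (al x)); move=> /negP; rewrite negbK => /eqP ->.
  move=> U1 U2 f [f' ff' f'f].
  have finj := can_inj ff'; have fsurj : surj f by move=> y; exists (f' y).
  have [h [fh hf]] := ex_inverse finj fsurj.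
  have [i1 i1E] := ex_inl U1 U2; have [i2 i2E] := ex_inr U1 U2.
  have [p1 p1E] := ex_fst U1 U2; have [p2 p2E] := ex_snd U1 U2.
  have [ext1|next1] := pselect (exists h1 : {linear ('I_n -> L^o) -> U1},
      forall x, h1 (k x) = p1 (h (e (al x)))); last first.
    right=> y; have [||x xE] := @Vmin U1 (f \o i1) (p1 \o h) _ _ (f (0, y)) => //.
      by move=> x; rewrite /= fh i1E p1E.
    by have /finj := xE; rewrite i1E => -[_ <-].
  have [ext2|next2] := pselect (exists h1 : {linear ('I_n -> L^o) -> U2},
      forall x, h1 (k x) = p2 (h (e (al x)))); last first.
    left=> y; have [||x xE] := @Vmin U2 (f \o i2) (p2 \o h) _ _ (f (y, 0)) => //.
      by move=> x; rewrite /= fh i2E p2E.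
    by have /finj := xE; rewrite i2E => -[<-].
  case: ext1 ext2 => h1 h1E [h2 h2E]; case: eal.
  have [l lE] := ex_pair h1 h2; exists (f \o l) => x.
  by rewrite /= lE h1E h2E p1E p2E -surjective_pairing hf.
have leftV X (f : {linear V -> X}) : Pinf X -> ~ split_mono f ->
    exists h : {linear ('I_n -> L^o) -> X}, forall x, h (k x) = f (e (al x)).
  move=> XP fnsplit; apply: contrapT => next.
  have [g gE] := WE X (f \o e \o al) XP next.
  (* Minimality of the orbit brings the detected class back to al, so that e al = ph e al up to
     extendable maps, where ph factors through f. A bijective ph would split f, a nilpotent one
     would annihilate the class. *)
  have [k' [l klE]] := almin (g \o f \o e) gE.
  pose ph := e \o k' \o g \o f.
  have [[phinj phsurj]|[N phN]] := indecomposable_endo ph Vl Vind.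
    have [w [wph phw]] := ex_inverse phinj phsurj.
    by apply: fnsplit; exists (w \o e \o k' \o g).
  have [l' l'E] : exists l' : {linear ('I_n -> L^o) -> V},
      forall x, e (al x) = iter N ph (e (al x)) + l' (k x).
    elim: {phN} N => [|N [l' l'E]]; first by exists \0 => x; rewrite /= addr0.
    have [s sE] := ex_add (ph \o l') (e \o l); exists s => x.
    rewrite {1}klE linearD sE /= addrA; congr (_ + _).
    by rewrite -(linearD ph) -l'E.
  by apply: eal; exists l' => x; rewrite [RHS]l'E phN add0r.
have [B [u [v [q [uvs qk vq usplit univ]]]]] := ses_pushout (e \o al) kcs.
have BP := Pinf_ext uvs VP CP.
exists V, B, u, v; apply: left_almost_split => //; first by move=> /usplit.
move=> X f XP /(leftV X f XP)[h hE].
by have [|g [gu _]] := univ X f h; [move=> x; rewrite hE|exists g].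
Qed.

End RightEnd.

(** * The almost split sequence with given left end *)

Section LeftEnd.

Hypothesis hC : covariantly_finite (@Pinf L).
Variable D : lmodType L.
Hypothesis Dfg : fin_gen D.
Hypothesis Dext : forall Z, fin_gen Z -> ext_vanish Z D.
Hypothesis Demb : forall M, fin_gen M ->
  exists n (g : {linear M -> ('I_n -> D)}), injective g.
Hypothesis transpose : forall n A B (u : {linear A -> ('I_n -> D)})
    (v : {linear ('I_n -> D) -> B}), short_exact u v ->
  exists M, fin_gen M /\ forall X (be : {linear X -> B}), fin_gen X ->
    ~ (exists h : {linear X -> ('I_n -> D)}, forall x, v (h x) = be x) ->
    exists g : {linear M -> X},
    ~ (exists h : {linear M -> ('I_n -> D)}, forall x, v (h x) = be (g x)).
Hypothesis orbit_min : forall N F W (v : {linear F -> W}), fin_gen N -> fin_gen W ->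
  (exists be : {linear N -> W}, ~ exists h : {linear N -> F}, forall x, v (h x) = be x) ->
  exists be : {linear N -> W},
    ~ (exists h : {linear N -> F}, forall x, v (h x) = be x) /\
    forall h : {linear N -> N},
      ~ (exists k : {linear N -> F}, forall x, v (k x) = be (h x)) ->
      exists (k : {linear N -> N}) (l : {linear N -> F}),
        forall x, be x = be (h (k x)) + v (l x).

Lemma left_end A : Pinf A -> indecomposable A ->
  (exists X, Pinf X /\ Ext1_neq0 X A) ->
  exists B C (u : {linear A -> B}) (v : {linear B -> C}), almost_split (@Pinf L) u v.
Proof.
move=> AP Aind [X0 [X0P [B0 [i0 [p0 [ips0 nsplit0]]]]]].
have [n [a ainj]] := Demb (proj1 AP); have [Q [q aqs]] := ses_coker ainj.
have [_ aq qsurj] := aqs.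
have Qfg : fin_gen Q := fin_gen_quo qsurj (fin_gen_pow n Dfg).
have [M [Mfg ME]] := transpose aqs.
have [N [io [NP ioE]]] := hC Mfg.
have NE X (be : {linear X -> Q}) : Pinf X ->
    ~ (exists h : {linear X -> ('I_n -> D)}, forall x, q (h x) = be x) ->
    exists g : {linear N -> X},
    ~ (exists h : {linear N -> ('I_n -> D)}, forall x, q (h x) = be (g x)).
  move=> XP /(ME X be (proj1 XP))[g gE]; have [g' g'E] := ioE X g XP.
  exists g' => -[h hE]; apply: gE; exists (h \o io) => x.
  by rewrite /= hE g'E.
have [g0 g0E] := ext_vanish_extend a ips0 (@ext_vanish_pow L n X0 D (Dext (proj1 X0P))).
have [be0 be0E] := cosyzygy_class aqs ips0 g0E.
have [|h0 h0E] := NE X0 be0 X0P; first by move=> /be0E/(splits_mono ips0).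
have [|be [beE bemin]] := orbit_min (v := q) (proj1 NP) Qfg.
  by exists (be0 \o h0).
have Nl := Llen (proj1 NP).
(* V is a shortest summand of N to which the class be restricts nontrivially; it becomes the right
   end. *)
have [|m [[V [j [e [ej jbe Vm]]]] mmin]] := @least_nat (fun m => exists V
  (j : {linear V -> N}) (e : {linear N -> V}), [/\ cancel j e,
    ~ (exists h : {linear V -> ('I_n -> D)}, forall x, q (h x) = be (j x))
    & length_le m V]).
  by have [m Nm] := Nl; exists m, N, idfun, idfun.
have VP : Pinf V by apply: (Pinf_summand (f := j)) NP; exists e.
have Vl : finite_length V by exists m.
have Vmin U (i : {linear U -> V}) (r : {linear V -> U}) : cancel i r ->
    ~ (exists h : {linear U -> ('I_n -> D)}, forall x, q (h x) = be (j (i x))) -> surj i.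
  move=> ir rE; apply: contrapT => ins.
  have [Um m0] := proper_sub_length (can_inj ir) ins Vm.
  have : (m <= m.-1)%N; last by case: m m0 {Vm mmin Um} => // m _; rewrite ltnn.
  apply: mmin; exists U, (j \o i), (r \o e); split=> //.
  by move=> x; rewrite /= ej ir.
have Vind : indecomposable V.
  split.
    apply: contrapT => /forallNP V0; apply: jbe; exists \0 => x.
    by have := V0 x; move=> /negP; rewrite negbK => /eqP ->; rewrite !linear0.
  move=> U1 U2 f [f' ff' f'f].
  have finj := can_inj ff'; have fsurj : surj f by move=> y; exists (f' y).
  have [h [fh hf]] := ex_inverse finj fsurj.
  have [i1 i1E] := ex_inl U1 U2; have [i2 i2E] := ex_inr U1 U2.
  have [p1 p1E] := ex_fst U1 U2; have [p2 p2E] := ex_snd U1 U2.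
  have [lift1|nlift1] := pselect (exists h1 : {linear U1 -> ('I_n -> D)},
      forall x, q (h1 x) = be (j (f (i1 x)))); last first.
    right=> y; have [||x xE] := @Vmin U1 (f \o i1) (p1 \o h) _ _ (f (0, y)) => //.
      by move=> x; rewrite /= fh i1E p1E.
    by have /finj := xE; rewrite i1E => -[_ <-].
  have [lift2|nlift2] := pselect (exists h1 : {linear U2 -> ('I_n -> D)},
      forall x, q (h1 x) = be (j (f (i2 x)))); last first.
    left=> y; have [||x xE] := @Vmin U2 (f \o i2) (p2 \o h) _ _ (f (y, 0)) => //.
      by move=> x; rewrite /= fh i2E p2E.
    by have /finj := xE; rewrite i2E => -[<-].
  case: lift1 lift2 => h1 h1E [h2 h2E]; case: jbe.
  have [l lE] := ex_copair h1 h2; exists (l \o h) => x.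
  rewrite /= [h x]surjective_pairing lE linearD h1E h2E -!linearD i1E i2E.
  rewrite -[in RHS](hf x); congr (be (j (f _))).
  by rewrite [RHS]surjective_pairing; congr pair; rewrite /= ?addr0 ?add0r.
have rightV X (f : {linear X -> V}) : Pinf X -> ~ split_epi f ->
    exists h : {linear X -> ('I_n -> D)}, forall x, q (h x) = be (j (f x)).
  move=> XP fnsplit; apply: contrapT => next.
  have [g gE] := NE X (be \o j \o f) XP next.
  (* Restricted to V, minimality reads be j = be j ph up to liftable maps, where ph ends with f. A
     bijective ph makes f a split epimorphism, a nilpotent one makes be j liftable. *)
  have [k' [l klE]] := bemin (j \o f \o g) gE.
  pose ph := f \o g \o k' \o j.
  have [[phinj phsurj]|[m' phN]] := indecomposable_endo ph Vl Vind.
    have [w [wph phw]] := ex_inverse phinj phsurj.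
    by apply: fnsplit; exists (g \o k' \o j \o w).
  have [l' l'E] : exists l' : {linear V -> ('I_n -> D)},
      forall x, be (j x) = be (j (iter m' ph x)) + q (l' x).
    elim: {phN} m' => [|m' [l' l'E]]; first by exists \0 => x; rewrite /= linear0 addr0.
    have [p pE] := ex_iter ph m'.
    have [s sE] := ex_add (l \o j \o p) l'; exists s => x.
    by rewrite [LHS]l'E klE sE linearD addrA /= pE.
  by apply: jbe; exists l' => x; rewrite [RHS]l'E phN !linear0 add0r.
have [B [u [v [p [uvs pu qp usplit univ]]]]] := ses_pullback (be \o j) aqs.
have BP := Pinf_ext uvs AP VP.
exists B, V, u, v; apply: right_almost_split => //; first by move=> /usplit.
move=> X f XP /(rightV X f XP)[h hE].
by have [|g gE] := univ X h f; [move=> x; rewrite hE|exists g => x; case: (gE x)].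
Qed.

End LeftEnd.

End AlmostSplit.

Theorem corollary4p5 (L : pzRingType) (hL : artin_algebra L)
    (hP : contravariantly_finite (@Pinf L)) :
  covariantly_finite (@Pinf L) /\ has_almost_split_sequences (@Pinf L).
Proof.
have [R [phi [Rart phiC Lfg]]] := hL.
have Rlen := finite_length_regular Rart.
have [E [E1 Emax]] := ex_maximal_multiplicity1 Rlen.
have Llen M := @fin_gen_finite_length R L phi Rlen Lfg M.
have Dfg := fin_gen_dual phiC Rlen Lfg E1.
have Dinj := @dual_injective R L phi phiC E Rlen Lfg E1 Emax.
have Demb := @dual_embedding R L phi E Rlen Lfg E1 Emax.
have Dtr := @dual_transpose R L phi phiC E Rlen Lfg E1 Emax.
have trD := @transpose_dual R L phi phiC E Rlen Lfg E1 Emax.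
have happ := hom_approximation phiC Rlen Lfg.
have hC := Pinf_covariantly_finite Llen hP Dfg Dinj Demb happ.
split=> //; split.
  exact: right_end Llen hP Dtr (nonextendable_min phiC Rlen Lfg).
have Dext := ext_vanish_injective Dfg Dinj.
exact: (@left_end L Llen hC (dual phi E) Dfg Dext Demb trD (nonliftable_min phiC Rlen Lfg)).
Qed.
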